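(* There exists an absolute constant $\mathcal{Q}>0$ such that the following is true. Let $\mathbf{K}$ be a field with odd characteristic. Let $E$ be an elliptic curve over $\mathbf{K}$, given by a Weierstrass equation. Let $\delta\geqslant 1$ be an integer. Let $t$ be a point of order $d=2^\delta$ in $E(\mathbf{K})$. Let $b$ be a point in $E(\mathbf{K})$ such that $db\neq O$. There exists a straight-line program that, on input $d$ scalars $(\alpha_l)_{0\leqslant l\leqslant d-1}$ in $\mathbf{K}$, computes a function $f\in\mathcal{L}(\langle t\rangle)$, given by its coordinates in either of the bases $u=(u_l)_{l\in\mathbf{Z}/d\mathbf{Z}}$ or $v=(v_l)_{l\in\mathbf{Z}/d\mathbf{Z}}$ of $\mathcal{L}(\langle t\rangle)$, such that $f(b+lt)=\alpha_l$ for every $l\in[0,d-1]$, at the expense of at most $\mathcal{Q}\,d\log(d)$ operations in $\mathbf{K}$.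
   Context: **Curve and functions.** $E$ is given by $Y^2Z+a_1XYZ+a_3YZ^2=X^3+a_2X^2Z+a_4XZ^2+a_6Z^3$ over $\mathbf{K}$, with $O=(0:1:0)$ the point at infinity (the neutral element), and $x=X/Z$, $y=Y/Z$. For a point $A$ on $E$, $\tau_A$ denotes the translation by $A$, and $x_A=x\circ\tau_{-A}$, $y_A=y\circ\tau_{-A}$. For two distinct points $A,B$ on $E$, $$u_{A,B}=\frac{y_A-y(A-B)}{x_A-x(A-B)},$$ a function on $E$ with polar divisor $[A]+[B]$. **The space.** $\langle t\rangle$ is the group generated by $t$, also seen as the effective divisor $\sum_{0\leqslant l\leqslant d-1}[lt]$ of degree $d$ on $E$; $\mathcal{L}(\langle t\rangle)$ is the associated $\mathbf{K}$-linear (Riemann–Roch) space, of dimension $d$. **The bases.** The sum $\mathfrak{a}=\sum_{l\in\mathbf{Z}/d\mathbf{Z}}u_{lt,(l+1)t}$ is a constant in $\mathbf{K}$. For $l\in\mathbf{Z}/d\mathbf{Z}$ set $u_l=u_{lt,(l+1)t}+(1-\mathfrak{a})/d$. Set $v_0=1$ and $v_l=u_{O,lt}$ for $l\neq 0\bmod d$. Both $u=(u_l)_{l\in\mathbf{Z}/d\mathbf{Z}}$ and $v=(v_l)_{l\in\mathbf{Z}/d\mathbf{Z}}$ are bases of $\mathcal{L}(\langle t\rangle)$. **Straight-line programs.** A straight-line program over $\mathbf{K}$ is a finite sequence of operations, without loops or conditionals, involving the inputs, precomputed constants in $\mathbf{K}$ (which may depend on $\mathbf{K},E,t,b$ but not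 on the input), and previously computed elements; here the operations are additions and multiplications by precomputed constants in $\mathbf{K}$. Its complexity is the number of operations. Precomputation of constants is not counted. *)

(* Defs.v *)
From mathcomp Require Import all_boot all_order all_algebra.
From mathcomp Require Import polyXY qpoly qfpoly.
From mathcomp Require Import ring zify.

Set Implicit Arguments.
Unset Strict Implicit.
Unset Printing Implicit Defensive.

Import Order.TTheory GRing.Theory Num.Theory.
Local Open Scope ring_scope.

(* y^2 + a1 x y + a3 y = x^3 + a2 x^2 + a4 x + a6 *)
Record weierstrass (F : Type) := Weierstrass {
  wa1 : F; wa2 : F; wa3 : F; wa4 : F; wa6 : F }.

Definition map_weierstrass (F L : Type) (phi : F -> L) (E : weierstrass F) :=
  Weierstrass (phi (wa1 E)) (phi (wa2 E)) (phi (wa3 E)) (phi (wa4 E))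
    (phi (wa6 E)).

(* [None] is the point at infinity (0:1:0), [Some (x, y)] is (x:y:1). *)
Definition point (F : Type) : Type := option (F * F).

Definition map_point (F L : Type) (phi : F -> L) (P : point F) : point L :=
  omap (fun xy => (phi xy.1, phi xy.2)) P.

Section Curve.
Variables (F : fieldType) (E : weierstrass F).

Definition disc : F :=
  let b2 := wa1 E ^+ 2 + 4%:R * wa2 E in
  let b4 := 2%:R * wa4 E + wa1 E * wa3 E in
  let b6 := wa3 E ^+ 2 + 4%:R * wa6 E in
  let b8 := wa1 E ^+ 2 * wa6 E + 4%:R * wa2 E * wa6 E - wa1 E * wa3 E * wa4 E
            + wa2 E * wa3 E ^+ 2 - wa4 E ^+ 2 in
  - b2 ^+ 2 * b8 - 8%:R * b4 ^+ 3 - 27%:R * b6 ^+ 2 + 9%:R * b2 * b4 * b6.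

Definition on_curve (P : point F) : bool :=
  if P is Some (x, y) then
    y ^+ 2 + wa1 E * x * y + wa3 E * y
      == x ^+ 3 + wa2 E * x ^+ 2 + wa4 E * x + wa6 E
  else true.

(* Affine coordinates; the value 0 at infinity is junk. *)
Definition xco (P : point F) : F := if P is Some (x, _) then x else 0.
Definition yco (P : point F) : F := if P is Some (_, y) then y else 0.

Definition negpt (P : point F) : point F :=
  if P is Some (x, y) then Some (x, - y - wa1 E * x - wa3 E) else None.

Definition slope (x1 y1 x2 y2 : F) : F :=
  if x1 == x2 then
    (3%:R * x1 ^+ 2 + 2%:R * wa2 E * x1 + wa4 E - wa1 E * y1)
      / (2%:R * y1 + wa1 E * x1 + wa3 E)
  else (y1 - y2) / (x1 - x2).

(* The chord-and-tangent law; meaningful for points satisfying [on_curve]. *)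
Definition addpt (P Q : point F) : point F :=
  match P, Q with
  | None, _ => Q
  | _, None => P
  | Some (x1, y1), Some (x2, y2) =>
      if (x1 == x2) && (y1 == - y2 - wa1 E * x2 - wa3 E) then None
      else
        let m := slope x1 y1 x2 y2 in
        let x3 := m ^+ 2 + wa1 E * m - wa2 E - x1 - x2 in
        Some (x3, - (m * (x3 - x1) + y1) - wa1 E * x3 - wa3 E)
  end.

Definition subpt (P Q : point F) : point F := addpt P (negpt Q).

Definition mulpt (n : nat) (P : point F) : point F := iter n (addpt P) None.

Definition has_order (P : point F) (d : nat) : Prop :=
  [/\ (0 < d)%N, mulpt d P = None
    & forall k : nat, (0 < k < d)%N -> mulpt k P <> None].

End Curve.

Section FunctionField.
Variables (K : fieldType) (E : weierstrass K).

Definition ratfun : fieldType := {fraction {poly K}}.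
Definition rcst (c : K) : ratfun := @FracField.tofrac {poly K} c%:P.
Definition rX : ratfun := @FracField.tofrac {poly K} 'X.

(* The Weierstrass equation as a polynomial in y over K(x). *)
Definition wlin : {poly K} := (wa1 E)%:P * 'X + (wa3 E)%:P.
Definition wcub : {poly K} :=
  'X^3 + (wa2 E)%:P * 'X^2 + (wa4 E)%:P * 'X + (wa6 E)%:P.
Definition wpoly : {poly ratfun} :=
  'X^2 + (@FracField.tofrac {poly K} wlin)%:P * 'X
       - (@FracField.tofrac {poly K} wcub)%:P.



Lemma size_wlin : (size wlin <= 2)%N.
Proof.
rewrite /wlin size_MXaddC; case: ifP => // _.
exact: leq_ltn_trans (size_polyC_leq1 _) _.
Qed.

Lemma size_wcub : size wcub = 4%N.
Proof.
rewrite /wcub -!addrA size_polyDl ?size_polyXn // ltnS.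
by rewrite -['X^2]/('X * 'X) mulrA addrA -mulrDl size_MXaddC; case: ifP => // _; rewrite ltnS size_MXaddC; case: ifP => // _; rewrite ltnS size_polyC_leq1.
Qed.

Lemma weierstrass_no_root (n d : {poly K}) :
  d != 0 -> n ^+ 2 + wlin * n * d != wcub * d ^+ 2.
Proof.
move=> d0; apply/eqP => e.
have c0 : wcub != 0 by rewrite -size_poly_eq0 size_wcub.
have n0 : n != 0.
  apply: contra_eq_neq e => ->; rewrite expr0n mulr0 mul0r addr0 eq_sym.
  by rewrite mulf_neq0 // expf_neq0.
have sn : size (n ^+ 2) = ((size n).-1 * 2).+1 by rewrite -size_exp -polySpred ?expf_neq0.
have sd : size (d ^+ 2) = ((size d).-1 * 2).+1 by rewrite -size_exp -polySpred ?expf_neq0.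
have sr : size (wcub * d ^+ 2) = ((size d).-1 * 2 + 4)%N.
  by rewrite size_mul ?expf_neq0 // size_wcub sd; clear; lia.
have sl : (size (wlin * n * d)%R <= (size n).-1 + (size d).-1 + 2)%N.
  rewrite -mulrA; apply: leq_trans (size_polyMleq wlin (n * d)) _.
  rewrite size_mul // (polySpred n0) (polySpred d0).
  by move: size_wlin; clear; lia.
case: (leqP (size n).-1 (size d).-1.+1) => h.
  have : (size (n ^+ 2 + wlin * n * d)%R
          <= maxn (size (n ^+ 2)%R) (size (wlin * n * d)%R))%N by exact: size_polyD.
  by rewrite e sr sn; move: h sl; clear; lia.
have : size (n ^+ 2 + wlin * n * d) = size (n ^+ 2).
  by apply: size_polyDl; rewrite sn; move: h sl; clear; lia.
by rewrite e sr sn; clear; lia.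
Qed.

Lemma ratfunP (r : ratfun) : exists n d : {poly K},
  d != 0 /\ r * @FracField.tofrac {poly K} d = @FracField.tofrac {poly K} n.
Proof.
elim/quotW: r => r; exists \n_r, \d_r; split; first exact: denom_ratioP.
unlock FracField.tofrac; rewrite -[LHS]FracField.pi_mul; apply/eqmodP => /=.
rewrite FracField.equivfE /FracField.mulf /=.
rewrite !numden_Ratio ?mulf_neq0 ?denom_ratioP //; try exact: oner_neq0.
by rewrite !mulr1 mulrC.
Qed.

Lemma wpoly_monic_irreducible : monic_irreducible_poly wpoly.
Proof.
have s : size wpoly = 3%N.
  rewrite /wpoly -addrA size_polyDl ?size_polyXn // -polyCN ltnS.
  by rewrite size_MXaddC; case: ifP => // _; rewrite ltnS size_polyC_leq1.
have m : wpoly \is monic.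
  rewrite monicE /wpoly -addrA lead_coefDl ?lead_coefXn //.
  rewrite size_polyXn -polyCN ltnS size_MXaddC.
  by case: ifP => // _; rewrite ltnS size_polyC_leq1.
split=> //; apply: cubic_irreducible; first by rewrite s.
move=> r; apply/negP; rewrite rootE /wpoly !hornerE => /eqP e.
have [n [d [d0 rd]]] := ratfunP r.
have /eqP := weierstrass_no_root n d0; apply; apply/eqP.
rewrite -(@tofrac_eq {poly K}) rmorphD !rmorphM /= -rd -subr_eq0.
move: e; set D := FracField.tofrac d.
set u := FracField.tofrac wlin; set c := FracField.tofrac wcub => e.
by apply/eqP; rewrite -[RHS](mul0r (D ^+ 2)) -e; ring.
Qed.

(* K(E) = K(x)[y] / (Weierstrass equation). *)
Definition funfield : fieldType :=
  {poly %/ wpoly with wpoly_monic_irreducible}.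

Definition fcst (c : K) : funfield := qpolyC wpoly (rcst c).
Definition fx : funfield := qpolyC wpoly rX.
Definition fy : funfield := in_qpoly wpoly 'X.

(* E over K(E), and its tautological point (x, y). *)
Definition genE : weierstrass funfield := map_weierstrass fcst E.
Definition genpt : point funfield := Some (fx, fy).

(* Functions on E are the K(E)-valued coordinates of K(E)-points, composition
   with a self-map of E being its effect on the generic point: hence
   x_A = x o tau_{-A} is the x-coordinate of (x, y) - A in E(K(E)). *)
Definition xtr (A : point K) : funfield :=
  xco (subpt genE genpt (map_point fcst A)).
Definition ytr (A : point K) : funfield :=
  yco (subpt genE genpt (map_point fcst A)).

Definition ufun (A B : point K) : funfield :=
  (ytr A - fcst (yco (subpt E A B))) / (xtr A - fcst (xco (subpt E A B))).

(* An affine chart of E around P and the coordinates of P in it: (x, y) at an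
   affine point, (x / y, 1 / y), in which O = (0, 0), at infinity. *)
Definition chart (P : point K) : funfield * funfield :=
  if P is Some _ then (fx, fy) else (fx / fy, fy^-1).
Definition chart_pt (P : point K) : K * K :=
  if P is Some xy then xy else (0, 0).

Definition eval_fun (p : {poly {poly K}}) (zw : funfield * funfield) :
    funfield := (map_poly (map_poly fcst) p).[zw.1, zw.2].

(* f is regular at P, with f(P) = c. *)
Definition value_at (f : funfield) (P : point K) (c : K) : Prop :=
  exists p q : {poly {poly K}},
    let: (z, w) := chart_pt P in
    [/\ q.[z, w] != 0,
        f = eval_fun p (chart P) / eval_fun q (chart P)
      & c = p.[z, w] / q.[z, w]].

(* The places of K(E) / K, as normalised discrete valuations trivial on K
   (equivalently the closed points of E, of any degree). The value of [ord] at
   the function 0 is junk. *)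
Record place := Place {
  ord :> funfield -> int;
  ordM : forall f g, f != 0 -> g != 0 -> ord (f * g) = ord f + ord g;
  ordD : forall f g, f != 0 -> g != 0 -> f + g != 0 ->
    Num.min (ord f) (ord g) <= ord (f + g);
  ord_cst : forall c, c != 0 -> ord (fcst c) = 0;
  ord_onto : exists2 f, f != 0 & ord f = 1 }.

Definition vanishes (v : place) (f : funfield) : bool :=
  (f == 0) || (0 < ord v f).

(* v is the place of the K-rational point P. *)
Definition centered (v : place) (P : point K) : bool :=
  vanishes v ((chart P).1 - fcst (chart_pt P).1)
  && vanishes v ((chart P).2 - fcst (chart_pt P).2).

(* Riemann-Roch space of the effective divisor \sum_(P <- D) [P]. *)
Definition in_RR (D : seq (point K)) (f : funfield) : Prop :=
  f != 0 -> forall v : place, 0 <= ord v f + (count (centered v) D)%:Z.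

Definition cyc (t : point K) (d : nat) : seq (point K) :=
  [seq mulpt E l t | l <- iota 0 d].

(* Indices in Z/dZ are represented by 0, ..., d-1; no reduction of l+1 is
   needed since t has order d. *)
Definition afun (t : point K) (d : nat) : funfield :=
  \sum_(l < d) ufun (mulpt E l t) (mulpt E l.+1 t).

Definition u_basis (t : point K) (d : nat) (l : 'I_d) : funfield :=
  ufun (mulpt E l t) (mulpt E l.+1 t) + (1 - afun t d) / d%:R.

Definition v_basis (t : point K) (d : nat) (l : 'I_d) : funfield :=
  if (l : nat) == 0%N then 1 else ufun None (mulpt E l t).

End FunctionField.

Arguments u_basis {K} E t d l.
Arguments v_basis {K} E t d l.

(* Straight-line programs over K with n inputs and m outputs. [Reg k] is the
   result of the k-th instruction; a register which has not been computed yet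
   reads as 0, that is, as a precomputed constant. *)
Section StraightLine.
Variables (K : fieldType) (n m : nat).

Inductive operand := Inp of 'I_n | Cst of K | Reg of nat.

Inductive instr := Add of operand & operand | Scale of K & operand.

Record slp := Slp { slp_code : seq instr; slp_out : 'I_m -> operand }.

Definition slp_cost (P : slp) : nat := size (slp_code P).

Section Run.
Variable input : 'I_n -> K.

Definition read (regs : seq K) (o : operand) : K :=
  match o with Inp i => input i | Cst c => c | Reg k => regs`_k end.

Definition exec (regs : seq K) (i : instr) : K :=
  match i with
  | Add o1 o2 => read regs o1 + read regs o2
  | Scale c o => c * read regs o
  end.

Definition slp_regs (P : slp) : seq K :=
  foldl (fun regs i => rcons regs (exec regs i)) [::] (slp_code P).

Definition slp_run (P : slp) (j : 'I_m) : K :=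
  read (slp_regs P) (slp_out P j).

End Run.
End StraightLine.

(* Main.v *)
(* With the functions s(P, lt), the slope of the line through P and -lt plus
   a_1/2, one has u_{O,lt} = s - a_1/2 and u_{lt,(l+1)t} is a difference of two
   such functions plus a constant, so that f is determined by a constant term
   and by the coefficients r_l of s(P, lt), its residues. The matrix of values
   of this system at the points b + kt is invertible: the product of f with
   (x - x(t)) ... (x - x((d/2) t)) has at most d + 1 poles and vanishes at d/2 t
   and at the d nodes, hence is zero by Abel's theorem because db is not O.
   The residues are computed by a fast Fourier transform. Let T = (d/2) t. The
   even part of f under translation by T is a function of the same kind on E/<T>,
   and the odd part becomes one after multiplication by h(P) = s(P, T), which is
   odd; each has d/2 unknown residues and d/2 nodes. Quotient curves are
   not needed: the descent only uses that s is a symmetric 2-cocycle whose square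
   is a sum of three values of an even function, and that s(x, y), h(x), h(y),
   h(x + y) give a function with the same properties modulo T.
   The cocycle relation and associativity come together: for a list of points of
   sum zero, the function vanishing on it is normalised to be monic at infinity,
   and its subleading coefficient is obtained by adding slopes in any order. *)

From HB Require Import structures.
Require Import Defs.
From mathcomp Require Import all_boot all_order all_algebra.
From mathcomp Require Import qfpoly.
From mathcomp Require Import ring zify.
From mathcomp Require Import reals exp.

Set Implicit Arguments.
Unset Strict Implicit.
Unset Printing Implicit Defensive.

Import Order.TTheory GRing.Theory Num.Theory.
Local Open Scope ring_scope.

(** * The function field *)

(** Multiplying the odd part by h produces a term rho h^2, where rho is the coefficient of h in that
    part. On the quotient h^2 is an abscissa, with double poles, hence not a combination of
    constants and slopes: rho must be known before the second half-size problem can be posed. The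
    interpolation problem has a unique solution at every level, so rho is a fixed linear form in the
    values of that level; evaluating it on 2m values costs O(m), which a d log d recursion absorbs.
    The constant term is a linear form for the same reason and is evaluated once, at the end. The
    condition db <> O is inherited along the tower: nb stays outside H, where n is the order of t
    modulo H. It keeps the nodes away from the poles, gives uniqueness at the first level, and
    forces h(lt) <> 0, so that residues of the odd part are recovered by division. Zeros are handled
    by explicit products of ideals in the coordinate ring, poles by applying the addition law to the
    generic point over K(E). *)

Lemma polyCMX_eq0 (F : fieldType) (a b : F) :
  a%:P + b%:P * 'X = 0 -> a = 0 /\ b = 0.
Proof.
move=> e; split; [move/(congr1 (coefp 0)): e|move/(congr1 (coefp 1)): e].
  by rewrite /= coefD coefMX !coefC /= addr0.
by rewrite /= coefD coefMX !coefC /= add0r.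
Qed.

Section FunctionFieldBasics.
Variables (K : fieldType) (E : weierstrass K).
Local Notation L := (funfield E).

Definition pc (p : {poly K}) : L := qpolyC (wpoly E) (@FracField.tofrac {poly K} p).

Lemma pc_is_zmod_morphism : zmod_morphism pc.
Proof. by move=> p q; rewrite /pc rmorphB; exact: (raddfB (qpolyC (wpoly E))). Qed.

Lemma pc_is_monoid_morphism : monoid_morphism pc.
Proof.
split=> [|p q]; rewrite /pc.
  by rewrite (rmorph1 (@FracField.tofrac {poly K})); exact: (rmorph1 (qpolyC (wpoly E))).
by rewrite (rmorphM (@FracField.tofrac {poly K})); exact: (rmorphM (qpolyC (wpoly E))).
Qed.

HB.instance Definition _ := GRing.isZmodMorphism.Build {poly K} L pc pc_is_zmod_morphism.
HB.instance Definition _ := GRing.isMonoidMorphism.Build {poly K} L pc pc_is_monoid_morphism.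

Lemma fcstE c : fcst E c = pc c%:P. Proof. by []. Qed.
Lemma fxE : fx E = pc 'X. Proof. by []. Qed.

Lemma fcst_is_zmod_morphism : zmod_morphism (fcst E).
Proof. by move=> p q; rewrite !fcstE polyCB rmorphB. Qed.

Lemma fcst_is_monoid_morphism : monoid_morphism (fcst E).
Proof. by split=> [|p q]; rewrite !fcstE ?polyCM ?rmorphM ?rmorph1. Qed.

HB.instance Definition _ := GRing.isZmodMorphism.Build K L (fcst E) fcst_is_zmod_morphism.
HB.instance Definition _ := GRing.isMonoidMorphism.Build K L (fcst E) fcst_is_monoid_morphism.

Lemma size_wpoly : size (wpoly E) = 3%N.
Proof.
rewrite /wpoly -addrA size_polyDl ?size_polyXn // -polyCN ltnS.
by rewrite size_MXaddC; case: ifP => // _; rewrite ltnS size_polyC_leq1.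
Qed.

Lemma mk_monic_wpoly : mk_monic (wpoly E) = wpoly E.
Proof. exact: (mk_monicE (wpoly_monic_irreducible E)). Qed.

Lemma pc0 : pc 0 = 0. Proof. exact: (rmorph0 pc). Qed.
Lemma pc1 : pc 1 = 1. Proof. exact: (rmorph1 pc). Qed.
Lemma pcD (p q : {poly K}) : pc (p + q) = pc p + pc q. Proof. exact: (rmorphD pc). Qed.
Lemma pcN (p : {poly K}) : pc (- p) = - pc p. Proof. exact: (rmorphN pc). Qed.
Lemma pcB (p q : {poly K}) : pc (p - q) = pc p - pc q. Proof. exact: (rmorphB pc). Qed.
Lemma pcM (p q : {poly K}) : pc (p * q) = pc p * pc q. Proof. exact: (rmorphM pc). Qed.
Lemma pcXn (p : {poly K}) n : pc (p ^+ n) = pc p ^+ n. Proof. exact: (rmorphXn pc). Qed.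

Lemma fcst0 : (fcst E) 0 = 0. Proof. exact: (rmorph0 (fcst E)). Qed.
Lemma fcst1 : (fcst E) 1 = 1. Proof. exact: (rmorph1 (fcst E)). Qed.
Lemma fcstD (p q : K) : (fcst E) (p + q) = (fcst E) p + (fcst E) q. Proof. exact: (rmorphD (fcst E)). Qed.
Lemma fcstN (p : K) : (fcst E) (- p) = - (fcst E) p. Proof. exact: (rmorphN (fcst E)). Qed.
Lemma fcstB (p q : K) : (fcst E) (p - q) = (fcst E) p - (fcst E) q. Proof. exact: (rmorphB (fcst E)). Qed.
Lemma fcstM (p q : K) : (fcst E) (p * q) = (fcst E) p * (fcst E) q. Proof. exact: (rmorphM (fcst E)). Qed.
Lemma fcstXn (p : K) n : (fcst E) (p ^+ n) = (fcst E) p ^+ n. Proof. exact: (rmorphXn (fcst E)). Qed.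
Lemma fcst_nat n : (fcst E) n%:R = n%:R. Proof. exact: (rmorph_nat (fcst E)). Qed.

Definition iq (s : {poly ratfun K}) : L := in_qpoly (wpoly E) s.

Lemma iq_is_zmod_morphism : zmod_morphism iq.
Proof. exact: (raddfB (in_qpoly (wpoly E))). Qed.

Lemma iq_is_monoid_morphism : monoid_morphism iq.
Proof.
split; first exact: (rmorph1 (in_qpoly (wpoly E))).
exact: (rmorphM (in_qpoly (wpoly E))).
Qed.

HB.instance Definition _ :=
  GRing.isZmodMorphism.Build {poly ratfun K} L iq iq_is_zmod_morphism.
HB.instance Definition _ :=
  GRing.isMonoidMorphism.Build {poly ratfun K} L iq iq_is_monoid_morphism.

Lemma iqC (a : ratfun K) : iq a%:P = qpolyC (wpoly E) a.
Proof.
apply/val_inj; rewrite [LHS]in_qpoly_small ?[RHS]qpolyCE //.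
by rewrite mk_monic_wpoly size_wpoly; exact: leq_ltn_trans (size_polyC_leq1 _) _.
Qed.

Lemma iq_pc (p : {poly K}) : iq (@FracField.tofrac {poly K} p)%:P = pc p.
Proof. exact: iqC. Qed.

Lemma iqX : iq 'X = fy E. Proof. by []. Qed.

Lemma iq_wpoly : iq (wpoly E) = 0.
Proof.
apply/val_inj => /=; rewrite mk_monic_wpoly.
exact: (Pdiv.RingMonic.rmodpp (wpoly_monic_irreducible E).2).
Qed.

Lemma fy_eq : fy E ^+ 2 + fcst E (wa1 E) * fx E * fy E + fcst E (wa3 E) * fy E
  = fx E ^+ 3 + fcst E (wa2 E) * fx E ^+ 2 + fcst E (wa4 E) * fx E + fcst E (wa6 E).
Proof.
have : fy E ^+ 2 + pc (wlin E) * fy E - pc (wcub E) = 0.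
  rewrite -iq_wpoly /wpoly -iqX -!iq_pc.
  by rewrite (rmorphB iq) (rmorphD iq) (rmorphXn iq) (rmorphM iq).
move/(canRL (subrK _)); rewrite add0r /wlin /wcub.
rewrite !pcD !pcXn !pcM => e.
rewrite !fcstE fxE [X in _ + pc (wa2 E)%:P * X]expr2 -[RHS]e.
by rewrite mulrDl addrA.
Qed.

(** The left side is represented by a polynomial of degree at most 1 in y, which is its own
    remainder modulo the Weierstrass equation. *)
Lemma pc_free (p q : {poly K}) : pc p + pc q * fy E = 0 -> p = 0 /\ q = 0.
Proof.
pose S : {poly ratfun K} :=
  (@FracField.tofrac {poly K} p)%:P + (@FracField.tofrac {poly K} q)%:P * 'X.
have sz : (size S < 3)%N.
  rewrite /S addrC size_MXaddC; case: ifP => // _.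
  by rewrite ltnS; apply: leq_ltn_trans (size_polyC_leq1 _) _.
have -> : pc p + pc q * fy E = iq S.
  by rewrite -iqX -!iq_pc -(rmorphM iq) -(rmorphD iq).
move/(congr1 val); rewrite [LHS]in_qpoly_small; last first.
  by rewrite mk_monic_wpoly size_wpoly.
rewrite -[RHS]/(0 : {poly ratfun K}) => /polyCMX_eq0 [/eqP + /eqP].
by rewrite !tofrac_eq0 => /eqP -> /eqP ->.
Qed.

Lemma pc_inj : injective pc.
Proof.
move=> p q e; apply/eqP; rewrite -subr_eq0; apply/eqP.
by apply: (proj1 (@pc_free (p - q) 0 _)); rewrite pcB pc0 mul0r addr0 e subrr.
Qed.

Lemma pc_eq0 p : (pc p == 0) = (p == 0).
Proof. by rewrite -(inj_eq pc_inj) pc0. Qed.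

Lemma fcst_inj : injective (fcst E).
Proof. by move=> a b /pc_inj /polyC_inj. Qed.

Lemma funfieldP (f : L) : exists p q r, r != 0 /\ f * pc r = pc p + pc q * fy E.
Proof.
pose A : L := qpolyC (wpoly E) (val f)`_0; pose B : L := qpolyC (wpoly E) (val f)`_1.
have Ef : f = A + B * fy E.
  have sz : (size (val f) < 3)%N.
    have /leq_trans := size_mk_monic f; apply.
    by rewrite mk_monic_wpoly size_wpoly.
  rewrite /A /B -!iqC -iqX -(rmorphM iq) -(rmorphD iq).
  apply/val_inj; rewrite [RHS]in_qpoly_small; last first.
    apply: (@leq_trans 3); last by rewrite mk_monic_wpoly size_wpoly.
    rewrite addrC size_MXaddC; case: ifP => // _.
    by rewrite ltnS; apply: leq_ltn_trans (size_polyC_leq1 _) _.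
  apply/polyP => -[|[|i]]; rewrite !(coefD, coefMX, coefC) /= ?addr0 ?add0r //.
  by rewrite nth_default // -ltnS (leq_trans sz).
have [n0 [d0 [d0_neq e0]]] := ratfunP (val f)`_0.
have [n1 [d1 [d1_neq e1]]] := ratfunP (val f)`_1.
exists (n0 * d1), (n1 * d0), (d0 * d1); split; first by rewrite mulf_neq0.
have E0 : A * pc d0 = pc n0.
  by rewrite /pc -e0; exact/esym/(rmorphM (qpolyC (wpoly E))).
have E1 : B * pc d1 = pc n1.
  by rewrite /pc -e1; exact/esym/(rmorphM (qpolyC (wpoly E))).
rewrite {1}Ef !pcM -E0 -E1.
move: A B (pc d0) (pc d1) (fy E) {Ef E0 E1} => A B C D y.
by rewrite mulrDl -!mulrA; congr (_ + _ * _); rewrite mulrCA [RHS]mulrCA; congr (_ * _); rewrite mulrC.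
Qed.

End FunctionFieldBasics.

(** * Products of maximal ideals in the coordinate ring *)

Section CoordinateRing.
Variables (F L : fieldType) (io : {rmorphism {poly F} -> L}) (Y : L).
Variables (A2 A4 A6 : F).
Hypothesis two_neq0 : (2%:R : F) != 0.

Definition wcubic : {poly F} := 'X^3 + A2%:P * 'X^2 + A4%:P * 'X + A6%:P.

Lemma horner_cubic x : wcubic.[x] = x ^+ 3 + A2 * x ^+ 2 + A4 * x + A6.
Proof. by rewrite /wcubic !hornerE; ring. Qed.

Lemma horner_deriv_cubic x : wcubic^`().[x] = 3%:R * x ^+ 2 + A2 * x *+ 2 + A4.
Proof. by rewrite /wcubic !derivE !hornerE /=; ring. Qed.

Hypothesis hY : Y ^+ 2 = io wcubic.
Hypothesis io_free : forall p q, io p + io q * Y = 0 -> p = 0 /\ q = 0.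

Local Notation X := (io 'X).
Local Notation "c %:L" := (io c%:P) (at level 2, format "c %:L").

(** With [io] = [pc E] and [Y] = [et E] this is the affine coordinate ring. The morphism is left
    abstract because the closure lemmas serve again for the ring generated by the coordinates of a
    translate of the generic point. *)
Definition KE (f : L) : Prop := exists p q, f = io p + io q * Y.

Lemma KE_io p : KE (io p).
Proof. by exists p, 0; rewrite rmorph0 mul0r addr0. Qed.

Lemma KE_Y : KE Y.
Proof. by exists 0, 1; rewrite rmorph0 rmorph1 mul1r add0r. Qed.

Lemma KED f g : KE f -> KE g -> KE (f + g).
Proof.
move=> [p [q ->]] [r [s ->]]; exists (p + r), (q + s).
by rewrite !rmorphD; ring.
Qed.

Lemma KEM f g : KE f -> KE g -> KE (f * g).
Proof.
move=> [p [q ->]] [r [s ->]]; exists (p * r + q * s * wcubic), (p * s + q * r).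
rewrite !(rmorphD io) !(rmorphM io) -hY; ring.
Qed.

Lemma KEN f : KE f -> KE (- f).
Proof. by move=> [p [q ->]]; exists (- p), (- q); rewrite !rmorphN; ring. Qed.

Lemma KEB f g : KE f -> KE g -> KE (f - g).
Proof. by move=> hf hg; apply/KED/KEN. Qed.

(* [Van s] is the product of the ideals [(X - x, Y - y)], [(x, y)] in [s]. *)
Fixpoint Van (s : seq (F * F)) (f : L) : Prop :=
  if s is P :: s' then
    exists g1 g2, [/\ Van s' g1, Van s' g2
                    & f = (X - P.1%:L) * g1 + (Y - P.2%:L) * g2]
  else KE f.

Lemma VanD s f g : Van s f -> Van s g -> Van s (f + g).
Proof.
elim: s f g => [|P s IH] f g /=; first exact: KED.
move=> [f1 [f2 [? ? ->]]] [g1 [g2 [? ? ->]]].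
by exists (f1 + g1), (f2 + g2); split; [exact: IH|exact: IH|ring].
Qed.

Lemma VanMl s f g : KE f -> Van s g -> Van s (f * g).
Proof.
move=> hf; elim: s g => [|P s IH] g /=; first exact: KEM.
move=> [g1 [g2 [? ? ->]]].
by exists (f * g1), (f * g2); split; [exact: IH|exact: IH|ring].
Qed.

Lemma VanN s f : Van s f -> Van s (- f).
Proof. by move=> h; rewrite -mulN1r; apply: VanMl h; apply/KEN; rewrite -(rmorph1 io); apply: KE_io. Qed.

Lemma VanB s f g : Van s f -> Van s g -> Van s (f - g).
Proof. by move=> hf hg; apply/VanD/VanN. Qed.

Lemma Van_KE s f : Van s f -> KE f.
Proof.
elim: s f => [|P s IH] f //= [g1 [g2 [/IH h1 /IH h2 ->]]].
by apply: KED; apply: KEM => //; apply: KEB; [apply: KE_io..|apply: KE_Y|apply: KE_io].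
Qed.

Lemma Van0 s : Van s 0.
Proof.
elim: s => [|P s IH] /=; first by rewrite -(rmorph0 io); apply: KE_io.
by exists 0, 0; rewrite !mulr0 addr0.
Qed.

Lemma Van_swap P Q s f : Van (P :: Q :: s) f -> Van (Q :: P :: s) f.
Proof.
move=> [g1 [g2 [[a [b [ha hb ->]]] [c [d [hc hd ->]]] ->]]].
exists ((X - P.1%:L) * a + (Y - P.2%:L) * c), ((X - P.1%:L) * b + (Y - P.2%:L) * d).
by split; [exists a, c|exists b, d|ring].
Qed.

Lemma Van_cons_congr P s s' : (forall f, Van s f -> Van s' f) ->
  forall f, Van (P :: s) f -> Van (P :: s') f.
Proof. by move=> h f [a [b [/h ha /h hb ->]]]; exists a, b. Qed.

Definition lin (P : F * F) (sg : F) : L := Y - P.2%:L - sg%:L * (X - P.1%:L).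

Lemma lin_neq0 P sg : lin P sg != 0.
Proof.
apply/eqP => e.
have [] := @io_free (- P.2%:P - sg%:P * ('X - P.1%:P)) 1.
  by rewrite -[RHS]e /lin; ring.
by move=> _ /eqP; rewrite oner_eq0.
Qed.

Lemma XB_neq0 x : X - x%:L != 0.
Proof.
apply/eqP => e; have [] := @io_free ('X - x%:P) 0.
  by rewrite rmorph0 mul0r addr0 rmorphB.
by move/eqP; rewrite polyXsubC_eq0.
Qed.

Section Chord.
Variables (P Q R : F * F) (sg : F).
Hypothesis hc : wcubic = (sg%:P * ('X - P.1%:P) + P.2%:P) ^+ 2
  + ('X - P.1%:P) * ('X - Q.1%:P) * ('X - R.1%:P).
Hypothesis hQ : Q.2 = P.2 + sg * (Q.1 - P.1).
Hypothesis hR : R.2 = - (P.2 + sg * (R.1 - P.1)).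
Hypothesis hPQ : P.1 != Q.1 \/ P.1 = Q.1 /\ P.2 != 0.

Lemma chord_sqr : Y ^+ 2 = (sg%:L * (X - P.1%:L) + P.2%:L) ^+ 2
  + (X - P.1%:L) * (X - Q.1%:L) * (X - R.1%:L).
Proof. by rewrite hY hc; ring. Qed.

Lemma chord_Q2 : Q.2%:L = P.2%:L + sg%:L * (Q.1%:L - P.1%:L).
Proof. by rewrite hQ; ring. Qed.

Lemma chord_R2 : R.2%:L = - (P.2%:L + sg%:L * (R.1%:L - P.1%:L)).
Proof. by rewrite hR; ring. Qed.

(** Write I_P for the ideal of P. The line gives I_P I_Q I_(-R) = (lin), the vertical through R
    gives I_R I_(-R) = (X - x_R); the quotient of the two generators carries I_P I_Q to I_R. *)
Lemma Van_chord s f : Van (P :: Q :: s) f ->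
  Van (R :: s) (f * (X - R.1%:L) / lin P sg).
Proof.
move=> [g1 [g2 [[a [b [ha hb ->]]] [c [d [hc' hd ->]]] ->]]].
(* Modulo the curve equation, (X - x_P)(X - x_Q)(X - x_R) / lin = sg (X - x_R) + (Y - y_R), which
   gives the coefficients of [a]. Those of [b], [c], [d] follow from Y - y_P = lin + sg (X - x_P)
   and its analogue for Q. *)
exists (sg%:L * a + (X - P.1%:L + sg%:L ^+ 2) * b + (X - Q.1%:L + sg%:L ^+ 2) * c
  + (lin P sg + sg%:L * (X - P.1%:L) + sg%:L * (X - Q.1%:L) + sg%:L ^+ 3) * d).
exists (a + sg%:L * b + sg%:L * c + sg%:L ^+ 2 * d).
have K x : KE (x%:L) by apply: KE_io.
have KX x : KE (X - x%:L) by apply: KEB; apply: KE_io.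
have KY x : KE (Y - x%:L) by apply: KEB => //; apply: KE_Y.
have Kl : KE (lin P sg) by apply: KEB => //; apply: KEM.
have K2 : KE (sg%:L ^+ 2) by rewrite expr2; apply: KEM.
have K3 : KE (sg%:L ^+ 3) by rewrite exprS; apply: KEM.
split.
- by repeat first [done | apply: VanD | apply: VanMl | apply: KED | apply: KEM].
- by repeat first [done | apply: VanD | apply: VanMl].
apply: (mulIf (lin_neq0 P sg)); rewrite divfK ?lin_neq0 //.
rewrite /lin chord_Q2 chord_R2.
have := chord_sqr.
move: (X) (P.1%:L) (P.2%:L) (Q.1%:L) (R.1%:L) (sg%:L) => x p1 p2 q1 r1 m e.
apply/eqP; rewrite -subr_eq0; apply/eqP.
transitivity ((Y ^+ 2 - ((m * (x - p1) + p2) ^+ 2 + (x - p1) * (x - q1) * (x - r1)))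
  * - (a + m * b + m * c + m ^+ 2 * d)).
  ring.
by rewrite e subrr mul0r.
Qed.

(** For distinct abscissas, (X - x_P)(Y - y_Q) - (X - x_Q)(Y - y_P) = (x_Q - x_P) lin. For a
    tangent, (X - x_P)^2 (sg^2 + X - x_R) - (Y - y_P)^2 = 2 y_P lin, which is why [hPQ] then asks
    for y_P to be nonzero. *)
Lemma Van_lin s k : Van s k -> Van (P :: Q :: s) (lin P sg * k).
Proof.
move=> hk.
have K x : KE (x%:L) by apply: KE_io.
have L0 x : x != 0 -> x%:L != 0.
  by move=> hx; apply/eqP => e; have [] := @io_free x%:P 0;
    rewrite ?rmorph0 ?mul0r ?addr0 // => /eqP; rewrite polyC_eq0 (negPf hx).
case: hPQ => [nx|[ex ny]].
  have nx' : Q.1 - P.1 != 0 by rewrite subr_eq0 eq_sym.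
  have hc1 : KE ((Q.1 - P.1)^-1%:L) by [].
  pose k' := (Q.1 - P.1)^-1%:L * k.
  have hk' : Van s k' by apply: VanMl.
  exists (0 * k' + (Y - Q.2%:L) * k'), (- (X - Q.1%:L) * k' + 0 * k'); split.
  - by exists 0, k'; split; [exact: Van0| |ring].
  - by exists (- k'), 0; split; [exact: VanN|exact: Van0|ring].
  have -> : k = (Q.1%:L - P.1%:L) * k'.
    rewrite /k' mulrA -!rmorphB -rmorphM -polyCM mulfV // !rmorph1.
    by rewrite mul1r.
  by rewrite /lin chord_Q2; ring.
have e2 : (P.2 *+ 2) != 0 by rewrite -mulr_natl mulf_neq0.
pose k' := (P.2 *+ 2)^-1%:L * k.
have hk' : Van s k' by apply: VanMl.
have eQ2 : Q.2 = P.2 by rewrite hQ ex subrr mulr0 addr0.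
exists ((X - P.1%:L) * ((sg%:L ^+ 2 + X - R.1%:L) * k') + (Y - P.2%:L) * 0),
  ((X - P.1%:L) * 0 + (Y - P.2%:L) * (- k')); split.
- exists ((sg%:L ^+ 2 + X - R.1%:L) * k'), 0; split; [|exact: Van0|by rewrite eQ2 ex].
  apply: VanMl => //; apply: KEB => //; apply: KED; last exact: KE_io.
  by rewrite expr2; apply: KEM.
- by exists 0, (- k'); split; [exact: Van0|exact: VanN|rewrite eQ2 ex].
have -> : k = (P.2%:L *+ 2) * k'.
  by rewrite /k' mulrA -!rmorphMn -rmorphM -polyCM mulfV // !rmorph1 mul1r.
have := chord_sqr; rewrite -ex /lin.
move: (X) (P.1%:L) (P.2%:L) (R.1%:L) (sg%:L) => x p1 p2 r1 m e.
apply/eqP; rewrite -subr_eq0; apply/eqP.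
transitivity ((Y ^+ 2 - ((m * (x - p1) + p2) ^+ 2 + (x - p1) * (x - p1) * (x - r1)))
  * k').
  ring.
by rewrite e subrr mul0r.
Qed.

Lemma Van_chord_inv s g : Van (R :: s) g ->
  Van (P :: Q :: s) (g * lin P sg / (X - R.1%:L)).
Proof.
move=> [a [b [ha hb ->]]].
have K x : KE (x%:L) by apply: KE_io.
have -> : ((X - R.1%:L) * a + (Y - R.2%:L) * b) * lin P sg / (X - R.1%:L)
  = lin P sg * (a - sg%:L * b) + (X - P.1%:L) * ((X - Q.1%:L) * b).
  apply: (mulIf (XB_neq0 R.1)); rewrite divfK ?XB_neq0 // /lin chord_R2.
  have := chord_sqr.
  move: (X) (P.1%:L) (P.2%:L) (Q.1%:L) (R.1%:L) (sg%:L) => x p1 p2 q1 r1 m e.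
  apply/eqP; rewrite -subr_eq0; apply/eqP.
  transitivity ((Y ^+ 2 - ((m * (x - p1) + p2) ^+ 2 + (x - p1) * (x - q1) * (x - r1)))
    * b).
    ring.
  by rewrite e subrr mul0r.
apply: VanD; first by apply: Van_lin; apply: VanB => //; apply: VanMl.
exists ((X - Q.1%:L) * b), 0; split; [|exact: Van0|by rewrite mulr0 addr0].
by exists b, 0; split; [|exact: Van0|rewrite mulr0 addr0].
Qed.

End Chord.

Section Vertical.
Variables (x y : F).
Hypothesis hxy : y ^+ 2 = wcubic.[x].

(** The divided difference of the cubic at x; at X = x it takes the value of the derivative, nonzero
    at a smooth point with y = 0. *)
Definition secant : {poly F} :=
  'X^2 + x%:P * 'X + (x ^+ 2)%:P + A2%:P * ('X + x%:P) + A4%:P.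

Lemma cubic_secant : wcubic = ('X - x%:P) * secant + (y ^+ 2)%:P.
Proof.
by rewrite hxy horner_cubic /wcubic /secant; ring.
Qed.

Lemma vert_sqr : Y ^+ 2 = (X - x%:L) * io secant + y%:L ^+ 2.
Proof. by rewrite hY cubic_secant; ring. Qed.

Lemma Van_vert s f : Van ((x, y) :: (x, - y) :: s) f -> Van s (f / (X - x%:L)).
Proof.
move=> [g1 [g2 [[a [b [ha hb ->]]] [c [d [hc' hd ->]]] ->]]] /=.
have -> : ((X - x%:L) * ((X - x%:L) * a + (Y - (- y)%:L) * b)
  + (Y - y%:L) * ((X - x%:L) * c + (Y - (- y)%:L) * d)) / (X - x%:L)
  = (X - x%:L) * a + (Y + y%:L) * b + (Y - y%:L) * c + io secant * d.
  apply: (mulIf (XB_neq0 x)); rewrite divfK ?XB_neq0 // polyCN rmorphN.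
  have := vert_sqr; move: (X) (x%:L) (y%:L) (io secant) => X' x' y' s' e.
  apply/eqP; rewrite -subr_eq0; apply/eqP.
  transitivity ((Y ^+ 2 - ((X' - x') * s' + y' ^+ 2)) * d); first by ring.
  by rewrite e subrr mul0r.
have K z : KE (z%:L) by apply: KE_io.
have KX : KE (X - x%:L) by apply: KEB; apply: KE_io.
have KY : KE (Y - y%:L) by apply: KEB => //; apply: KE_Y.
have KY' : KE (Y + y%:L) by apply: KED => //; apply: KE_Y.
have Ks : KE (io secant) by apply: KE_io.
by repeat first [done | apply: VanD | apply: VanMl].
Qed.

Hypothesis smooth : y != 0 \/ wcubic^`().[x] != 0.

(** If y is nonzero, 2y (X - x) = (X - x)(Y + y) - (X - x)(Y - y) is a difference of generators. If
    y = 0, then Y^2 = (X - x) [secant], and [secant] is a nonzero constant up to a multiple of X -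
    x. *)
Lemma Van_vert_inv s g : Van s g -> Van ((x, y) :: (x, - y) :: s) (g * (X - x%:L)).
Proof.
move=> hg.
have K z : KE (z%:L) by apply: KE_io.
case: (eqVneq y 0) => [y0|ny]; last first.
  have e2 : (y *+ 2) != 0 by rewrite -mulr_natl mulf_neq0.
  pose k := (y *+ 2)^-1%:L * g.
  have hk : Van s k by apply: VanMl.
  exists ((X - x%:L) * 0 + (Y - (- y)%:L) * k), ((X - x%:L) * (- k) + (Y - (- y)%:L) * 0).
  split; first by exists 0, k; split => //; apply: Van0.
    by exists (- k), 0; split => //; [apply: VanN|apply: Van0].
  have -> : g = (y%:L *+ 2) * k.
    by rewrite /k mulrA -!rmorphMn -rmorphM -polyCM mulfV // !rmorph1 mul1r.
  by rewrite /= polyCN rmorphN; ring.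
case: smooth => [|nd]; first by rewrite y0 eqxx.
set D := wcubic^`().[x] in nd.
pose k := D^-1%:L * g.
have hk : Van s k by apply: VanMl.
have -> : g = D%:L * k.
  by rewrite /k mulrA -rmorphM -polyCM mulfV // !rmorph1 mul1r.
have eD : D%:L = io secant - (X - x%:L) * (X + x%:L *+ 2 + A2%:L).
  rewrite /D horner_deriv_cubic /secant.
  by ring.
exists ((X - x%:L) * (- (X + x%:L *+ 2 + A2%:L) * k) + (Y - (- y)%:L) * 0),
  ((X - x%:L) * 0 + (Y - (- y)%:L) * k); split.
- exists (- (X + x%:L *+ 2 + A2%:L) * k), 0; split=> //; last exact: Van0.
  apply: VanMl => //; apply/KEN/KED => //; apply: KED; first exact: KE_io.
  by rewrite mulr2n; apply: KED.
- by exists 0, k; split=> //; apply: Van0.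
rewrite eD /= polyCN rmorphN.
have := vert_sqr; move: (X) (x%:L) (y%:L) (io secant) (A2%:L) => X' x' y' s' a e.
apply/eqP; rewrite -subr_eq0; apply/eqP.
transitivity (- (Y ^+ 2 - ((X' - x') * s' + y' ^+ 2)) * k); first by ring.
by rewrite e subrr oppr0 mul0r.
Qed.

End Vertical.

(* The pole order at infinity of [io p + io q * Y] is the degree of [gr p q]:
   [X] and [Y] are given the weights 2 and 3. *)
Definition gr (p q : {poly F}) : {poly F} := (p \Po 'X^2) + (q \Po 'X^2) * 'X^3.

Lemma coef_gr p q m : (gr p q)`_m =
  if odd m then (if (m < 3)%N then 0 else q`_((m - 3)./2)) else p`_(m./2).
Proof.
rewrite /gr coefD coefMXn !coef_comp_poly_Xn // !dvdn2 !divn2.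
case: (ltnP m 3) => h3.
  by move: h3; case: m => [|[|[|m]]] //= _; rewrite addr0.
by rewrite oddB // addbT negbK; case: (odd m); rewrite ?addr0 ?add0r.
Qed.

Lemma gr_eq0 p q : gr p q = 0 -> p = 0 /\ q = 0.
Proof.
move=> e; split; apply/polyP => i; rewrite coef0.
  by have := congr1 (coefp i.*2) e; rewrite /= coef_gr odd_double coef0 doubleK.
have := congr1 (coefp (i.*2 + 3)) e.
by rewrite /= coef_gr oddD odd_double coef0 addnK doubleK ltnNge leq_addl.
Qed.

(** [tau] is the coefficient of index n - 1; the extra factor 'X gives it the value 0 when n = 0. *)
Definition topl p q n l tau := [/\ forall m, (n < m)%N -> (gr p q)`_m = 0,
  (gr p q)`_n = l & ('X * gr p q)`_n = tau].

Lemma topl_uniq p q n l tau n' l' tau' : l != 0 -> l' != 0 ->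
  topl p q n l tau -> topl p q n' l' tau' -> [/\ n = n', l = l' & tau = tau'].
Proof.
move=> l0 l0' [h e et] [h' e' et']; case: (ltngtP n n') => hl.
- by rewrite -e' (h _ hl) eqxx in l0'.
- by rewrite -e (h' _ hl) eqxx in l0.
by split=> //; [rewrite -e -e' hl|rewrite -et -et' hl].
Qed.

Lemma topl_exists p q : (p, q) != (0, 0) ->
  exists n l tau, l != 0 /\ topl p q n l tau.
Proof.
move=> h; have g0 : gr p q != 0.
  by apply/eqP => /gr_eq0 [ep eq]; rewrite ep eq eqxx in h.
exists (size (gr p q)).-1, (lead_coef (gr p q)), ('X * gr p q)`_(size (gr p q)).-1.
rewrite lead_coef_eq0; split=> //; split=> // m hm.
by apply: nth_default; rewrite (polySpred g0).
Qed.

Lemma topl_vert p q n l tau c : topl p q n l tau ->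
  topl (p * ('X - c%:P)) (q * ('X - c%:P)) n.+2 l tau.
Proof.
have eg : gr (p * ('X - c%:P)) (q * ('X - c%:P)) = gr p q * ('X^2 - c%:P).
  by rewrite /gr !comp_polyM !comp_polyB comp_polyX comp_polyC; ring.
move=> [h e e']; rewrite /topl eg.
have E m : (gr p q * ('X^2 - c%:P))`_m.+2 = (gr p q)`_m - (gr p q)`_m.+2 * c.
  by rewrite mulrBr coefB coefMC coefMXn /= subn2.
split; first by move=> [|[|m]] // hm; rewrite E !h ?mul0r ?subrr // ltnW // ltnW.
  by rewrite E e h ?mul0r ?subr0 // ltnW.
rewrite mulrA; case: n => [|n] in h e e' *.
  rewrite coefXM in e'; rewrite mulrBr coefB coefMC coefMXn /= coefXM.
  by rewrite -e' /= coefXM /= h // mul0r subr0.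
rewrite mulrBr coefB coefMC coefMXn /= subn2 /= e'.
by rewrite coefXM /= h ?mul0r ?subr0.
Qed.

(** With Y read as T^3 and X as T^2, the line multiplies by T^3 - sg T^2 - n0. The reading is not
    multiplicative, because Y^2 is the full cubic, but A2, A4, A6 enter at least two degrees below
    the top and leave [tau] alone. This is what makes slopes additive. *)
Lemma topl_lin p q n (l tau x y sg : F) : topl p q n l tau ->
  topl (q * wcubic - (sg%:P * 'X + (y - sg * x)%:P) * p)
       (p - (sg%:P * 'X + (y - sg * x)%:P) * q) n.+3 l (tau - sg * l).
Proof.
set p' := q * _ - _; set q' := p - _; set n0 := y - sg * x.
have eg : gr p' q' = 'X^3 * gr p q - sg *: ('X^2 * gr p q) - n0 *: gr p q
    + (A2 *: ((q \Po 'X^2) * 'X^4) + A4 *: ((q \Po 'X^2) * 'X^2) + A6 *: (q \Po 'X^2)).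
  rewrite -!mul_polyC /gr /p' /q' /n0 /wcubic !comp_polyB !(comp_polyB, comp_polyD, comp_polyM) !comp_polyX !comp_polyC.
  ring.
move=> [h e e'].
have hq m : (n < m + 3)%N -> (q \Po 'X^2)`_m = 0.
  move=> hm; rewrite coef_comp_poly_Xn // dvdn2 divn2; case: ifP => // om.
  have := h _ hm; rewrite coef_gr oddD (negPf om) /= ltnNge leq_addl /= addnK.
  by [].
have R m : (n < m.+1)%N -> (A2 *: ((q \Po 'X^2) * 'X^4) + A4 *: ((q \Po 'X^2) * 'X^2)
    + A6 *: (q \Po 'X^2))`_m.+2 = 0.
  move=> hm.
  have hk k : (k <= 4)%N -> ((q \Po 'X^2) * 'X^k)`_m.+2 = 0.
    by move=> hk; rewrite coefMXn; case: ifP => // _; apply: hq; lia.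
  by rewrite !coefD !coefZ !hk // hq ?mulr0 ?addr0 //; lia.
have s3 m : (m.+3 - 3 = m)%N by lia.
have E m : (n <= m)%N -> (gr p' q')`_m.+3 = (gr p q)`_m.
  move=> hm; rewrite eg coefD R; last lia.
  rewrite addr0 !coefB !coefZ !coefXnM /= s3 (h m.+3) ?mulr0 ?subr0; last lia.
  by rewrite subn2 /= (h m.+1) ?mulr0 ?subr0 //; lia.
split; first by move=> [|[|[|m]]] // hm; rewrite E ?h //; apply: ltnW.
  by rewrite E.
rewrite coefXM /= eg coefD R // addr0 !coefB !coefZ !coefXnM /= subn2 /=.
rewrite e (h n.+2) ?mulr0 ?subr0; last lia.
rewrite -e' coefXM; case: (n) => [|k] //=.
by have -> : (k.+3 - 3 = k)%N by lia.
Qed.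

Lemma rep_uniq p q p' q' : io p + io q * Y = io p' + io q' * Y -> p = p' /\ q = q'.
Proof.
move=> e; have [] := @io_free (p - p') (q - q').
  by rewrite !rmorphB mulrBl addrACA -opprD e subrr.
by move=> /eqP + /eqP; rewrite !subr_eq0 => /eqP-> /eqP->.
Qed.

Definition has_top f n tau := exists p q, f = io p + io q * Y /\ topl p q n 1 tau.

Lemma topl_neq0 p q n l tau : l != 0 -> topl p q n l tau -> (p, q) != (0, 0).
Proof.
move=> l0 [_ e _]; apply: contraNneq l0 => -[ep eq].
by rewrite -e ep eq /gr !comp_poly0 mul0r addr0 coef0.
Qed.

Lemma mul_vert_rep p q c : (io p + io q * Y) * (X - c%:L)
  = io (p * ('X - c%:P)) + io (q * ('X - c%:P)) * Y.
Proof. ring. Qed.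

Lemma mul_lin_rep p q P sg : (io p + io q * Y) * lin P sg
  = io (q * wcubic - (sg%:P * 'X + (P.2 - sg * P.1)%:P) * p)
    + io (p - (sg%:P * 'X + (P.2 - sg * P.1)%:P) * q) * Y.
Proof. by rewrite (rmorphB io (q * _)) (rmorphM io q) -hY /lin; ring. Qed.

Lemma has_top_vert f n tau c :
  has_top f n tau -> has_top (f * (X - c%:L)) n.+2 tau.
Proof.
move=> [p [q [-> h]]]; exists (p * ('X - c%:P)), (q * ('X - c%:P)).
by split; [exact: mul_vert_rep|exact: topl_vert].
Qed.

Lemma has_top_lin f n tau P sg :
  has_top f n tau -> has_top (f * lin P sg) n.+3 (tau - sg).
Proof.
move=> [p [q [-> h]]].
exists (q * wcubic - (sg%:P * 'X + (P.2 - sg * P.1)%:P) * p).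
exists (p - (sg%:P * 'X + (P.2 - sg * P.1)%:P) * q); split; first exact: mul_lin_rep.
by have := topl_lin P.1 P.2 sg h; rewrite mulr1.
Qed.

Lemma has_top_vert_inv f n tau c : KE f -> has_top (f * (X - c%:L)) n tau ->
  exists2 m, n = m.+2 & has_top f m tau.
Proof.
move=> [p [q ->]] [p' [q' [e h]]].
move: e h; rewrite mul_vert_rep => /rep_uniq [<- <-] h.
have : (p, q) != (0, 0).
  apply: contraTneq (topl_neq0 (oner_neq0 _) h) => -[-> ->].
  by rewrite !mul0r eqxx.
move=> /topl_exists [m [l [t [l0 hm]]]].
have [em el et] := topl_uniq l0 (oner_neq0 _) (topl_vert c hm) h.
by exists m; rewrite -?em //; exists p, q; rewrite -el -et.
Qed.

Lemma has_top_lin_inv f n tau P sg : KE f -> has_top (f * lin P sg) n tau ->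
  exists2 m, n = m.+3 & has_top f m (tau + sg).
Proof.
move=> [p [q ->]] [p' [q' [e h]]].
move: e h; rewrite mul_lin_rep => /rep_uniq [<- <-] h.
have : (p, q) != (0, 0).
  apply: contraTneq (topl_neq0 (oner_neq0 _) h) => -[-> ->].
  by rewrite !mul0r !mulr0 subrr eqxx.
move=> /topl_exists [m [l [t [l0 hm]]]].
have [em el et] := topl_uniq l0 (oner_neq0 _) (topl_lin P.1 P.2 sg hm) h.
by exists m; rewrite -?em //; exists p, q; rewrite -et el mulr1 subrK -[X in topl _ _ _ X _]el.
Qed.

(* A monic function vanishing on [s], whose pole order at infinity falls short
   of the number of its prescribed zeros by [e]; [tau] is its subleading
   coefficient. *)
Definition Prin e s tau :=
  exists f n, [/\ Van s f, has_top f n tau & (n + e)%N = size s].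

Lemma has_top0 f tau : has_top f 0 tau -> f = 1 /\ tau = 0.
Proof.
move=> [p [q [-> [h h0 ht]]]]; have := @gr_eq0 (p - 1) q.
have -> : gr (p - 1) q = 0.
  have -> : gr (p - 1) q = gr p q - 1.
    by rewrite /gr comp_polyB [1 \Po _]rmorph1; ring.
  apply/polyP => -[|i]; rewrite coefB coef1 coef0; first by rewrite h0 subrr.
  by rewrite h // subr0.
move=> [//|/eqP]; rewrite subr_eq0 => /eqP -> ->.
by rewrite -ht coefXM rmorph1 rmorph0 mul0r addr0.
Qed.

Lemma Prin_nil e tau : Prin e [::] tau <-> e = 0%N /\ tau = 0.
Proof.
split=> [[f [n [_ h /eqP]]]|[-> ->]].
  by rewrite addn_eq0 => /andP[/eqP en /eqP ->]; rewrite en in h; case: (has_top0 h).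
exists 1, 0%N; split=> //; first by rewrite /= -(rmorph1 io); apply: KE_io.
exists 1, 0; split; first by rewrite rmorph0 rmorph1 mul0r addr0.
have e1 : gr 1 0 = 1 by rewrite /gr comp_poly0 mul0r addr0 rmorph1.
by split=> [m hm||]; rewrite e1 ?mulr1 ?coefX ?coef1 //; case: m hm.
Qed.

Lemma Van1_eval P p q : P.2 ^+ 2 = wcubic.[P.1] ->
  Van [:: P] (io p + io q * Y) <-> p.[P.1] + q.[P.1] * P.2 = 0.
Proof.
move=> hP; split=> [[g1 [g2 [[p1 [q1 ->]] [p2 [q2 ->]] e]]]|e].
  have [-> ->] : p = ('X - P.1%:P) * p1 + q2 * wcubic - P.2 *: p2 /\
      q = ('X - P.1%:P) * q1 + p2 - P.2 *: q2.
    apply: rep_uniq; rewrite e -!mul_polyC.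
    by rewrite (rmorphB io (_ + _)) (rmorphD io (_ * p1)) (rmorphM io q2) -hY; ring.
  move: (wcubic) hP => c hP.
  by rewrite !(hornerE, hornerZ) -hP /=; ring.
have dvd (r : {poly F}) : exists r', r - r.[P.1]%:P = ('X - P.1%:P) * r'.
  have /factor_theorem [r' hr'] : root (r - r.[P.1]%:P) P.1.
    by rewrite rootE !hornerE subrr.
  by exists r'; rewrite hr' mulrC.
have [p' hp] := dvd p; have [q' hq] := dvd q.
exists (io p' + io q' * Y), (q.[P.1]%:L); split.
- by exists p', q'.
- exact: KE_io.
have -> : io p = (X - P.1%:L) * io p' + p.[P.1]%:L.
  by rewrite -rmorphB -rmorphM -hp rmorphB subrK.
have -> : io q = (X - P.1%:L) * io q' + q.[P.1]%:L.
  by rewrite -rmorphB -rmorphM -hq rmorphB subrK.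
have -> : p.[P.1] = - (q.[P.1] * P.2) by apply/eqP; rewrite -addr_eq0 e.
by ring.
Qed.

(* Distinct points have comaximal ideals. *)
Lemma Van_cons (P : F * F) (s : seq (F * F)) f : P \notin s -> Van s f -> Van [:: P] f -> Van (P :: s) f.
Proof.
move=> hP hs hf.
have [g [c [c0 hg hgc]]] : exists g c, [/\ c != 0, Van s g & Van [:: P] (g - c%:L)].
  elim: s hP {hs} => [|Q s IH] hP.
    exists 1, 1; split; first exact: oner_neq0.
      by rewrite /= -(rmorph1 io); apply: KE_io.
    by rewrite rmorph1 subrr; apply: Van0.
  move: hP; rewrite inE negb_or => /andP[hPQ /IH [g [c [c0 hg [a1 [a2 [ha1 ha2 hgc]]]]]]].
  have Kg := Van_KE hg.
  have K x : KE (x%:L) by apply: KE_io.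
  case: (eqVneq P.1 Q.1) => [e1|n1].
    have n2 : P.2 - Q.2 != 0.
      by rewrite subr_eq0; apply: contraNneq hPQ => e2; rewrite [P]surjective_pairing e1 e2 -surjective_pairing.
    exists ((Y - Q.2%:L) * g), ((P.2 - Q.2) * c); split; first exact: mulf_neq0.
      by exists 0, g; split=> //; [exact: Van0|ring].
    exists ((Y - Q.2%:L) * a1), ((Y - Q.2%:L) * a2 + c%:L); split.
    - by apply: KEM => //; apply: KEB => //; apply: KE_Y.
    - by apply: KED => //; apply: KEM => //; apply: KEB => //; apply: KE_Y.
    have -> : g = c%:L + (g - c%:L) by rewrite addrC subrK.
    by rewrite hgc; ring.
  have n2 : P.1 - Q.1 != 0 by rewrite subr_eq0.
  exists ((X - Q.1%:L) * g), ((P.1 - Q.1) * c); split; first exact: mulf_neq0.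
    by exists g, 0; split=> //; [exact: Van0|ring].
  exists ((X - Q.1%:L) * a1 + c%:L), ((X - Q.1%:L) * a2); split.
  - by apply: KED => //; apply: KEM => //; apply: KEB => //; apply: KE_io.
  - by apply: KEM => //; apply: KEB => //; apply: KE_io.
  have -> : g = c%:L + (g - c%:L) by rewrite addrC subrK.
  by rewrite hgc; ring.
have -> : f = c^-1%:L * (f * g - f * (g - c%:L)).
  rewrite -mulrBr opprB addrC subrK mulrCA -rmorphM -polyCM mulVf // !rmorph1.
  by rewrite mulr1.
apply: VanMl; first exact: KE_io.
apply: VanB.
  have [f1 [f2 [k1 k2 ->]]] := hf.
  by exists (f1 * g), (f2 * g); split; [apply: VanMl..|ring].
have [f1 [f2 [k1 k2 ->]]] := hgc.
by exists (f1 * f), (f2 * f); split; [apply: VanMl..|ring].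
Qed.

(** The pole order is 0 or 1. Order 1 does not occur, since [gr] has no term of degree 1; order 0
    forces the constant 1, which has no zero. *)
Lemma Prin_singleton e P tau : P.2 ^+ 2 = wcubic.[P.1] -> ~ Prin e [:: P] tau.
Proof.
move=> hP [f [[|[|n]] [hV h // ]]] _; last first.
  by case: h => [p [q [_ [_ /eqP]]]]; rewrite coef_gr /= eq_sym oner_eq0.
have [ef _] := has_top0 h; move: hV; rewrite {}ef => hV.
have := Van1_eval 1 0 hP; rewrite rmorph1 rmorph0 mul0r addr0 => /iffLR /(_ hV).
by rewrite !hornerE => /eqP; rewrite oner_eq0.
Qed.

Lemma Prin_swap e P Q s tau : Prin e (P :: Q :: s) tau -> Prin e (Q :: P :: s) tau.
Proof. by move=> [f [n [/Van_swap ? ? ?]]]; exists f, n. Qed.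

Lemma Prin_swap2 e P Q R s tau :
  Prin e (P :: Q :: R :: s) tau -> Prin e (P :: R :: Q :: s) tau.
Proof.
move=> [f [n [h ? ?]]]; exists f, n; split=> //.
by apply: Van_cons_congr h; apply: Van_swap.
Qed.

(** The factor (X - x_R) / lin changes the pole order by 2 - 3 and the number of zeros by -1, so the
    deficit [e] is kept, while [tau] gains the slope. *)
Lemma Prin_chord e P Q R sg s tau :
  wcubic = (sg%:P * ('X - P.1%:P) + P.2%:P) ^+ 2
    + ('X - P.1%:P) * ('X - Q.1%:P) * ('X - R.1%:P) ->
  Q.2 = P.2 + sg * (Q.1 - P.1) ->
  R.2 = - (P.2 + sg * (R.1 - P.1)) ->
  P.1 != Q.1 \/ P.1 = Q.1 /\ P.2 != 0 ->
  Prin e (P :: Q :: s) tau <-> Prin e (R :: s) (tau + sg).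
Proof.
move=> hc hQ hR hPQ; split=> -[f [n [hV hT hn]]].
  have hV' := Van_chord hc hQ hR hV.
  have := has_top_vert R.1 hT.
  rewrite -[f * _](divfK (lin_neq0 P sg)) => /(has_top_lin_inv (Van_KE hV')).
  move=> [k [ek] hk]; exists (f * (X - R.1%:L) / lin P sg), k; split=> //.
  by move: hn; rewrite ek /= => -[].
have hV' := Van_chord_inv hc hQ hR hPQ hV.
have := has_top_lin P sg hT; rewrite addrK.
rewrite -[f * _](divfK (XB_neq0 R.1)) => /(has_top_vert_inv (Van_KE hV')).
move=> [k [ek] hk]; exists (f * lin P sg / (X - R.1%:L)), k; split=> //.
by rewrite -ek addSn hn.
Qed.

Lemma Prin_vert e x y s tau : y ^+ 2 = wcubic.[x] ->
  y != 0 \/ wcubic^`().[x] != 0 ->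
  Prin e ((x, y) :: (x, - y) :: s) tau <-> Prin e s tau.
Proof.
move=> hxy sm; split=> -[f [n [hV hT hn]]].
  have hV' := Van_vert hxy hV.
  move: hT; rewrite -[f](divfK (XB_neq0 x)) => /(has_top_vert_inv (Van_KE hV')).
  move=> [k ek hk]; exists (f / (X - x%:L)), k; split=> //.
  by move: hn; rewrite ek /= => -[].
exists (f * (X - x%:L)), n.+2; split; [exact: Van_vert_inv|exact: has_top_vert|].
by rewrite /= -hn !addSn.
Qed.

End CoordinateRing.

(** * The group law *)

Lemma complete_square (R : comPzRingType) (x y b1 b3 b2 b4 b6 : R) :
  y ^+ 2 + (b1 + b1) * x * y + (b3 + b3) * y = x ^+ 3 + b2 * x ^+ 2 + b4 * x + b6 ->
  (y + b1 * x + b3) ^+ 2 = x ^+ 3 + (b2 + b1 ^+ 2) * (x * x)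
    + (b4 + (b1 * b3 + b1 * b3)) * x + (b6 + b3 ^+ 2).
Proof.
move=> e; have -> : x ^+ 3 = y ^+ 2 + (b1 + b1) * x * y + (b3 + b3) * y
  - b2 * x ^+ 2 - b4 * x - b6 by rewrite e; ring.
ring.
Qed.

Section GroupLaw.
Variables (F : fieldType) (E : weierstrass F).
Hypothesis two_neq0 : (2%:R : F) != 0.
Hypothesis disc_neq0 : disc E != 0.

(** Completing the square: [eta] is the ordinate for which the curve reads eta^2 = cubic and
    negation is a change of sign. *)
Definition c1 := wa1 E / 2%:R.
Definition c3 := wa3 E / 2%:R.
Definition A2 := wa2 E + c1 ^+ 2.
Definition A4 := wa4 E + c1 * c3 *+ 2.
Definition A6 := wa6 E + c3 ^+ 2.
Definition eta (x y : F) := y + c1 * x + c3.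

Lemma a1E : wa1 E = c1 *+ 2.
Proof. by rewrite -mulr_natr /c1 divfK. Qed.
Lemma a3E : wa3 E = c3 *+ 2.
Proof. by rewrite -mulr_natr /c3 divfK. Qed.

Local Notation cubic := (wcubic A2 A4 A6).

Lemma on_curveE x y : on_curve E (Some (x, y)) = (eta x y ^+ 2 == cubic.[x]).
Proof.
rewrite /on_curve horner_cubic -subr_eq0 -[RHS]subr_eq0; congr (_ == 0).
by rewrite a1E a3E /A2 /A4 /A6 /eta; ring.
Qed.

(** [disc E] is 16 times the discriminant of the cubic. A common root x of the cubic and its
    derivative expresses A4 and A6 through x and A2, and the discriminant then vanishes
    identically. *)
Lemma smooth x : cubic.[x] = 0 -> cubic^`().[x] = 0 -> False.
Proof.
rewrite horner_cubic horner_deriv_cubic => h h'; move/eqP: disc_neq0; apply.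
have e4 : A4 = - (3%:R * x ^+ 2 + A2 * x *+ 2).
  by apply/eqP; rewrite -addr_eq0 addrC h'.
have e6 : A6 = - (x ^+ 3 + A2 * x ^+ 2 + A4 * x).
  by apply/eqP; rewrite -addr_eq0 addrC h.
have -> : disc E = 16%:R * (A2 ^+ 2 * A4 ^+ 2 - 4%:R * A4 ^+ 3 - 4%:R * A2 ^+ 3 * A6
   - 27%:R * A6 ^+ 2 + 18%:R * A2 * A4 * A6).
  by rewrite /disc a1E a3E /A2 /A4 /A6; ring.
by rewrite e6 e4; ring.
Qed.

Lemma negpt_eta x y : eta x (- y - wa1 E * x - wa3 E) = - eta x y.
Proof. by rewrite /eta a1E a3E; ring. Qed.

Lemma eta_inj x y y' : eta x y = eta x y' -> y = y'.
Proof. by move/addIr/addIr. Qed.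

Lemma neg_cond x1 y1 x2 y2 :
  (x1 == x2) && (y1 == - y2 - wa1 E * x2 - wa3 E)
  = (x1 == x2) && (eta x1 y1 == - eta x2 y2).
Proof.
case: eqVneq => //= ->; rewrite -negpt_eta; apply/eqP/eqP => [-> //|].
exact: eta_inj.
Qed.

(** The slope in the coordinates (x, eta), hence the added [c1]. The value 0 for a vertical line or
    a summand O is forced: these cases leave the subleading coefficient unchanged. *)
Definition sg (P Q : point F) : F :=
  match P, Q with
  | Some (x1, y1), Some (x2, y2) =>
      if (x1 == x2) && (y1 == - y2 - wa1 E * x2 - wa3 E) then 0
      else slope E x1 y1 x2 y2 + c1
  | _, _ => 0
  end.

(** The chord case records the intersection of the line with the cubic as a polynomial identity,
    with multiplicities, so that it covers tangents as well. *)
Variant add_spec : point F -> point F -> point F -> F -> Prop :=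
  | AddOl Q : add_spec None Q Q 0
  | AddOr P : add_spec P None P 0
  | AddVert x y : eta x y ^+ 2 = cubic.[x] ->
      add_spec (Some (x, y)) (Some (x, - y - wa1 E * x - wa3 E)) None 0
  | AddChord x1 y1 x2 y2 x3 y3 s of
      cubic = (s%:P * ('X - x1%:P) + (eta x1 y1)%:P) ^+ 2
        + ('X - x1%:P) * ('X - x2%:P) * ('X - x3%:P)
      & eta x2 y2 = eta x1 y1 + s * (x2 - x1)
      & eta x3 y3 = - (eta x1 y1 + s * (x3 - x1))
      & x1 != x2 \/ x1 = x2 /\ eta x1 y1 != 0
      & s ^+ 2 = x1 + x2 + x3 + A2 :
      add_spec (Some (x1, y1)) (Some (x2, y2)) (Some (x3, y3)) s.

Lemma cubic_chord x1 x2 e1 s :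
  let x3 := s ^+ 2 - A2 - x1 - x2 in
  let a := A4 + s ^+ 2 * x1 *+ 2 - s * e1 *+ 2 - (x1 * x2 + x1 * x3 + x2 * x3) in
  let b := A6 - (e1 - s * x1) ^+ 2 + x1 * x2 * x3 in
  cubic = (s%:P * ('X - x1%:P) + e1%:P) ^+ 2
        + ('X - x1%:P) * ('X - x2%:P) * ('X - x3%:P) + (a%:P * 'X + b%:P).
Proof. by rewrite /wcubic /=; ring. Qed.

Lemma addP P Q : on_curve E P -> on_curve E Q -> add_spec P Q (addpt E P Q) (sg P Q).
Proof.
case: P => [[x1 y1]|] hP; last by constructor.
case: Q => [[x2 y2]|] hQ; last by constructor.
rewrite /addpt /sg; case: ifP => [/andP[/eqP ex /eqP ey]|nv].
  have -> : Some (x2, y2) = Some (x1, - y1 - wa1 E * x1 - wa3 E).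
    by rewrite ey ex; congr (Some (_, _)); ring.
  by constructor; apply/eqP; rewrite -on_curveE.
move: hP hQ nv; rewrite !on_curveE neg_cond => /eqP e1 /eqP e2 nv.
set m := slope E x1 y1 x2 y2; set x3 := _ - x2.
have ex3 : x3 = (m + c1) ^+ 2 - A2 - x1 - x2 by rewrite /x3 /A2 a1E; ring.
have hs : x1 != x2 \/ x1 = x2 /\ eta x1 y1 != 0.
  case: (eqVneq x1 x2) => [e|]; [right; split=> //|by left].
  move: nv; rewrite e eqxx /=; apply: contraFneq => e0.
  have : eta x2 y2 ^+ 2 = 0 by rewrite e2 -e -e1 e e0 expr0n.
  by move/eqP; rewrite expf_eq0 /= => /eqP ->; rewrite e0 oppr0.
have [hm hq] : (eta x2 y2 = eta x1 y1 + (m + c1) * (x2 - x1)) /\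
   (x1 = x2 -> (m + c1) * (eta x1 y1 *+ 2) = cubic^`().[x1]).
  rewrite /m /slope; case: eqVneq => [e|ne].
    have e0 : eta x1 y1 != 0 by case: hs => [|[]//]; rewrite e eqxx.
    have e12 : eta x2 y2 = eta x1 y1.
      move: nv; rewrite e eqxx /= => /negP nv.
      have : (eta x2 y2 - eta x1 y1) * (eta x2 y2 + eta x1 y1) = 0.
        by rewrite -subr_sqr e1 e2 e subrr.
      move/eqP; rewrite mulf_eq0 subr_eq0 addr_eq0 => /orP[/eqP ->|/eqP h]; first by rewrite e.
      by case: nv; rewrite h -e opprK.
    split=> [|_]; first by rewrite e12 e subrr mulr0 addr0.
    have ed : 2%:R * y1 + wa1 E * x1 + wa3 E = eta x1 y1 *+ 2.
      by rewrite /eta a1E a3E; ring.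
    rewrite ed mulrDl divfK; last by rewrite -mulr_natl mulf_neq0.
    by rewrite horner_deriv_cubic /eta /A2 /A4 a1E; ring.
  split; last by move=> e; case/eqP: ne.
  by rewrite /eta; field; rewrite subr_eq0.
have [] := (e1, e2); rewrite !horner_cubic => {e1}e1 {e2}e2.
have := cubic_chord x1 x2 (eta x1 y1) (m + c1); rewrite -ex3 /=.
set a := A4 + _ - _ - _; set b := A6 - _ + _ => hc.
have ha1 : a * x1 + b = 0.
  transitivity (x1 ^+ 3 + A2 * x1 ^+ 2 + A4 * x1 + A6 - eta x1 y1 ^+ 2).
    by rewrite /a /b ex3; ring.
  by rewrite e1 subrr.
(* The remainder a X + b vanishes at x1 and x2. If these coincide, [hq] says that its derivative
   vanishes instead. *)
have a0 : a = 0.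
  case: (eqVneq x1 x2) => [e|ne].
    move: (hq e); rewrite horner_deriv_cubic => /eqP; rewrite -subr_eq0 => /eqP h.
    by rewrite -oppr0 -h /a ex3 e; ring.
  have ha2 : a * x2 + b = 0.
    transitivity (x2 ^+ 3 + A2 * x2 ^+ 2 + A4 * x2 + A6 - eta x2 y2 ^+ 2).
      by rewrite hm /a /b ex3; ring.
    by rewrite e2 subrr.
  apply: (@mulIf _ (x1 - x2)); first by rewrite subr_eq0.
  by rewrite mul0r -[RHS](subrr 0) -{1}ha1 -ha2; ring.
have b0 : b = 0 by rewrite -ha1 a0 mul0r add0r.
constructor => //.
- by rewrite hc a0 b0; ring.
- by rewrite /eta a1E a3E; ring.
- by rewrite ex3; ring.
Qed.

Lemma on_curve_neg P : on_curve E P -> on_curve E (negpt E P).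
Proof.
case: P => [[x y]|] //; rewrite [on_curve _ (negpt _ _)]on_curveE on_curveE.
by rewrite negpt_eta sqrrN.
Qed.

Lemma on_curve_add P Q : on_curve E P -> on_curve E Q -> on_curve E (addpt E P Q).
Proof.
move=> hP hQ; case: (addP hP hQ) (hP) (hQ) => // x1 y1 x2 y2 x3 y3 s hc _ h3 _ _ _ _.
by rewrite on_curveE h3 hc !hornerE /= /eta; apply/eqP; ring.
Qed.

Local Notation L := (funfield E).

Definition et : L := fy E + fcst E c1 * fx E + fcst E c3.

Lemma et_sqr : et ^+ 2 = pc E cubic.
Proof.
have := fy_eq E; rewrite /et.
have -> : wa1 E = c1 *+ 2 by exact: a1E.
have -> : wa3 E = c3 *+ 2 by exact: a3E.
rewrite /wcubic !pcD !pcXn !pcM -!fcstE -[pc E _]fxE /A2 /A4 /A6 !fcstD !fcstXn.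
rewrite !fcstM.
exact: complete_square.
Qed.

Lemma et_free (p q : {poly F}) : pc E p + pc E q * et = 0 -> p = 0 /\ q = 0.
Proof.
have -> : pc E p + pc E q * et = pc E (p + q * (c1%:P * 'X + c3%:P)) + pc E q * fy E.
  have aux (R : comPzRingType) (a b y d x e : R) :
    a + b * (y + d * x + e) = (a + b * (d * x + e)) + b * y by ring.
  by rewrite /et pcD pcM pcD pcM; exact: aux.
by move=> /pc_free[+ q0]; rewrite q0 mul0r addr0.
Qed.

Definition crd (P : point F) : seq (F * F) :=
  if P is Some (x, y) then [:: (x, eta x y)] else [::].

Definition PrinP e (s : seq (point F)) (tau : F) :=
  Prin (pc E) et e (flatten (map crd s)) tau.

Lemma PrinP_add e P Q s tau : on_curve E P -> on_curve E Q ->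
  PrinP e (P :: Q :: s) tau <-> PrinP e (addpt E P Q :: s) (tau + sg P Q).
Proof.
move=> hP hQ; rewrite /PrinP.
case: (addP hP hQ) => [R|R|x y exy|x1 y1 x2 y2 x3 y3 m hc hQ' hR h12 _] /=;
  rewrite ?addr0 //.
- rewrite negpt_eta; apply: (Prin_vert (A2 := A2) (A4 := A4) (A6 := A6)) => //.
  + exact: et_sqr.
  + exact: et_free.
  case: (eqVneq (eta x y) 0) => [e0|]; [right|by left].
  apply/eqP => e'; apply: (@smooth x) => //; by rewrite -exy e0 expr0n.
exact: (Prin_chord two_neq0 et_sqr et_free).
Qed.

Lemma PrinP_nil e tau : PrinP e [::] tau <-> e = 0%N /\ tau = 0.
Proof. exact: Prin_nil. Qed.

Lemma PrinP_infty e s tau : PrinP e (None :: s) tau <-> PrinP e s tau.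
Proof. by []. Qed.

Lemma PrinP_singleton e P tau : on_curve E P -> PrinP e [:: P] tau ->
  [/\ P = None, e = 0%N & tau = 0].
Proof.
case: P => [[x y]|] hP; last by move/PrinP_nil => [-> ->].
move=> h; exfalso; apply: (Prin_singleton et_sqr et_free _ h).
by apply/eqP; rewrite -on_curveE.
Qed.

Lemma PrinP_swap e P Q s tau : PrinP e (P :: Q :: s) tau -> PrinP e (Q :: P :: s) tau.
Proof.
by case: P => [[x y]|]; case: Q => [[x' y']|]; first exact: Prin_swap.
Qed.

Lemma PrinP_swap2 e P Q R s tau :
  PrinP e (P :: Q :: R :: s) tau -> PrinP e (P :: R :: Q :: s) tau.
Proof.
case: P => [[x0 y0]|]; last by rewrite !PrinP_infty; apply: PrinP_swap.
by case: Q => [[x y]|]; case: R => [[x' y']|]; first exact: Prin_swap2.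
Qed.

Lemma negptK P : negpt E (negpt E P) = P.
Proof. by case: P => [[x y]|] //=; congr (Some (_, _)); ring. Qed.

Lemma addpt_neg P : addpt E P (negpt E P) = None.
Proof.
by case: P => [[x y]|] //=; rewrite eqxx /=; case: ifP => // /eqP []; ring.
Qed.

Lemma sg_neg P : sg P (negpt E P) = 0.
Proof.
by case: P => [[x y]|] //=; rewrite eqxx /=; case: ifP => // /eqP []; ring.
Qed.

Lemma addpt_eq0 P Q : addpt E P Q = None -> P = negpt E Q.
Proof.
case: P => [[x y]|]; case: Q => [[x' y']|] //=.
by case: ifP => // /andP[/eqP-> /eqP->].
Qed.

(** The summands on the right are ordered so that commutativity is the case Q = O. The list P, Q, R,
    -(P + Q + R) is built up along (P + Q) + R and contracted along (Q + R) + P. *)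
Lemma addpt_cocycle P Q R : on_curve E P -> on_curve E Q -> on_curve E R ->
  addpt E (addpt E P Q) R = addpt E (addpt E Q R) P /\
  sg P Q + sg (addpt E P Q) R = sg Q R + sg (addpt E Q R) P.
Proof.
move=> hP hQ hR.
have hPQ := on_curve_add hP hQ; have hQR := on_curve_add hQ hR.
set S := negpt E (addpt E (addpt E P Q) R).
have hS : on_curve E S by apply/on_curve_neg/on_curve_add.
have : PrinP 0 [:: addpt E (addpt E P Q) R; S] 0.
  apply/PrinP_add => //; first exact: on_curve_add.
  by rewrite addpt_neg sg_neg addr0; apply/PrinP_nil.
move=> h; set a := sg P Q; set b := sg (addpt E P Q) R.
have {}h : PrinP 0 [:: addpt E P Q; R; S] (- b).
  by apply/PrinP_add; rewrite // addNr.
have {}h : PrinP 0 [:: P; Q; R; S] (- b - a).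
  by apply/PrinP_add; rewrite // subrK.
move: h => /PrinP_swap/PrinP_swap2/(PrinP_add 0 [:: P; S] _ hQ hR).
move=> /(PrinP_add 0 [:: S] _ hQR hP).
move=> /(PrinP_add 0 [::] _ (on_curve_add hQR hP) hS).
move=> /PrinP_singleton [|h _ h']; first by rewrite !on_curve_add.
have e : addpt E (addpt E P Q) R = addpt E (addpt E Q R) P.
  by rewrite (addpt_eq0 h) negptK.
split=> //; rewrite -e sg_neg addr0 in h'.
apply/eqP; rewrite eq_sym -subr_eq0 -h'; apply/eqP; ring.
Qed.

Lemma addptC P Q : on_curve E P -> on_curve E Q -> addpt E P Q = addpt E Q P.
Proof.
move=> hP hQ; have [e _] := @addpt_cocycle P None Q hP isT hQ.
by move: e; case: (P) => [[x y]|] /=; case: (Q) => [[x' y']|].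
Qed.

Lemma sgC P Q : on_curve E P -> on_curve E Q -> sg P Q = sg Q P.
Proof.
move=> hP hQ; have [_] := @addpt_cocycle P None Q hP isT hQ.
have -> : addpt E P None = P by case: (P) => [[]|].
have -> : sg P None = 0 by case: (P) => [[]|].
by rewrite /= !add0r.
Qed.

Lemma addptA P Q R : on_curve E P -> on_curve E Q -> on_curve E R ->
  addpt E P (addpt E Q R) = addpt E (addpt E P Q) R.
Proof.
move=> hP hQ hR; rewrite addptC ?on_curve_add //.
by have [-> _] := addpt_cocycle hP hQ hR.
Qed.

End GroupLaw.

(** * Interpolation on a tower of 2-isogenies *)

Section Levels.
Variables (K : fieldType) (G : zmodType).
Hypothesis two_neq0 : (2%:R : K) != 0.
Implicit Types (x y z : G) (H : pred G) (s : G -> G -> K) (w : G -> K).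

(* On a curve, [H] is the zero group, [s x y] the slope of the line through [x]
   and [y] (plus [a_1 / 2], and 0 when the line is vertical), [w] the abscissa
   up to an additive constant; [lev_s2] is the sum of the abscissas of three
   collinear points. Isogenous curves reappear as larger [H] on the same [G], so
   that no isogeny is ever constructed. *)
Record level H s w (kappa : K) : Prop := Level {
  lev0 : H 0;
  levB : forall x y, H x -> H y -> H (x - y);
  lev_sC : forall x y, s x y = s y x;
  lev_sA : forall x y z, s x y + s (x + y) z = s y z + s x (y + z);
  lev_sN : forall x, s x (- x) = 0;
  lev_sP : forall e x y, H e -> s (x + e) y = s x y;
  lev_wN : forall x, w (- x) = w x;
  lev_wP : forall e x, H e -> w (x + e) = w x;
  lev_s2 : forall x y, ~~ H x -> ~~ H y -> ~~ H (x + y) ->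
    s x y ^+ 2 = w x + w y + w (x + y) + kappa;
  lev_wI : forall x y, ~~ H x -> ~~ H y -> w x = w y -> H (x + y) || H (x - y)
}.

Section OneLevel.
Variables (H : pred G) (s : G -> G -> K) (w : G -> K) (kappa : K).
Hypothesis lev : level H s w kappa.

Lemma levN x : H (- x) = H x.
Proof.
have h y : H y -> H (- y) by rewrite -[- y]sub0r; apply: (levB lev); apply: (lev0 lev).
by apply/idP/idP => [/h|/h //]; rewrite opprK.
Qed.

Lemma levD x y : H x -> H y -> H (x + y).
Proof. by move=> hx hy; rewrite -[y]opprK (levB lev) ?levN. Qed.

Lemma levDr x y : H y -> H (x + y) = H x.
Proof.
by move=> hy; apply/idP/idP => [h|/levD ->//]; rewrite -[x](addrK y) (levB lev).
Qed.

Lemma levMn x n : H x -> H (x *+ n).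
Proof.
move=> hx; elim: n => [|n IH]; first by rewrite mulr0n (lev0 lev).
by rewrite mulrS levD.
Qed.

Lemma lev_s0 x : s 0 x = 0.
Proof.
have := lev_sA lev 0 0 x; rewrite addr0 add0r => /addIr <-.
by have := lev_sN lev 0; rewrite oppr0.
Qed.

(** Geometrically, in this lemma and the next two: the line through x and y meets the curve again at
    -(x + y), and reflection reverses slopes. Both facts come from the cocycle relation with two
    arguments opposite. *)
Lemma lev_sc x y : s (x + y) (- x) = - s x y.
Proof.
have := lev_sA lev (- x) x y; rewrite (lev_sC lev (- x) x) (lev_sN lev) addNr.
by rewrite lev_s0 addr0 (lev_sC lev (- x)) => /eqP; rewrite eq_sym addr_eq0 eq_sym eqr_oppLR => /eqP.
Qed.

Lemma lev_s3 x y : s x (- (x + y)) = s x y.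
Proof.
have := lev_sA lev y x (- (x + y)).
have -> : y + x = x + y by rewrite addrC.
have -> : x - (x + y) = - y by rewrite opprD addNKr.
by rewrite !(lev_sN lev) !addr0 (lev_sC lev y) => ->.
Qed.

Lemma lev_sNN x y : s (- x) (- y) = - s x y.
Proof.
rewrite -lev_sc -[RHS](lev_sC lev (- x)) -(lev_s3 (- x) (x + y)).
by rewrite addKr.
Qed.

Lemma lev_sPr e x y : H e -> s x (y + e) = s x y.
Proof. by move=> he; rewrite (lev_sC lev) (lev_sP lev) // (lev_sC lev). Qed.

(* Eliminating [s x (y + z)] between the cocycle relation and the four squares. *)
Lemma lev_prod x y z : ~~ H x -> ~~ H y -> ~~ H z -> ~~ H (x + y) ->
  ~~ H (y + z) -> ~~ H (x + y + z) ->
  s x y * s y z + s (x + y) z * s y z - s x y * s (x + y) z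
  = w y + w (x + y) + w z + kappa.
Proof.
move=> hx hy hz hxy hyz hxyz.
have e := lev_sA lev x y z.
have hxyz' : ~~ H (x + (y + z)) by rewrite addrA.
have e1 := lev_s2 lev hx hy hxy; have e2 := lev_s2 lev hxy hz hxyz.
have e3 := lev_s2 lev hy hz hyz; have := lev_s2 lev hx hyz hxyz'.
have -> : s x (y + z) = s x y + s (x + y) z - s y z by rewrite e [RHS]addrC addKr.
rewrite addrA.
move: (s x y) (s (x + y) z) (s y z) e1 e2 e3 => a c b e1 e2 e3 e4.
apply: (mulfI two_neq0).
transitivity (a ^+ 2 + c ^+ 2 + b ^+ 2 - (a + c - b) ^+ 2); first by ring.
by rewrite e1 e2 e3 e4; ring.
Qed.

(** * The quotient by a point of order two *)

Section Next.
Variable T : G.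
Hypotheses (HT : ~~ H T) (HTT : H (T + T)).

(* [next_s] is [s x y + s (x + T) y], made symmetric by subtracting [h y]: up to
   normalisation, the slope on the quotient by [T]. *)
Definition h x := s T x.
Definition next_H : pred G := fun x => H x || H (x + T).
Definition next_s x y := s x y *+ 2 + h (x + y) - h x - h y.
(** By [h_sqr] this is w x + w (x + T) up to a constant outside [next_H]: the abscissa on the
    quotient by T, as in Velu's formulas. *)
Definition next_w x := h x ^+ 2.
Definition next_kappa := - (kappa *+ 2) - w T *+ 6.

Lemma levNT x : s (- T) x = s T x.
Proof. by rewrite -(lev_sP lev (- T) x HTT) addKr. Qed.

Lemma hN x : h (- x) = - h x.
Proof. by rewrite /h -levNT lev_sNN. Qed.

Lemma hT x : h (x + T) = - h x.
Proof.
by rewrite /h addrC -[in RHS]lev_s3 -[in RHS]levNT lev_sNN opprK.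
Qed.

Lemma h_opp x : h (- T + x) = - h x.
Proof.
by rewrite -hT addrC -[RHS](lev_sPr (e := - (T + T))) ?levN // opprD addrA addrK.
Qed.

Lemma next_HT x : next_H (x + T) = next_H x.
Proof. by rewrite /next_H /= -addrA (levDr _ HTT) // orbC. Qed.

Lemma next_HNor x : ~~ next_H x -> ~~ H x /\ ~~ H (x + T).
Proof. by rewrite /next_H /= negb_or => /andP. Qed.

Lemma next_sT x y : next_s (x + T) y = next_s x y.
Proof.
have e : s (x + T) y = s x y + h (x + y) - h x.
  have := lev_sA lev T x y; rewrite addrC (addrC T x) -/(h x) -/(h (x + y)) => <-.
  by rewrite addrK.
by rewrite /next_s e (addrAC x T y) !hT; ring.
Qed.

Lemma next_sH e x y : next_H e -> next_s (x + e) y = next_s x y.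
Proof.
have P f z : H f -> next_s (z + f) y = next_s z y.
  by move=> hf; rewrite /next_s /h (addrAC z f y) (lev_sP lev) // !(lev_sPr _ _ hf).
case/orP => [/P -> //|he].
by rewrite -[LHS]next_sT -addrA P.
Qed.

(* The extra symmetry [T = - T] modulo [H] turns the product relation of a
   secant into one for a triangle. *)
Lemma triangle x y : ~~ next_H x -> ~~ next_H y -> ~~ next_H (x + y) ->
  s x y * h x + s x y * h y - h x * h y = w x + w y + w T + kappa.
Proof.
move=> /next_HNor[hx hx'] /next_HNor[hy hy'] /next_HNor[hxy hxy'].
have hyN : H (- y + T) = H (y + T).
  by rewrite -levN opprD opprK -(levDr (y - T) HTT) addrA subrK.
have e : - (x + y) + x = - y by rewrite opprD addrAC addNr add0r.
have := @lev_prod (- (x + y)) x T.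
rewrite e !levN hyN => /(_ hxy hx HT hy hx' hy').
rewrite (lev_sC lev (- _) x) lev_s3 (lev_wN lev).
rewrite (lev_sC lev x T) (lev_sC lev (- y) T) -!/(h _) hN => <-.
ring.
Qed.

Lemma secant_y x y : ~~ next_H x -> ~~ next_H y -> ~~ next_H (x + y) ->
  s x y * h y + h (x + y) * h y - s x y * h (x + y) = w y + w (x + y) + w T + kappa.
Proof.
move=> /next_HNor[hx hx'] /next_HNor[hy hy'] /next_HNor[hxy hxy'].
have := @lev_prod x y T hx hy HT hxy hy' hxy'.
by rewrite (lev_sC lev y T) (lev_sC lev (x + y) T).
Qed.

Lemma secant_x x y : ~~ next_H x -> ~~ next_H y -> ~~ next_H (x + y) ->
  s x y * h x + h (x + y) * h x - s x y * h (x + y) = w x + w (x + y) + w T + kappa.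
Proof.
by move=> hx hy; rewrite (lev_sC lev x) (addrC x y) => hxy; rewrite secant_y.
Qed.

Lemma h_sqr x : ~~ next_H x -> h x ^+ 2 = w x + w T + w (x + T) + kappa.
Proof.
move=> /next_HNor[hx hx']; rewrite /h (lev_s2 lev) //; last by rewrite addrC.
by rewrite (addrC T x) (addrC (w T)).
Qed.

(** For fixed y, the product is a multiple of a slope modulo T plus a constant: this brings the odd
    part, once multiplied by h, back to an interpolation problem. It follows from the three product
    relations and [h_sqr] by linear elimination. *)
Lemma h_prod x y : ~~ next_H x -> ~~ next_H y -> ~~ next_H (x + y) ->
  h x * h (x + y) = h y * next_s x y + (w (y + T) - w y).
Proof.
move=> hx hy hxy; have e1 := triangle hx hy hxy; have e2 := secant_x hx hy hxy.
have e3 := secant_y hx hy hxy; have e4 := h_sqr hy.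
rewrite /next_s; move: (s x y) (h x) (h y) (h (x + y)) e1 e2 e3 e4 => m a b c e1 e2 e3 e4.
apply/eqP; rewrite -subr_eq0; apply/eqP.
transitivity (- (m * a + m * b - a * b) + (m * a + c * a - m * c) - (m * b + c * b - m * c)
   + b ^+ 2 - (w (y + T) - w y)); first by ring.
by rewrite e1 e2 e3 e4; ring.
Qed.

Lemma h_eq_w x y : ~~ next_H x -> ~~ next_H y -> ~~ next_H (x + y) ->
  h x = h y -> w x = w y.
Proof.
move=> hx hy hxy e; have e2 := secant_x hx hy hxy; have e3 := secant_y hx hy hxy.
apply/eqP; rewrite -subr_eq0; apply/eqP.
transitivity ((w x + w (x + y) + w T + kappa) - (w y + w (x + y) + w T + kappa)).
  by ring.
by rewrite -e2 -e3 e subrr.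
Qed.

Lemma next_HB x y : next_H x -> next_H y -> next_H (x - y).
Proof.
have e : x - y = (x + T) - (y + T) by rewrite opprD addrACA subrr addr0.
case/orP=> hx; case/orP=> hy; rewrite /next_H.
- by rewrite (levB lev).
- rewrite (_ : x - y + T = x - (y + T) + (T + T)); last by rewrite opprD -!addrA addKr.
  by rewrite (levDr _ HTT) (levB lev hx hy) orbT.
- by rewrite addrAC (levB lev hx) ?orbT.
- by rewrite e (levB lev).
Qed.

Lemma next_level : level next_H next_s next_w next_kappa.
Proof.
split.
- by rewrite /next_H (lev0 lev).
- exact: next_HB.
- by move=> x y; rewrite /next_s (lev_sC lev) (addrC x y); ring.
- move=> x y z; rewrite /next_s (addrA x y z).
  have := lev_sA lev x y z.
  move: (s x y) (s (x + y) z) (s y z) (s x (y + z)) => a b c d e.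
  have -> : a = c + d - b by rewrite -e addrK.
  ring.
- by move=> x; rewrite /next_s (lev_sN lev) hN subrr /h (lev_sC lev) lev_s0; ring.
- by move=> e x y; apply: next_sH.
- by move=> x; rewrite /next_w hN sqrrN.
- move=> e x; rewrite /next_w /next_H => /orP[he|he]; rewrite /h.
    by rewrite lev_sPr.
  rewrite -[s T (x + e)]opprK -[X in - X]hT -addrA /h lev_sPr //.
  by rewrite sqrrN.
- move=> x y hx hy hxy.
  have e1 := triangle hx hy hxy; have e2 := secant_x hx hy hxy.
  have e3 := secant_y hx hy hxy.
  have e4 : s x y ^+ 2 = w x + w y + w (x + y) + kappa.
    by apply: (lev_s2 lev); [case: (next_HNor hx)|case: (next_HNor hy)|case: (next_HNor hxy)].
  rewrite /next_s /next_w /next_kappa.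
  move: (s x y) (h x) (h y) (h (x + y)) e1 e2 e3 e4 => m a b c e1 e2 e3 e4.
  (* The cross terms of (2 m + c - a - b)^2 are exactly those of the three product relations. The
     values w x, w y, w (x + y) cancel, and 4 kappa - 6 (kappa + w T) remains. *)
  transitivity (4%:R * m ^+ 2 + a ^+ 2 + b ^+ 2 + c ^+ 2
    - 2%:R * (m * a + c * a - m * c) - 2%:R * (m * b + c * b - m * c)
    - 2%:R * (m * a + m * b - a * b)); first by ring.
  by rewrite e1 e2 e3 e4; ring.
(* Equal squares give h x = h y or h x = h (- y), and [h_eq_w] turns this into equal abscissas one
   level down. *)
move=> x y hx hy; rewrite /next_w => /eqP; rewrite eqf_sqr => /orP h.
have [//|hxy] := boolP (next_H (x + y)).
have [|hxy'] := boolP (next_H (x - y)); first by rewrite orbT.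
have hyN z : next_H z -> next_H (- z).
  by move=> hz; rewrite -[- z]sub0r next_HB // /next_H (lev0 lev).
have hNy : ~~ next_H (- y) by apply: contra hy => /hyN; rewrite opprK.
case: h => /eqP e.
  have /(lev_wI lev (proj1 (next_HNor hx)) (proj1 (next_HNor hy))) := h_eq_w hx hy hxy e.
  by case/orP => hh; [case/next_HNor: hxy|case/next_HNor: hxy']; rewrite hh.
rewrite -hN in e.
have /(lev_wI lev (proj1 (next_HNor hx)) (proj1 (next_HNor hNy))) := h_eq_w hx hNy hxy' e.
by rewrite opprK; case/orP => hh; [case/next_HNor: hxy'|case/next_HNor: hxy]; rewrite hh.
Qed.

(** If 2y is outside [next_H], then h y = 0 would give h (y + T) = h y, hence w (y + T) = w y,
    against [lev_wI]. If 2y is T modulo H, then w (y + T) = w y kills the constant in [h_prod], and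
    h y = 0 would force h z = 0 or h (z + y) = 0, which the first case excludes. The witness z will
    be b. *)
Lemma h_neq0 y z : ~~ next_H y -> ~~ H (y + y) ->
  ~~ next_H z -> ~~ next_H (z + z) -> ~~ next_H (z + y) -> h y != 0.
Proof.
have nz x : ~~ next_H x -> ~~ next_H (x + x) -> h x != 0.
  move=> hx hxx; apply/eqP => e.
  have hxT : ~~ next_H (x + T) by rewrite next_HT.
  have hxxT : ~~ next_H (x + T + x) by rewrite addrAC next_HT.
  have := h_eq_w hxT hx hxxT; rewrite hT e oppr0 => /(_ erefl).
  move/(lev_wI lev (proj1 (next_HNor hxT)) (proj1 (next_HNor hx))).
  rewrite addrAC (negPf (proj2 (next_HNor hxx))) /= addrAC subrr add0r.
  by rewrite (negPf HT).
move=> hy hyy hz hzz hzy; have [hyy'|] := boolP (next_H (y + y)); last exact: nz.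
apply/eqP => e; have := h_prod hz hy hzy.
rewrite e mul0r add0r.
have -> : w (y + T) = w y.
  have := hyy'; rewrite /next_H (negPf hyy) /= => hyT.
  by rewrite -(lev_wN lev y) -(lev_wP lev (- y) hyT) -!addrA addKr.
rewrite subrr => /eqP; rewrite mulf_eq0 => /orP[] /eqP e0.
  by move: (nz z hz hzz); rewrite e0 eqxx.
have := nz (z + y) hzy; rewrite e0 eqxx addrACA.
have hh : ~~ next_H (z + z + (y + y)).
  by apply: contra hzz => /next_HB /(_ hyy'); rewrite addrK.
by move=> /(_ hh).
Qed.

End Next.
End OneLevel.

(** * Interpolation at the nodes b + kt and its reduction modulo T *)

Section Cyclic.
Variables (b t : G).

Definition node k : G := b + t *+ k.

Definition cyclic_data H n := (forall k, H (t *+ k) = (n %| k)%N) /\ ~~ H (b *+ n).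

Definition interp s n (c0 : K) (r : nat -> K) x :=
  c0 + \sum_(1 <= l < n) r l * s x (- (t *+ l)).

Definition unisolvent s n := forall c0 r,
  (forall k, (k < n)%N -> interp s n c0 r (node k) = 0) ->
  c0 = 0 /\ forall l, (0 < l < n)%N -> r l = 0.

Section Step.
Variables (H : pred G) (s : G -> G -> K) (w : G -> K) (kappa : K) (m : nat).
Hypothesis lev : level H s w kappa.
Hypothesis m_gt0 : (0 < m)%N.
Hypothesis hcyc : cyclic_data H (m + m).
Local Notation T := (t *+ m).

Lemma half_notin : ~~ H T.
Proof. by rewrite (proj1 hcyc); apply/negP => /(dvdn_leq m_gt0); rewrite leqNgt -[X in (X < _)%N]addn0 ltn_add2l m_gt0. Qed.

Lemma half2_in : H (T + T).
Proof. by rewrite -mulrnDr (proj1 hcyc). Qed.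

Local Notation h := (h s T).
Local Notation H' := (next_H H T).
Local Notation s' := (next_s s T).

Lemma next_Htk k : H' (t *+ k) = (m %| k)%N.
Proof.
rewrite /next_H /= -mulrnDr !(proj1 hcyc) addnn -mul2n.
apply/orP/idP => [[]|]; first by apply: dvdn_trans; apply: dvdn_mull.
  move=> h2; have : (m %| k + m)%N by apply: dvdn_trans h2; apply: dvdn_mull.
  by rewrite dvdn_addl.
case/dvdnP => q ->; rewrite -mulSnr !dvdn_pmul2r //.
by rewrite !dvdn2 /=; case: (odd q); [right|left].
Qed.

Lemma next_double x : H' x -> H (x + x).
Proof.
case/orP => hx; first exact: (levD lev).
rewrite -(levDr lev _ half2_in) addrACA; exact: (levD lev).
Qed.

Lemma next_cyclic : cyclic_data H' m.
Proof.
split; first exact: next_Htk.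
by apply: contra (proj2 hcyc) => /next_double; rewrite -mulrnDr.
Qed.

Lemma node_shift k : node (k + m) = node k + T.
Proof. by rewrite /node mulrnDr addrA. Qed.

(* Adding a multiple of [t] does not change the [2m]-th multiple modulo [H]. *)
Lemma trans_notin k l : ~~ H' (node k - t *+ l).
Proof.
apply: contra (proj2 hcyc) => /next_double /(levMn lev m).
rewrite -mulr2n -mulrnA mul2n -addnn /node -addrA mulrnDl (levDr lev) //.
rewrite mulrnBl -!mulrnA.
by apply: (levB lev); rewrite (proj1 hcyc) dvdn_mull.
Qed.

Lemma node_notin k : ~~ H' (node k).
Proof. by rewrite -[node k]subr0 -(mulr0n t); apply: trans_notin. Qed.

Lemma tl_notin l : (0 < l < m)%N -> ~~ H' (t *+ l).
Proof.
move=> /andP[l0 lm]; rewrite next_Htk; apply/negP => /dvdn_leq.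
by rewrite l0 => /(_ isT); lia.
Qed.

Lemma next_HN x : H' (- x) = H' x.
Proof. exact: (levN (next_level lev half_notin half2_in)). Qed.

Lemma hl_neq0 l : (2 %| m)%N -> (0 < l < m)%N -> h (t *+ l) != 0.
Proof.
move=> m2 hl; have /andP[l0 lm] := hl.
apply: (h_neq0 lev half_notin half2_in (z := b)).
- exact: tl_notin.
- rewrite -mulrnDr (proj1 hcyc); apply/negP => /dvdn_leq.
  by rewrite addn_gt0 l0 => /(_ isT); lia.
- by have := node_notin 0; rewrite /node mulr0n addr0.
(* If 2b were in H', then 4b would be in H, and so would (m / 2) 4b = 2m b; here m has to be
   even. *)
- apply: contra (proj2 hcyc) => /next_double /(levMn lev (m %/ 2)).
  by rewrite -!mulr2n -!mulrnA; congr (is_true (H (_ *+ _))); lia.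
- exact: node_notin.
Qed.

Definition rplus (r : nat -> K) l := (r l + r (l + m)%N) / 2%:R.
Definition rminus (r : nat -> K) l := (r l - r (l + m)%N) / 2%:R.
Definition rho (r : nat -> K) := r m + \sum_(1 <= l < m) rplus r l.
Definition even_cst c0 (r : nat -> K) := c0 - \sum_(1 <= l < m) rminus r l * h (t *+ l).

Lemma sum_halves (F : nat -> K) : \sum_(1 <= l < m + m) F l
  = F m + \sum_(1 <= l < m) (F l + F (l + m)%N).
Proof.
rewrite (big_cat_nat (n := m)) //=; last by lia.
rewrite [X in _ + X]big_ltn; last by lia.
rewrite big_split /= -[m.+1]add1n big_addn addnK.
by rewrite addrCA addrA.
Qed.

Lemma s_shift x y : s (x + T) y = s x y + h (x + y) - h x.
Proof.
have := lev_sA lev T x y; rewrite [s T x + _]addrC (addrC T x) -/(h x) -/(h (x + y)) => <-.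
by rewrite addrK.
Qed.

Lemma s_sum x y : s x y + s (x + T) y = s' x y + h y.
Proof. by rewrite s_shift /next_s; ring. Qed.

Lemma s_diff x y : s x y - s (x + T) y = h x - h (x + y).
Proof. by rewrite s_shift; ring. Qed.

Lemma tl_shift l : - (t *+ (l + m)) = - T - t *+ l.
Proof. by rewrite mulrnDr opprD addrC. Qed.

Lemma h_shift x : h (- T + x) = - h x.
Proof. exact: (h_opp lev half2_in). Qed.

Lemma s'_shift x y : s' x (- T + y) = s' x y.
Proof.
have L := next_level lev half_notin half2_in.
rewrite addrC (lev_sPr L) //; apply/orP; right.
by rewrite addNr (lev0 lev).
Qed.

Lemma interp_even c0 r x :
  interp s (m + m) c0 r x + interp s (m + m) c0 r (x + T)
  = 2%:R * interp s' m (even_cst c0 r) (rplus r) x.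
Proof.
rewrite /interp !sum_halves addrACA [X in _ + X]addrACA -big_split /=.
have -> : r m * s x (- T) + r m * s (x + T) (- T) = 0.
  rewrite -mulrDr s_sum.
  have -> : h (- T) = 0.
    by rewrite -[- T]addr0 h_shift /h (lev_sC lev) (lev_s0 lev) oppr0.
  have -> : s' x (- T) = 0.
    rewrite -[- T]addr0 s'_shift.
    by rewrite (lev_sC (next_level lev half_notin half2_in)) (lev_s0 (next_level lev half_notin half2_in)).
  by rewrite addr0 mulr0.
rewrite add0r /even_cst -[c0 - _ + _]addrA -sumrN -big_split /= mulrDr.
rewrite mulr_natl mulr2n; congr (_ + _).
rewrite mulr_sumr; apply: eq_bigr => l _.
rewrite addrACA -!mulrDr !s_sum tl_shift s'_shift h_shift (hN lev half2_in).
rewrite /rplus /rminus.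
field.
exact: two_neq0.
Qed.

Lemma interp_odd c0 r x :
  interp s (m + m) c0 r x - interp s (m + m) c0 r (x + T)
  = 2%:R * (rho r * h x - \sum_(1 <= l < m) rminus r l * h (x - t *+ l)).
Proof.
rewrite /interp !sum_halves opprD addrACA subrr add0r opprD addrACA -mulrBr s_diff.
rewrite -sumrB.
have -> : rho r * h x - \sum_(1 <= l < m) rminus r l * h (x - t *+ l)
    = r m * h x + \sum_(1 <= l < m) (rplus r l * h x - rminus r l * h (x - t *+ l)).
  by rewrite /rho mulrDl mulr_suml -addrA -sumrB.
rewrite [RHS]mulrDr mulr_sumr; congr (_ + _).
  have -> : h (x - T) = - h x by rewrite addrC h_shift.
  by rewrite opprK; ring.
apply: eq_bigr => l _.
rewrite opprD addrACA -!mulrBr !s_diff tl_shift.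
have -> : h (x + (- T - t *+ l)) = - h (x - t *+ l) by rewrite addrCA h_shift.
by rewrite /rplus /rminus; field.
Qed.

(** [h_prod] with y = -lt applies to each product of h at node k and at node k - lt; since h (-lt) =
    -h (lt), the new residue is h (lt) times the old one. *)
Lemma odd_interp r k :
  h (node k) * (rho r * h (node k) - \sum_(1 <= l < m) rminus r l * h (node k - t *+ l))
    - rho r * h (node k) ^+ 2
  = interp s' m (- \sum_(1 <= l < m) rminus r l * (w (- (t *+ l) + T) - w (- (t *+ l))))
      (fun l => h (t *+ l) * rminus r l) (node k).
Proof.
rewrite mulrBr [h _ * (rho r * _)]mulrCA -expr2 addrAC subrr sub0r /interp.
rewrite mulr_sumr -!sumrN -big_split /= !big_nat; apply: eq_bigr => l hl.
rewrite mulrCA (h_prod lev half_notin half2_in (node_notin k)); first last.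
- exact: trans_notin.
- by rewrite next_HN tl_notin.
rewrite (hN lev half2_in); ring.
Qed.

Lemma unisolvent_next : unisolvent s (m + m) -> unisolvent s' m.
Proof.
move=> U c0 r' hr.
(* Lift of r' to the level above, equal at l and l + m. The value at m makes [rho] vanish, so that
   the odd part is identically 0 and the even part is the given function. *)
pose r l := if l == m then - \sum_(1 <= i < m) r' i else
  if (l < m)%N then r' l else r' (l - m)%N.
have r1 l : (0 < l < m)%N -> r l = r' l.
  by move=> hl; rewrite /r; case: eqP => [|_]; [lia|case: ltnP => //; lia].
have r2 l : (0 < l < m)%N -> r (l + m)%N = r' l.
  by move=> hl; rewrite /r addnK; case: eqP => [|_]; [lia|case: ltnP => //; lia].
have rp l : (0 < l < m)%N -> rplus r l = r' l.
  by move=> hl; rewrite /rplus r1 // r2 //; field.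
have rm l : (0 < l < m)%N -> rminus r l = 0.
  by move=> hl; rewrite /rminus r1 // r2 // subrr mul0r.
have r0 : rho r = 0.
  rewrite /rho {1}/r eqxx (eq_big_nat _ _ rp) addNr //.
have ev x : interp s' m (even_cst c0 r) (rplus r) x = interp s' m c0 r' x.
  rewrite /interp /even_cst big_nat big1 ?subr0; last first.
    by move=> l hl; rewrite rm ?mul0r.
  by congr (_ + _); apply: eq_big_nat => l hl; rewrite rp.
have Z k : (k < m)%N -> interp s (m + m) c0 r (node k) = 0 /\
    interp s (m + m) c0 r (node k + T) = 0.
  move=> hk; have := interp_even c0 r (node k); rewrite ev hr // mulr0 => e1.
  have := interp_odd c0 r (node k); rewrite r0 mul0r big_nat big1 ?subrr ?mulr0.
    move/eqP; rewrite subr_eq0 => /eqP e2; rewrite e2 in e1 *.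
    move/eqP: e1; rewrite -mulr2n -mulr_natl mulf_eq0 (negPf two_neq0) /= => /eqP.
    by [].
  by move=> l hl; rewrite rm ?mul0r.
have [k hk|-> rz] := U c0 r.
  have [km|mk] := ltnP k m; first by case: (Z k km).
  rewrite -(subnK mk) node_shift; apply: (proj2 (Z _ _)); lia.
split=> // l hl; rewrite -(rp l hl) /rplus !rz ?addr0 ?mul0r //; lia.
Qed.

End Step.

Section LinearSolution.
Variables (s : G -> G -> K) (n : nat).
Hypothesis U : unisolvent s n.
Hypothesis n_gt0 : (0 < n)%N.

Definition coefs (c0 : K) (r : nat -> K) l := if l == 0%N then c0 else r l.

Definition vmx : 'M[K]_n :=
  \matrix_(k, l) if (l : nat) == 0%N then 1 else s (node k) (- (t *+ l)).

Lemma vmxE c0 r (k : 'I_n) :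
  (vmx *m \col_l coefs c0 r l) k 0 = interp s n c0 r (node k).
Proof.
rewrite mxE /interp.
transitivity (\sum_(0 <= l < n) (if l == 0%N then 1 else s (node k) (- (t *+ l))) * coefs c0 r l).
  by rewrite big_mkord; apply: eq_bigr => l _; rewrite !mxE.
rewrite big_ltn // /= mul1r; congr (_ + _); apply: eq_big_nat => l /andP[l0 _].
by rewrite /coefs eqn0Ngt l0 /= mulrC.
Qed.

Lemma vmx_unit : vmx \in unitmx.
Proof.
rewrite -unitmx_tr unitmxE unitfE; apply/det0P => -[v v0 hv].
pose r l := v 0 (insubd (Ordinal n_gt0) l).
have ev : v^T = \col_l coefs (r 0%N) r l.
  apply/colP => l; rewrite !mxE /coefs; case: eqP => [e|_]; rewrite /r.
    by congr (v 0 _); apply/val_inj; rewrite val_insubd n_gt0.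
  by congr (v 0 _); apply/val_inj; rewrite val_insubd ltn_ord.
have [k hk|c0 rz] := U (c0 := r 0%N) (r := r).
  have := congr1 (fun M : 'rV_n => M 0 (Ordinal hk)) hv.
  rewrite -(trmxK (v *m _)) trmx_mul trmxK ev [X in X = _ -> _]mxE.
  by rewrite (vmxE (r 0%N) r (Ordinal hk)) mxE.
case/eqP: v0; apply: trmx_inj; rewrite ev; apply/colP => l; rewrite !mxE /coefs.
by case: eqP => // /eqP l0; rewrite rz // lt0n l0 ltn_ord.
Qed.

Lemma interp_solve (beta : nat -> K) : exists c0 r,
  forall k, (k < n)%N -> interp s n c0 r (node k) = beta k.
Proof.
pose c := invmx vmx *m \col_k beta k.
pose r l := c (insubd (Ordinal n_gt0) l) 0.
have ec : c = \col_l coefs (r 0%N) r l.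
  apply/colP => l; rewrite [RHS]mxE /coefs; case: eqP => [e|_]; rewrite /r.
    by congr (c _ 0); apply/val_inj; rewrite val_insubd n_gt0.
  by congr (c _ 0); apply/val_inj; rewrite val_insubd ltn_ord.
exists (r 0%N), r => k hk.
by rewrite -(vmxE _ _ (Ordinal hk)) -ec /c mulKVmx ?vmx_unit // mxE.
Qed.

Lemma interp_linear : exists M : nat -> nat -> K, forall c0 r beta,
  (forall k, (k < n)%N -> interp s n c0 r (node k) = beta k) ->
  forall l, (l < n)%N -> coefs c0 r l = \sum_(0 <= k < n) M l k * beta k.
Proof.
pose io := insubd (Ordinal n_gt0).
exists (fun l k => invmx vmx (io l) (io k)) => c0 r beta hb l hl.
have e : vmx *m \col_l coefs c0 r l = \col_k beta k.
  by apply/colP => k; rewrite vmxE hb // mxE.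
have := congr1 (fun M : 'cV_n => (invmx vmx *m M) (io l) 0) e.
rewrite mulKmx ?vmx_unit // mxE val_insubd hl => ->.
rewrite mxE big_mkord; apply: eq_bigr => k _; rewrite mxE; congr (invmx _ _ _ * _).
by apply/val_inj; rewrite val_insubd ltn_ord.
Qed.

End LinearSolution.
End Cyclic.
End Levels.

(** * Straight-line programs *)

Section Programs.
Variables (K : fieldType) (N : nat).
Local Notation fn := (('I_N -> K) -> K).
Local Notation code := (seq (instr K N)).
Implicit Types (c : code) (g : fn).

Definition regs c (alpha : 'I_N -> K) : seq K :=
  foldl (fun rs i => rcons rs (exec alpha rs i)) [::] c.

Lemma regs_rcons c i alpha :
  regs (rcons c i) alpha = rcons (regs c alpha) (exec alpha (regs c alpha) i).
Proof. by rewrite /regs foldl_rcons. Qed.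

Lemma size_regs c alpha : size (regs c alpha) = size c.
Proof.
by elim/last_ind: c => [|c i IH] //; rewrite regs_rcons !size_rcons IH.
Qed.

Lemma nth_regs_cat c c' alpha k : (k < size c)%N ->
  (regs (c ++ c') alpha)`_k = (regs c alpha)`_k.
Proof.
move=> hk; elim/last_ind: c' => [|c' i IH]; first by rewrite cats0.
rewrite -rcons_cat regs_rcons nth_rcons size_regs size_cat.
by rewrite (leq_trans hk) ?leq_addr.
Qed.

Definition valid c (o : operand K N) : bool := if o is Reg k then (k < size c)%N else true.

(* [valid] excludes registers not yet written: they read as 0 now but would
   change when the program is extended. *)
Definition avail c g := exists2 o, valid c o & forall alpha, read alpha (regs c alpha) o = g alpha.

Definition extends n c c' := exists2 d, c' = c ++ d & (size d <= n)%N.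

Lemma extends_refl c : extends 0 c c.
Proof. by exists [::]; rewrite ?cats0. Qed.

Lemma extends_trans n n' c c' c'' :
  extends n c c' -> extends n' c' c'' -> extends (n + n') c c''.
Proof.
move=> [d -> hd] [d' -> hd']; exists (d ++ d'); first by rewrite catA.
by rewrite size_cat leq_add.
Qed.

Lemma extends_le n n' c c' : (n <= n')%N -> extends n c c' -> extends n' c c'.
Proof. by move=> h [d -> hd]; exists d => //; apply: leq_trans hd h. Qed.

Lemma avail_extends n c c' g : extends n c c' -> avail c g -> avail c' g.
Proof.
move=> [d -> _] [o vo ho]; exists o.
  by case: o vo {ho} => //= k hk; rewrite size_cat ltn_addr.
by move=> alpha; rewrite -ho; case: o vo {ho} => //= k hk; apply: nth_regs_cat.
Qed.

Lemma avail_ext c g g' : g =1 g' -> avail c g -> avail c g'.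
Proof. by move=> e [o vo ho]; exists o => // alpha; rewrite -e. Qed.

Lemma avail_inp c i : avail c (fun alpha => alpha i).
Proof. by exists (Inp _ i). Qed.

Lemma avail_cst c x : avail c (fun _ => x).
Proof. by exists (Cst _ x). Qed.

Lemma avail_instr c i :
  exists2 c', extends 1 c c' & avail c' (fun alpha => exec alpha (regs c alpha) i).
Proof.
exists (rcons c i); first by exists [:: i]; rewrite ?cats1.
exists (Reg _ _ (size c)); first by rewrite /= size_rcons.
by move=> alpha /=; rewrite regs_rcons nth_rcons size_regs ltnn eqxx.
Qed.

Lemma avail_add c g1 g2 : avail c g1 -> avail c g2 ->
  exists2 c', extends 1 c c' & avail c' (fun alpha => g1 alpha + g2 alpha).
Proof.
move=> [o1 _ h1] [o2 _ h2]; have [c' hc h] := avail_instr c (Add o1 o2).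
by exists c' => //; apply: avail_ext h => alpha /=; rewrite h1 h2.
Qed.

Lemma avail_scale c x g : avail c g ->
  exists2 c', extends 1 c c' & avail c' (fun alpha => x * g alpha).
Proof.
move=> [o _ h1]; have [c' hc h] := avail_instr c (Scale x o).
by exists c' => //; apply: avail_ext h => alpha /=; rewrite h1.
Qed.

Lemma avail_comb c x1 g1 x2 g2 : avail c g1 -> avail c g2 ->
  exists2 c', extends 3 c c' & avail c' (fun alpha => x1 * g1 alpha + x2 * g2 alpha).
Proof.
move=> h1 h2; have [c1 e1 a1] := avail_scale x1 h1.
have [c2 e2 a2] := avail_scale x2 (avail_extends e1 h2).
have [c3 e3 a3] := avail_add (avail_extends e2 a1) a2.
by exists c3 => //; have := extends_trans (extends_trans e1 e2) e3.
Qed.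

Lemma avail_lin n c (m : nat -> K) (g : nat -> fn) :
  (forall k, (k < n)%N -> avail c (g k)) ->
  exists2 c', extends (2 * n) c c'
    & avail c' (fun alpha => \sum_(0 <= k < n) m k * g k alpha).
Proof.
elim: n => [|n IH] hg.
  exists c; first exact: extends_refl.
  by apply: avail_ext (avail_cst c 0) => alpha; rewrite big_nil.
have [k hk|c1 e1 a1] := IH; first exact/hg/ltnW.
have [c2 e2 a2] := avail_scale (m n) (avail_extends e1 (hg n (ltnSn n))).
have [c3 e3 a3] := avail_add (avail_extends e2 a1) a2.
exists c3.
  by apply: extends_le (extends_trans (extends_trans e1 e2) e3); lia.
by apply: avail_ext a3 => alpha; rewrite big_nat_recr.
Qed.

(** The hypothesis ranges over all extensions of c because the pieces computing the g k are appended
    one after the other. *)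
Lemma avail_family n q c (P : nat -> Prop) (g : nat -> fn) :
  (forall k, (k < n)%N -> P k -> forall p c1, extends p c c1 ->
     exists2 c2, extends q c1 c2 & avail c2 (g k)) ->
  (forall k, P k \/ ~ P k) ->
  exists2 c', extends (n * q) c c' & forall k, (k < n)%N -> P k -> avail c' (g k).
Proof.
move=> + dec; elim: n => [|n IH] hg; first by exists c; first exact: extends_refl.
have [k hk|c1 e1 a1] := IH; first exact/hg/ltnW.
have [Pn|nPn] := dec n; last first.
  exists c1; first by apply: extends_le e1; rewrite leq_mul2r leqnSn orbT.
  by move=> k; rewrite ltnS leq_eqVlt => /orP[/eqP->//|]; apply: a1.
have [c2 e2 a2] := hg n (ltnSn n) Pn _ _ e1.
exists c2; first by rewrite mulSn addnC; exact: extends_trans e1 e2.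
move=> k; rewrite ltnS leq_eqVlt => /orP[/eqP->//|hk Pk].
exact: avail_extends e2 (a1 k hk Pk).
Qed.

End Programs.

(** * The fast recursion for the residues *)

Section FFT.
Variables (K : fieldType) (G : zmodType) (N : nat).
Hypothesis two_neq0 : (2%:R : K) != 0.
Variables (b t : G).
Local Notation fn := (('I_N -> K) -> K).

(* Averaging over the translation by [T] splits the problem in two of half size:
   the even part is an interpolation problem on the quotient by [T], and so is
   the odd part after multiplication by [h]. The residues are linear functions
   of the values, so the two global scalars that are needed are linear
   combinations of the inputs with precomputed coefficients. Only the residues,
   and not the constant term, are passed on. *)
Lemma residues_program j H s w kappa : level H s w kappa -> cyclic_data b t H (2 ^ j) ->
  unisolvent b t s (2 ^ j) ->
  forall (c : seq (instr K N)) (beta : nat -> fn) (c0 : fn) (r : nat -> fn),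
  (forall k, (k < 2 ^ j)%N -> avail c (beta k)) ->
  (forall alpha k, (k < 2 ^ j)%N ->
     interp t s (2 ^ j) (c0 alpha) (r^~ alpha) (node b t k) = beta k alpha) ->
  exists2 c', extends (12 * j * 2 ^ j) c c'
    & forall l, (0 < l < 2 ^ j)%N -> avail c' (r l).
Proof.
elim: j H s w kappa => [|j IH] H s w kappa lev hcyc U c beta c0 r hb hi.
  by exists c; [exact: extends_refl|case].
move: hcyc U hb hi; have -> : (2 ^ j.+1 = 2 ^ j + 2 ^ j)%N by rewrite expnS mul2n addnn.
set m := (2 ^ j)%N => hcyc U hb hi.
have m_gt0 : (0 < m)%N by rewrite expn_gt0.
have HT := half_notin m_gt0 hcyc; have HTT := half2_in hcyc.
have lev' := next_level two_neq0 lev HT HTT.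
have cyc' := next_cyclic lev m_gt0 hcyc.
have U' := unisolvent_next two_neq0 lev m_gt0 hcyc U.
set T := t *+ m in HT HTT lev' cyc' U'.
have n_gt0 : (0 < m + m)%N by rewrite addn_gt0 m_gt0.
have [M hM] := interp_linear U n_gt0.
have rE alpha l : (0 < l < m + m)%N ->
    r l alpha = \sum_(0 <= k < m + m) M l k * beta k alpha.
  move=> /andP[l0 hl]; have := hM _ _ (fun k => beta k alpha) (hi alpha) l hl.
  by rewrite /coefs eqn0Ngt l0.
pose h := h s T.
pose rh alpha := rho m (r^~ alpha).
have rhE alpha : rh alpha = \sum_(0 <= k < m + m)
    (M m k + \sum_(1 <= l < m) (M l k + M (l + m)%N k) / 2%:R) * beta k alpha.
  rewrite /rh /rho rE; last by lia.
  under [RHS]eq_bigr => k _ do rewrite mulrDl mulr_suml.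
  rewrite big_split /=; congr (_ + _); rewrite exchange_big_nat /=.
  apply: eq_big_nat => l hl; rewrite /rplus !rE; [|lia..].
  rewrite -big_split /= mulr_suml; apply: eq_bigr => k _.
  by rewrite -mulrDl mulrAC.
(* The residue at T is not among the unknowns of either half-size problem and is computed directly
   from the values. *)
have [d1 e1 a1] := avail_lin (M m) hb.
have rm_av : avail d1 (r m).
  by apply: avail_ext a1 => alpha; rewrite rE //; lia.
have [d2 e2 a2] := avail_lin (fun k => M m k + \sum_(1 <= l < m) (M l k + M (l + m)%N k) / 2%:R)
  (fun k hk => avail_extends e1 (hb k hk)).
have {a2} rh_av : avail d2 rh by apply: avail_ext a2 => alpha; rewrite rhE.
have e12 := extends_trans e1 e2.
have hb2 k hk := avail_extends e12 (hb k hk).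
pose bp k : fn := fun alpha => 2%:R^-1 * beta k alpha + 2%:R^-1 * beta (k + m)%N alpha.
pose x k := node b t k.
pose bm k : fn := fun alpha => (h (x k) / 2%:R * beta k alpha
  + (- (h (x k) / 2%:R)) * beta (k + m)%N alpha).
pose bg k : fn := fun alpha => 1 * bm k alpha + (- h (x k) ^+ 2) * rh alpha.
have [d3 e3 a3] : exists2 c', extends (m * 3) d2 c' &
    forall k, (k < m)%N -> True -> avail c' (bp k).
  apply: avail_family => [k hk _ p c1 ec|k]; last by left.
  by apply: avail_comb; apply: avail_extends ec _; apply: hb2; lia.
have [d4 e4 a4] : exists2 c', extends (m * 6) d3 c' &
    forall k, (k < m)%N -> True -> avail c' (bg k).
  apply: avail_family => [k hk _ p c1 ec|k]; last by left.
  have [c2 ec2 ac2] : exists2 c2, extends 3 c1 c2 & avail c2 (bm k).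
    by apply: avail_comb; apply: avail_extends ec _; apply: avail_extends e3 _; apply: hb2; lia.
  have rh_av' := avail_extends ec2 (avail_extends ec (avail_extends e3 rh_av)).
  have [c3 ec3 ac3] := avail_comb 1 (- h (x k) ^+ 2) ac2 rh_av'.
  by exists c3 => //; exact: extends_trans ec2 ec3.
have [d5 e5 a5] : exists2 c', extends (12 * j * m) d4 c' &
    forall l, (0 < l < m)%N -> avail c' (fun alpha => rplus m (r^~ alpha) l).
  apply: (IH _ _ _ _ lev' cyc' U' _ bp
    (fun alpha => even_cst t s m (c0 alpha) (r^~ alpha))).
    by move=> k hk; apply: avail_extends e4 (a3 k hk I).
  move=> alpha k hk; apply: (mulfI two_neq0).
  have := interp_even two_neq0 lev m_gt0 hcyc (c0 alpha) (r^~ alpha) (node b t k) => <-.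
  rewrite -node_shift !hi; [|lia..].
  by rewrite /bp mulrDr !mulVKf.
pose gm l : fn := fun alpha => h (t *+ l) * rminus m (r^~ alpha) l.
have [d6 e6 a6] : exists2 c', extends (12 * j * m) d5 c' &
    forall l, (0 < l < m)%N -> avail c' (gm l).
  apply: (IH _ _ _ _ lev' cyc' U' _ bg (fun alpha => - \sum_(1 <= l < m)
    rminus m (r^~ alpha) l * (w (- (t *+ l) + T) - w (- (t *+ l))))).
    by move=> k hk; apply: avail_extends e5 (a4 k hk I).
  move=> alpha k hk.
  have := odd_interp two_neq0 lev m_gt0 hcyc (r^~ alpha) k => <-.
  have : rho m (r^~ alpha) * h (node b t k) - \sum_(1 <= l < m) rminus m (r^~ alpha) l
    * h (node b t k - t *+ l) = (beta k alpha - beta (k + m)%N alpha) / 2%:R.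
    apply: (mulfI two_neq0).
    have := interp_odd two_neq0 lev m_gt0 hcyc (c0 alpha) (r^~ alpha) (node b t k) => <-.
    by rewrite -node_shift !hi ?mulVKf //; [rewrite mulrCA mulfV ?mulr1|lia..].
  move=> ->; rewrite /bg /bm /rh -/T -/h -/(x k); field; exact: two_neq0.
have gm_inv l alpha : (0 < l < m)%N ->
    rminus m (r^~ alpha) l = (h (t *+ l))^-1 * gm l alpha.
  move=> hl; rewrite /gm mulKf // ; apply: (hl_neq0 two_neq0 lev m_gt0 hcyc) => //.
  (* An index 0 < l < m forces m > 1, and the power of two m is then even, as [hl_neq0] requires. *)
  have j0 : (0 < j)%N.
    by rewrite lt0n; apply/eqP => j0; move: hl; rewrite /m j0 expn0; case: (l) => [|[]].
  by rewrite /m -(prednK j0) expnS dvdn_mulr.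
have [d7 e7 a7] : exists2 c', extends (m * 6) d6 c' &
    forall l, (l < m)%N -> (0 < l)%N -> avail c' (r l) /\ avail c' (r (l + m)%N).
  have [c1 ec1 ac1] : exists2 c', extends (m * 3) d6 c' &
      forall l, (l < m)%N -> (0 < l)%N -> avail c' (r l).
    apply: avail_family => [l hl l0 p c1 ec|k]; last by case: (0 < k)%N; [left|right].
    have hl' : (0 < l < m)%N by rewrite l0.
    have := avail_comb 1 (h (t *+ l))^-1 (avail_extends ec (avail_extends e6 (a5 l hl')))
      (avail_extends ec (a6 l hl')).
    move=> [c2 ec2 ac2]; exists c2 => //; apply: avail_ext ac2 => alpha.
    by rewrite -gm_inv // /rplus /rminus; field.
  have [c2 ec2 ac2] : exists2 c', extends (m * 3) c1 c' &
      forall l, (l < m)%N -> (0 < l)%N -> avail c' (r (l + m)%N).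
    apply: avail_family => [l hl l0 p c2 ec|k]; last by case: (0 < k)%N; [left|right].
    have hl' : (0 < l < m)%N by rewrite l0.
    have ec' := extends_trans ec1 ec.
    have := avail_comb 1 (- (h (t *+ l))^-1) (avail_extends ec' (avail_extends e6 (a5 l hl')))
      (avail_extends ec' (a6 l hl')).
    move=> [c3 ec3 ac3]; exists c3 => //; apply: avail_ext ac3 => alpha.
    by rewrite mulNr -gm_inv // /rplus /rminus; field.
  exists c2; first by rewrite (_ : m * 6 = m * 3 + m * 3)%N; [exact: extends_trans ec1 ec2|lia].
  by move=> l hl l0; split; [apply: avail_extends ec2 (ac1 l hl l0)|exact: ac2].
have ee := extends_trans (extends_trans (extends_trans (extends_trans
  (extends_trans e12 e3) e4) e5) e6) e7.
exists d7.
  (* Origin of 12: the two linear forms cost 8m, [bp] 3m, [bg] 6m, the recovery of the residues 6m,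
     and the recursive calls 24jm; (24j + 23)m is at most 12 (j + 1) 2m. *)
  apply: extends_le ee; nia.
move=> l hl; case: (ltngtP l m) => [lm|ml|->].
- by apply: (a7 l lm _).1; lia.
- rewrite -(subnK (ltnW ml)); apply: (a7 _ _ _).2; lia.
apply: avail_extends rm_av.
exact: extends_trans (extends_trans (extends_trans (extends_trans
  (extends_trans e2 e3) e4) e5) e6) e7.
Qed.

End FFT.

(** * The group of points and unisolvence *)

Section CurveGroup.
Variables (F : fieldType) (E : weierstrass F).
Hypothesis two_neq0 : (2%:R : F) != 0.
Hypothesis disc_neq0 : disc E != 0.

(* The hypotheses are arguments so that the group structure can be inferred. *)
Definition ecpt of (2%:R : F) != 0 & disc E != 0 := {P : point F | on_curve E P}.
Local Notation G := (ecpt two_neq0 disc_neq0).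

HB.instance Definition _ := SubChoice.on G.

Definition pt (x : G) : point F := sval x.
Definition ecO : G := exist _ None isT.
Definition ecN (x : G) : G := exist _ (negpt E (pt x)) (on_curve_neg two_neq0 (svalP x)).
Definition ecD (x y : G) : G :=
  exist _ (addpt E (pt x) (pt y)) (on_curve_add two_neq0 (svalP x) (svalP y)).

Lemma pt_inj : injective pt. Proof. exact: val_inj. Qed.

Lemma ecA : associative ecD.
Proof. by move=> x y z; apply: pt_inj; exact: (addptA two_neq0 disc_neq0 (svalP x) (svalP y) (svalP z)). Qed.
Lemma ecC : commutative ecD.
Proof. by move=> x y; apply: pt_inj; exact: (addptC two_neq0 disc_neq0 (svalP x) (svalP y)). Qed.
Lemma ec0 : left_id ecO ecD.
Proof. by move=> x; apply: pt_inj. Qed.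
Lemma ecNx : left_inverse ecO ecN ecD.
Proof. by move=> x; rewrite ecC; apply: pt_inj; apply: addpt_neg. Qed.

HB.instance Definition _ := GRing.isZmodule.Build G ecA ecC ec0 ecNx.

Lemma ptD (x y : G) : pt (x + y) = addpt E (pt x) (pt y). Proof. by []. Qed.
Lemma ptN (x : G) : pt (- x) = negpt E (pt x). Proof. by []. Qed.
Lemma pt_eq0 (x : G) : pt x = None -> x = 0. Proof. by move=> h; apply: pt_inj. Qed.
Lemma ptMn (x : G) n : pt (x *+ n) = mulpt E n (pt x).
Proof. by elim: n => [|n IH] //; rewrite mulrS ptD IH. Qed.
Lemma pt_on (x : G) : on_curve E (pt x). Proof. exact: (svalP x). Qed.

Definition sgG (x y : G) : F := sg E (pt x) (pt y).
Definition xG (x : G) : F := xco (pt x).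
Definition etaG (x : G) : F := eta E (xco (pt x)) (yco (pt x)).
Definition zeroG : pred G := pred1 0.

Lemma crdE (x : G) : x != 0 -> crd E (pt x) = [:: (xG x, etaG x)].
Proof.
move=> hx; rewrite /xG /etaG; case e: (pt x) => [[u v]|] //.
by rewrite (pt_eq0 e) eqxx in hx.
Qed.

Lemma etaG_sqr x : x != 0 -> etaG x ^+ 2 = (wcubic (A2 E) (A4 E) (A6 E)).[xG x].
Proof.
move=> hx; have := pt_on x; rewrite /xG /etaG; case e: (pt x) => [[u v]|].
  by rewrite on_curveE // => /eqP.
by rewrite (pt_eq0 e) eqxx in hx.
Qed.

Lemma xGN x : xG (- x) = xG x.
Proof. by rewrite /xG ptN; case: (pt x) => [[]|]. Qed.

Lemma etaGN x : x != 0 -> etaG (- x) = - etaG x.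
Proof.
move=> hx; rewrite /etaG ptN; case e: (pt x) => [[u v]|] /=; first exact: negpt_eta.
by rewrite (pt_eq0 e) eqxx in hx.
Qed.

Lemma coord_inj x y : x != 0 -> y != 0 -> xG x = xG y -> etaG x = etaG y -> x = y.
Proof.
move=> hx hy; rewrite /xG /etaG; case ex: (pt x) => [[u v]|]; last first.
  by rewrite (pt_eq0 ex) eqxx in hx.
case ey: (pt y) => [[u' v']|] /=; last by rewrite (pt_eq0 ey) eqxx in hy.
move=> eu; rewrite {}eu in ex *; move/eta_inj => ev; apply: pt_inj.
by rewrite ex ey ev.
Qed.

Lemma xG_inj x y : x != 0 -> y != 0 -> xG x = xG y -> x = y \/ x = - y.
Proof.
move=> hx hy e; have := etaG_sqr hx; rewrite e -etaG_sqr // => /eqP.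
rewrite eqf_sqr => /orP[] /eqP he; [left|right]; apply: coord_inj => //.
- by rewrite oppr_eq0.
- by rewrite xGN.
- by rewrite etaGN.
Qed.

Lemma sgG_spec x y : x != 0 -> y != 0 -> x + y != 0 ->
  [/\ etaG y = etaG x + sgG x y * (xG y - xG x),
   etaG (x + y) = - (etaG x + sgG x y * (xG (x + y) - xG x))
   & sgG x y ^+ 2 = xG x + xG y + xG (x + y) + A2 E].
Proof.
move=> hx hy hxy; have n z : z != 0 -> pt z <> None.
  by move=> hz e; rewrite (pt_eq0 e) eqxx in hz.
have := n _ hxy; have := n _ hx; have := n _ hy; rewrite /etaG /sgG /xG ptD.
case: (addP two_neq0 (pt_on x) (pt_on y)) => // x1 y1 x2 y2 x3 y3 s _ h1 h2 _ h3 _ _ _ /=.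
Qed.

Lemma sgGC x y : sgG x y = sgG y x.
Proof. exact: (sgC two_neq0 disc_neq0 (pt_on x) (pt_on y)). Qed.

Lemma curve_level : level zeroG sgG xG (A2 E).
Proof.
split.
- exact: eqxx.
- by move=> x y /eqP-> /eqP->; rewrite subrr; exact: eqxx.
- exact: sgGC.
- move=> x y z.
  have [_ e] := addpt_cocycle two_neq0 disc_neq0 (pt_on x) (pt_on y) (pt_on z).
  by rewrite [sgG x (y + z)]sgGC; exact: e.
- by move=> x; exact: sg_neg.
- by move=> e x y /eqP->; rewrite addr0.
- exact: xGN.
- by move=> e x /eqP->; rewrite addr0.
- by move=> x y hx hy hxy; have [] := sgG_spec hx hy hxy.
move=> x y hx hy e; apply/orP; case: (xG_inj hx hy e) => ->; [right|left].
  by rewrite subrr; exact: eqxx.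
by rewrite addNr; exact: eqxx.
Qed.

(** Replacing two points by their sum keeps the list principal with the same deficit; the single
    point left at the end must be O, with deficit 0. *)
Lemma Abel e (s : seq G) tau : PrinP E e (map pt s) tau ->
  e = 0%N /\ \sum_(x <- s) x = 0.
Proof.
elim: (size s).+1 {-2}s (ltnSn (size s)) tau => // n IH [|x [|y s']] hs tau.
- by rewrite big_nil => /PrinP_nil [-> _].
- move=> /(PrinP_singleton two_neq0 (pt_on x)) [ex -> _].
  by rewrite big_seq1 (pt_eq0 ex).
move=> /(PrinP_add two_neq0 disc_neq0 _ _ _ (pt_on x) (pt_on y)).
rewrite -ptD -map_cons => /IH [|-> ]; first by rewrite -ltnS.
by rewrite !big_cons addrA.
Qed.

End CurveGroup.

(** The reduction modulo T pairs l with l + m; below, l is paired with 2m - l, because lt and -lt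
    share their abscissa. *)
Lemma sum_reflect (V : nmodType) m (F : nat -> V) :
  \sum_(1 <= l < m) F (l + m)%N = \sum_(1 <= l < m) F (m + m - l)%N.
Proof. by rewrite big_nat_rev; apply: eq_big_nat => l hl; congr F; lia. Qed.

(** * Unisolvence on the curve *)

Section Interpolation.
Variables (K : fieldType) (E : weierstrass K).
Hypothesis two_neq0 : (2%:R : K) != 0.
Hypothesis disc_neq0 : disc E != 0.
Local Notation G := (ecpt two_neq0 disc_neq0).
Variables (b t : G) (m : nat).
Hypothesis m_gt0 : (0 < m)%N.
Hypothesis hcyc : cyclic_data b t (@zeroG K E two_neq0 disc_neq0) (m + m).
Local Notation d := (m + m)%N.
Local Notation X l := (xG (t *+ l)).
Local Notation Y l := (etaG (t *+ l)).
Local Notation cubic := (wcubic (A2 E) (A4 E) (A6 E)).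

Lemma tk0 k : (t *+ k == 0) = (d %| k)%N.
Proof. exact: (proj1 hcyc). Qed.

Lemma t_sub i l : (i <= l)%N -> t *+ l - t *+ i = t *+ (l - i).
Proof. by move=> h; rewrite mulrnBr. Qed.

Lemma t_add i l : t *+ l + t *+ i = t *+ (l + i).
Proof. by rewrite mulrnDr. Qed.

Lemma bd0 : b *+ d != 0. Proof. exact: (proj2 hcyc). Qed.

Lemma td0 : t *+ d = 0. Proof. by apply/eqP; rewrite tk0. Qed.

Lemma td_sub l : (l <= d)%N -> t *+ (d - l) = - (t *+ l).
Proof. by move=> hl; rewrite mulrnBr // td0 sub0r. Qed.

Lemma tl_neq0 l : (0 < l < d)%N -> t *+ l != 0.
Proof. by move=> /andP[l0 hl]; rewrite tk0; apply/negP => /(dvdn_leq l0); rewrite leqNgt hl. Qed.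

Lemma node_sub k l : node b t k - t *+ l != 0.
Proof.
apply: contra bd0 => /eqP e; apply/eqP.
have : (node b t k - t *+ l) *+ d = 0 by rewrite e mul0rn.
rewrite /node mulrnBl mulrnDl -!mulrnA !(mulnC _ d) !mulrnA td0 !mul0rn.
by rewrite addr0 subr0.
Qed.

Lemma node_neq0 k : node b t k != 0.
Proof. by have := node_sub k 0; rewrite mulr0n subr0. Qed.

Lemma sg_node k l : (0 < l < d)%N ->
  sgG (node b t k) (- (t *+ l)) * (xG (node b t k) - X l) = etaG (node b t k) + Y l.
Proof.
move=> hl; have h1 := tl_neq0 hl.
have [] := @sgG_spec _ _ two_neq0 disc_neq0 (node b t k) (- (t *+ l)).
- exact: node_neq0.
- by rewrite oppr_eq0.
- exact: node_sub.
rewrite xGN etaGN // => e _ _; have -> : Y l = - - Y l by rewrite opprK.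
by rewrite e; ring.
Qed.

Lemma X_reflect l : (l <= d)%N -> X (d - l) = X l.
Proof. by move=> hl; rewrite td_sub // xGN. Qed.

Lemma Y_reflect l : (0 < l < d)%N -> Y (d - l) = - Y l.
Proof. by move=> /andP[l0 hl]; rewrite td_sub ?etaGN ?tl_neq0 ?l0 // ltnW. Qed.

Lemma Ym0 : Y m = 0.
Proof.
have hm : (0 < m < d)%N by lia.
have := Y_reflect hm; rewrite addnK => e; apply/eqP.
have : 2%:R * Y m == 0 by rewrite mulr_natl mulr2n {1}e addNr.
by rewrite mulf_eq0 (negPf two_neq0).
Qed.

Lemma Yl_neq0 l : (0 < l < m)%N -> Y l != 0.
Proof.
move=> hl; apply/eqP => e.
have tl0 : t *+ l != 0 by apply: tl_neq0; lia.
have : t *+ l = - (t *+ l).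
  by apply: coord_inj; rewrite ?oppr_eq0 // ?xGN // etaGN // e oppr0.
move/eqP; rewrite -addr_eq0 t_add tk0 => /dvdn_leq; lia.
Qed.

Lemma X_neq i l : (0 < i <= m)%N -> (0 < l <= m)%N -> i != l -> X l - X i != 0.
Proof.
move=> hi hl hil; rewrite subr_eq0; apply/eqP => /xG_inj.
have ti0 : t *+ i != 0 by apply: tl_neq0; lia.
have tl0 : t *+ l != 0 by apply: tl_neq0; lia.
move=> /(_ tl0 ti0) [] /eqP; rewrite -subr_eq0.
  case: (ltngtP i l) hil => // h _.
    by rewrite (t_sub (ltnW h)) tk0 => /dvdn_leq; lia.
  by rewrite -oppr_eq0 opprB (t_sub (ltnW h)) tk0 => /dvdn_leq; lia.
by rewrite opprK t_add tk0 => /dvdn_leq; lia.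
Qed.

(** A common denominator of the slopes s(P, -lt): the one of index l is x - x(lt), shared by l and d
    - l. *)
Definition Dall : {poly K} := \prod_(i <- iota 1 m) ('X - (X i)%:P).
Definition Dsub l : {poly K} := \prod_(i <- iota 1 m | i != l) ('X - (X i)%:P).

Lemma Dall_split l : (0 < l <= m)%N -> Dall = ('X - (X l)%:P) * Dsub l.
Proof.
by move=> hl; rewrite /Dall (bigD1_seq l) ?iota_uniq // mem_iota; lia.
Qed.

Lemma size_Dall : size Dall = m.+1.
Proof. by rewrite /Dall size_prod_XsubC size_iota. Qed.

Lemma Dall_neq0 : Dall != 0. Proof. by rewrite -size_poly_eq0 size_Dall. Qed.

Lemma size_Dsub l : (0 < l <= m)%N -> size (Dsub l) = m.
Proof.
move=> hl; have n0 : Dsub l != 0.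
  by apply: contraNneq Dall_neq0 => e; rewrite (Dall_split hl) e mulr0.
have := size_Dall; rewrite (Dall_split hl) size_mul ?polyXsubC_eq0 // size_XsubC.
by case.
Qed.

Lemma Dsub_root i l : (0 < i <= m)%N -> i != l -> (Dsub l).[X i] = 0.
Proof.
move=> hi hil; apply/eqP; rewrite /Dsub horner_prod prodf_seq_eq0; apply/hasP.
by exists i; rewrite ?mem_iota ?hil ?hornerXsubC ?subrr ?eqxx //; lia.
Qed.

Lemma Dsub_neq0 l : (0 < l <= m)%N -> (Dsub l).[X l] != 0.
Proof.
move=> hl; rewrite /Dsub horner_prod prodf_seq_neq0; apply/allP => i.
by rewrite mem_iota => hi; apply/implyP => hil; rewrite !hornerE X_neq //; lia.
Qed.

Section Numerator.
Variables (c0 : K) (r : nat -> K).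

(** [num_p] + [num_q] eta is the interpolant times [Dall]. It is read off from s(P, -lt)(x - x(lt))
    = eta + eta(lt), with eta(-lt) = -eta(lt) and eta(mt) = 0. *)
Definition num_p : {poly K} := c0%:P * Dall
  + \sum_(1 <= l < m) ((r l - r (d - l)%N) * Y l)%:P * Dsub l.
Definition num_q : {poly K} :=
  (r m)%:P * Dsub m + \sum_(1 <= l < m) (r l + r (d - l)%N)%:P * Dsub l.

Lemma num_node k : num_p.[xG (node b t k)] + num_q.[xG (node b t k)] * etaG (node b t k)
  = Dall.[xG (node b t k)] * interp t (@sgG _ _ two_neq0 disc_neq0) d c0 r (node b t k).
Proof.
set P := node b t k; set x := xG P; set u := etaG P.
pose a l := sgG P (- (t *+ l)).
have DE l : (0 < l <= m)%N -> Dall.[x] = (x - X l) * (Dsub l).[x].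
  by move=> hl; rewrite (Dall_split hl) hornerM hornerXsubC.
have em : Dall.[x] * (r m * a m) = r m * (Dsub m).[x] * u.
  have hm : (0 < m < d)%N by lia.
  rewrite (DE m) ?m_gt0 ?leqnn //.
  have := sg_node k hm; rewrite Ym0 addr0 -/P -/x -/u -/(a m) => <-; ring.
have el l : (0 < l < m)%N -> Dall.[x] * (r l * a l + r (d - l)%N * a (d - l)%N)
    = (r l - r (d - l)%N) * Y l * (Dsub l).[x] + (r l + r (d - l)%N) * (Dsub l).[x] * u.
  move=> hl; have hl1 : (0 < l < d)%N by lia.
  have hl2 : (0 < d - l < d)%N by lia.
  rewrite (DE l); last by lia.
  have := sg_node k hl1; have := sg_node k hl2.
  rewrite Y_reflect // X_reflect; last by lia.
  rewrite -/P -/x -/u -/(a l) -/(a (d - l)%N).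
  move: (a l) (a _) (x - X l) (Y l) (Dsub l).[x] => al al' w y D e1 e2.
  transitivity ((r l * (al * w) + r (d - l)%N * (al' * w)) * D); first by ring.
  by rewrite e1 e2; ring.
transitivity (c0 * Dall.[x] + (r m * (Dsub m).[x] * u
  + \sum_(1 <= l < m) ((r l - r (d - l)%N) * Y l * (Dsub l).[x]
       + (r l + r (d - l)%N) * (Dsub l).[x] * u))).
  rewrite /num_p /num_q !hornerD !horner_sum !hornerM !hornerC mulrDl.
  rewrite -addrA; congr (_ + _); rewrite addrCA; congr (_ + _).
  rewrite mulr_suml -big_split /=; apply: eq_bigr => l _.
  by rewrite !hornerM !hornerC.
have -> : interp t (@sgG _ _ two_neq0 disc_neq0) d c0 r P
   = c0 + (r m * a m + \sum_(1 <= l < m) (r l * a l + r (d - l)%N * a (d - l)%N)).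
  rewrite /interp sum_halves //; congr (_ + (_ + _)).
  rewrite big_split /= (sum_reflect m (fun l => r l * a l)) -big_split /=.
  by [].
rewrite [RHS]mulrDr [Dall.[x] * c0]mulrC [Z in _ = _ + Z]mulrDr em mulr_sumr; congr (_ + (_ + _)).
by apply: eq_big_nat => l hl; rewrite el.
Qed.

Lemma num_T : num_p.[X m] + num_q.[X m] * Y m = 0.
Proof.
rewrite Ym0 mulr0 addr0 /num_p hornerD horner_sum hornerM (Dall_split (l := m)) ?m_gt0 ?leqnn //.
rewrite hornerM hornerXsubC subrr mul0r mulr0 add0r big_nat big1 // => l hl.
by rewrite hornerM Dsub_root ?mulr0 //; lia.
Qed.

Lemma size_num_p : (size num_p <= m.+1)%N.
Proof.
apply: leq_trans (size_polyD _ _) _; rewrite geq_max; apply/andP; split.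
  by apply: leq_trans (size_polyMleq _ _) _; rewrite size_Dall; case: size (size_polyC_leq1 c0) => [|[]] //=; lia.
apply: leq_trans (size_sum _ _ _) _; apply/bigmax_leqP_seq => l.
rewrite mem_index_iota => hl _; rewrite mul_polyC.
by apply: leq_trans (size_scale_leq _ _) _; rewrite size_Dsub; lia.
Qed.

Lemma size_num_q : (size num_q <= m)%N.
Proof.
apply: leq_trans (size_polyD _ _) _; rewrite geq_max !mul_polyC; apply/andP; split.
  by apply: leq_trans (size_scale_leq _ _) _; rewrite size_Dsub; lia.
apply: leq_trans (size_sum _ _ _) _; apply/bigmax_leqP_seq => l.
rewrite mem_index_iota => hl _; rewrite mul_polyC.
by apply: leq_trans (size_scale_leq _ _) _; rewrite size_Dsub; lia.
Qed.

(** Evaluation at x(lt) isolates the index l: [num_q] gives r_l + r_(d-l) = 0 and [num_p] gives r_l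
    - r_(d-l) = 0, as eta(lt) is nonzero for 0 < l < m. *)
Lemma num_eq0 : num_p = 0 -> num_q = 0 -> c0 = 0 /\ forall l, (0 < l < d)%N -> r l = 0.
Proof.
have hm : (0 < m <= m)%N by rewrite m_gt0 leqnn.
have sumX (f : nat -> K) l : (0 < l < m)%N ->
    (\sum_(1 <= i < m) (f i)%:P * Dsub i).[X l] = f l * (Dsub l).[X l].
  move=> hl; have hl' : (0 < l <= m)%N by lia.
  rewrite horner_sum (bigD1_seq l) /= ?mem_index_iota //; last exact: iota_uniq.
  rewrite hornerM hornerC big1 ?addr0 // => i il.
  by rewrite hornerM Dsub_root ?mulr0 // eq_sym.
have sumXm (f : nat -> K) : (\sum_(1 <= i < m) (f i)%:P * Dsub i).[X m] = 0.
  rewrite horner_sum big_nat big1 // => i hi.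
  by rewrite hornerM Dsub_root ?mulr0 //; lia.
move=> ep eq.
have rl l : (0 < l < m)%N -> r l = 0 /\ r (d - l)%N = 0.
  move=> hl; have hl' : (0 < l <= m)%N by lia.
  have hml : l != m by lia.
  have D0 := Dsub_neq0 hl'.
  have := congr1 (fun s : {poly K} => s.[X l]) eq.
  rewrite /num_q hornerD sumX // hornerM (Dsub_root (i := l) (l := m)) // mulr0 add0r horner0.
  move=> /eqP; rewrite mulf_eq0 (negPf D0) orbF => /eqP e1.
  have := congr1 (fun s : {poly K} => s.[X l]) ep.
  rewrite /num_p hornerD sumX // hornerM (Dall_split hl') hornerM hornerXsubC subrr mul0r mulr0 add0r horner0.
  move=> /eqP; rewrite !mulf_eq0 (negPf D0) orbF (negPf (Yl_neq0 hl)) orbF => /eqP e2.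
  have r0 : r l = 0.
    apply: (mulfI two_neq0); rewrite mulr0 -[RHS](addr0 0) -{1}e1 -e2; ring.
  by split=> //; rewrite -e1 r0 add0r.
have rm0 : r m = 0.
  have := congr1 (fun s : {poly K} => s.[X m]) eq.
  rewrite /num_q hornerD sumXm hornerM hornerC addr0 horner0 => /eqP.
  by rewrite mulf_eq0 (negPf (Dsub_neq0 hm)) orbF => /eqP.
split.
  move: ep; rewrite /num_p big_nat big1 ?addr0 => [/eqP|l hl].
    by rewrite mulf_eq0 (negPf Dall_neq0) orbF polyC_eq0 => /eqP.
  by have [-> ->] := rl l hl; rewrite subrr mul0r polyC0 mul0r.
move=> l hl; case: (ltngtP l m) => [lm|ml|-> //].
  by apply: (proj1 (rl l _)); lia.
have := proj2 (rl (d - l)%N _); rewrite subKn; [apply; lia|lia].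
Qed.

End Numerator.

Definition zeros : seq G := t *+ m :: [seq node b t k | k <- iota 0 d].

Lemma zeros_neq0 x : x \in zeros -> x != 0.
Proof.
rewrite inE => /orP[/eqP->|/mapP[k _ ->]]; last exact: node_neq0.
by apply: tl_neq0; lia.
Qed.

Lemma zeros_uniq : uniq zeros.
Proof.
rewrite /zeros /=; apply/andP; split.
  apply/negP => /mapP[k _ e]; have := node_sub k m.
  by rewrite -e subrr eqxx.
rewrite map_inj_in_uniq ?iota_uniq // => i j; rewrite !mem_iota => hi hj.
rewrite /node => /addrI => e; apply/eqP.
case: (ltngtP i j) => // h.
  have : t *+ j - t *+ i == 0 by rewrite e subrr.
  by rewrite (t_sub (ltnW h)) tk0 => /dvdn_leq; lia.
have : t *+ i - t *+ j == 0 by rewrite e subrr.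
by rewrite (t_sub (ltnW h)) tk0 => /dvdn_leq; lia.
Qed.

Lemma sum_zeros : \sum_(x <- zeros) x = b *+ d.
Proof.
rewrite /zeros big_cons big_map.
have -> : \sum_(k <- iota 0 d) node b t k = b *+ d + t *+ (d * d.-1)./2.
  rewrite /node big_split /=; congr (_ + _).
    by rewrite big_const_seq count_predT size_iota iter_addr_0.
  rewrite -bin2 -bin2_sum /index_iota subn0.
  by rewrite (big_morph (fun k => t *+ k) (id1 := 0) (op1 := +%R) _ (mulr0n t)) // => i j; exact: mulrnDr.
(* The extra zero T brings the multiple of t to m + d(d - 1)/2 = dm, so that t drops out of the
   sum. *)
rewrite addrCA t_add; have -> : (m + (d * d.-1)./2 = d * m)%N by nia.
by rewrite mulrnA td0 mul0rn addr0.
Qed.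

Local Notation Van := (Van (pc E) (et E)).

Lemma Van_uniq (s : seq (K * K)) f : uniq s -> KE (pc E) (et E) f ->
  (forall P, P \in s -> Van [:: P] f) -> Van s f.
Proof.
move=> + Kf; elim: s => [|P s IH] //= /andP[hP us] h.
apply: (Van_cons (et_sqr E two_neq0) hP); last exact: h (mem_head _ _).
by apply: IH => // Q hQ; apply: h; rewrite inE hQ orbT.
Qed.

Lemma crd_zeros : flatten (map (crd E) (map (@pt _ _ _ _) zeros))
  = [seq (xG x, etaG x) | x <- zeros].
Proof.
elim: zeros zeros_neq0 => //= x s IH h.
by rewrite crdE ?h ?mem_head // IH // => y hy; apply: h; rewrite inE hy orbT.
Qed.

Lemma unisolvent_curve : unisolvent b t (@sgG _ _ two_neq0 disc_neq0) d.
Proof.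
move=> c0 r h; pose p := num_p c0 r; pose q := num_q r.
have [e|pq] := eqVneq (p, q) (0, 0).
  by case: e => ep eq; apply: num_eq0.
exfalso.
have [n [l [tau [l0 [ht h1 h2]]]]] := topl_exists pq.
(* [num_p] has weight at most 2m = d, and [num_q] eta at most 2(m - 1) + 3 = d + 1. *)
have hn : (n <= d.+1)%N.
  rewrite leqNgt; apply/negP => hn; case/eqP: l0; rewrite -h1 coef_gr.
  have sp := size_num_p c0 r; have sq := size_num_q r.
  case: ifP => on; last by rewrite nth_default // (leq_trans sp) //; lia.
  case: ifP => // _; rewrite nth_default // (leq_trans sq) //.
  by have := odd_double_half n; rewrite on; lia.
pose f := pc E (l^-1 *: p) + pc E (l^-1 *: q) * et E.
have hf : f = pc E l^-1%:P * (pc E p + pc E q * et E).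
  by rewrite /f -!mul_polyC !pcM [RHS]mulrDr [in RHS]mulrA.
have hV : Van [seq (xG x, etaG x) | x <- zeros] f.
  rewrite hf; apply: (VanMl (et_sqr E two_neq0)); first exact: KE_io.
  apply: Van_uniq.
  - rewrite map_inj_in_uniq ?zeros_uniq // => x y hx hy [ex ey].
    by apply: coord_inj => //; apply: zeros_neq0.
  - by exists p, q.
  move=> P /mapP[x hx ->].
  apply/(Van1_eval (et_sqr E two_neq0) (@et_free _ E)).
    by apply: etaG_sqr; apply: zeros_neq0.
  move: hx; rewrite inE => /orP[/eqP->|/mapP[k]]; first exact: num_T.
  rewrite mem_iota => /andP[_ hk] ->.
  by have /= -> := num_node c0 r k; rewrite h ?mulr0.
have hP : PrinP E (d.+1 - n) (map (@pt _ _ _ _) zeros) (tau / l).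
  exists f, n; rewrite crd_zeros size_map /zeros /= size_map size_iota subnKC //.
  split=> //; exists (l^-1 *: p), (l^-1 *: q); split=> //.
  have eg : gr (l^-1 *: p) (l^-1 *: q) = l^-1 *: gr p q.
    by rewrite /gr !comp_polyZ scalerDr scalerAl.
  split=> [k hk||]; rewrite eg.
  + by rewrite coefZ ht ?mulr0.
  + by rewrite coefZ h1 mulVf.
  + by rewrite -scalerAr coefZ h2 mulrC.
have [_] := Abel hP; rewrite sum_zeros => e.
by have := bd0; rewrite e eqxx.
Qed.

End Interpolation.

(** * The generic point *)

Lemma chord_aux (R : pzRingType) (a c m x y : R) :
  c = a + m * (y - x) -> m * (x - y) = a - c.
Proof. by move=> ->; rewrite opprD addrA subrr sub0r -mulrN opprB. Qed.

Lemma eta_sub_aux (R : comPzRingType) (y y0 c x c' x0 : R) :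
  y - y0 = y + c * x + c' - (y0 + c * x0 + c') - c * (x - x0).
Proof. ring. Qed.

Section BaseChange.
Variables (K : fieldType) (E : weierstrass K).
Hypothesis two_neq0 : (2%:R : K) != 0.
Hypothesis disc_neq0 : disc E != 0.
Local Notation L := (funfield E).
Local Notation E' := (genE E).
Local Notation fc := (fcst E).

Lemma fcst_eq0 c : (fc c == 0) = (c == 0).
Proof. by rewrite -(inj_eq (@fcst_inj _ E)) fcst0. Qed.

Lemma fcstV c : fc c^-1 = (fc c)^-1.
Proof. exact: (fmorphV (fcst E)). Qed.

Lemma gen_two_neq0 : (2%:R : L) != 0.
Proof. by rewrite -(fcst_nat E 2) fcst_eq0. Qed.

Lemma disc_gen : disc E' = fc (disc E).
Proof.
rewrite /disc /=; move: E => [a1 a2 a3 a4 a6] /=.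
by rewrite !(fcstD, fcstN, fcstM, fcstXn, fcst_nat).
Qed.

Lemma gen_disc_neq0 : disc E' != 0.
Proof. by rewrite disc_gen fcst_eq0. Qed.

Lemma c1_gen : c1 E' = fc (c1 E).
Proof. by rewrite /c1 fcstM fcstV fcst_nat. Qed.
Lemma c3_gen : c3 E' = fc (c3 E).
Proof. by rewrite /c3 fcstM fcstV fcst_nat. Qed.
Lemma A2_gen : A2 E' = fc (A2 E).
Proof. by rewrite /A2 c1_gen fcstD fcstXn. Qed.
Lemma A4_gen : A4 E' = fc (A4 E).
Proof. by rewrite /A4 c1_gen c3_gen !mulr2n !fcstD fcstM. Qed.
Lemma A6_gen : A6 E' = fc (A6 E).
Proof. by rewrite /A6 c3_gen fcstD fcstXn. Qed.

Local Notation G := (ecpt two_neq0 disc_neq0).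
Local Notation G' := (ecpt gen_two_neq0 gen_disc_neq0).
Implicit Types A B C : G.

Lemma genpt_on : on_curve E' (genpt E).
Proof. by apply/eqP; exact: fy_eq. Qed.

Definition gen : G' := exist _ (genpt E) genpt_on.

Lemma map_on P : on_curve E P -> on_curve E' (map_point fc P).
Proof.
case: P => [[x y]|] //= /eqP h; apply/eqP.
have := congr1 fc h; rewrite !(fcstD, fcstM, fcstXn).
by [].
Qed.

Definition emb (A : G) : G' := exist _ (map_point fc (pt A)) (map_on (pt_on A)).

Lemma map_slope x1 y1 x2 y2 :
  slope E' (fc x1) (fc y1) (fc x2) (fc y2) = fc (slope E x1 y1 x2 y2).
Proof.
rewrite /slope (inj_eq (@fcst_inj _ E)) /=; case: ifP => _.
  by rewrite !(fcstM, fcstV, fcstD, fcstN, fcstXn, fcst_nat).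
by rewrite fcstM fcstV !fcstB.
Qed.

Lemma map_addpt P Q :
  map_point fc (addpt E P Q) = addpt E' (map_point fc P) (map_point fc Q).
Proof.
case: P => [[x1 y1]|] //; case: Q => [[x2 y2]|] //=.
have -> : - fc y2 - fc (wa1 E) * fc x2 - fc (wa3 E) = fc (- y2 - wa1 E * x2 - wa3 E).
  by rewrite !fcstB fcstN fcstM.
rewrite !(inj_eq (@fcst_inj _ E)); case: ifP => // _ /=.
rewrite map_slope; congr (Some (_, _)).
  by rewrite !(fcstN, fcstD, fcstXn, fcstM).
by rewrite !(fcstN, fcstD, fcstXn, fcstM).
Qed.

Lemma embD A B : emb (A + B) = emb A + emb B.
Proof. by apply: pt_inj; exact: map_addpt. Qed.

Lemma emb0 : emb 0 = 0. Proof. exact: pt_inj. Qed.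

Lemma embN A : emb (- A) = - emb A.
Proof. by apply/eqP; rewrite -addr_eq0 -embD addNr emb0. Qed.

Lemma xG_emb A : xG (emb A) = fc (xG A).
Proof. by rewrite /xG /=; case: (pt A) => [[]|] //=; rewrite fcst0. Qed.

Lemma etaG_emb A : etaG (emb A) = fc (etaG A).
Proof.
have ey : yco (pt (emb A)) = fc (yco (pt A)).
  by rewrite /=; case: (pt A) => [[]|] //=; rewrite fcst0.
by rewrite /etaG /eta -/(xG _) -/(xG _) xG_emb ey c1_gen c3_gen !(fcstD, fcstM).
Qed.

Lemma emb_eq0 A : (emb A == 0) = (A == 0).
Proof.
apply/eqP/eqP => [e|->]; last exact: emb0.
apply: pt_inj; have := congr1 (@pt _ _ _ _) e; rewrite /emb /=.
by case: (pt A).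
Qed.

Lemma gen_emb A : gen != emb A.
Proof.
apply/eqP => e; have := congr1 (@xG _ _ _ _) e; rewrite xG_emb.
rewrite /xG /= fcstE fxE => /pc_inj e'.
by have := congr1 (fun s : {poly K} => size s) e'; rewrite size_polyX size_polyC; case: (_ != 0).
Qed.

Lemma gen_sub A : gen - emb A != 0.
Proof. by rewrite subr_eq0 gen_emb. Qed.

(** An equality would make gen - A equal to C or -C, hence the generic point constant. *)
Lemma gen_sub_x A C : C != 0 -> xG (gen - emb A) - fc (xG C) != 0.
Proof.
move=> hC; rewrite -xG_emb subr_eq0; apply/eqP => /xG_inj.
rewrite gen_sub emb_eq0 hC => /(_ isT isT) [] /eqP; rewrite subr_eq => /eqP e.
  by have := gen_emb (C + A); rewrite embD e eqxx.
by have := gen_emb (- C + A); rewrite embD embN e eqxx.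
Qed.

Lemma gen_sub_emb_neq0 A C : gen - emb A + emb C != 0.
Proof.
have -> : gen - emb A + emb C = gen - emb (A - C) by rewrite embD embN opprD opprK addrA.
exact: gen_sub.
Qed.

Lemma chord_spec A C : C != 0 ->
  let Q := gen - emb A in let s := sgG Q (emb C) in
  [/\ s * (xG Q - fc (xG C)) = etaG Q - fc (etaG C),
      etaG (Q + emb C) = - (etaG Q + s * (xG (Q + emb C) - xG Q))
    & s ^+ 2 = xG Q + fc (xG C) + xG (Q + emb C) + fc (A2 E)].
Proof.
move=> hC Q s; have hC' : emb C != 0 by rewrite emb_eq0.
have [h1 h2 h3] := sgG_spec (gen_sub A) hC' (gen_sub_emb_neq0 A C).
rewrite -xG_emb -etaG_emb; split=> //; last by rewrite -A2_gen.
exact: chord_aux h1.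
Qed.

(** For the generic point P, u_{A,B} is the slope in the coordinates (x, y) of the line through P -
    A and A - B; passing to eta adds [c1]. *)
Lemma ufunE A B : A != B -> ufun E (pt A) (pt B)
  = sgG (gen - emb A) (emb (A - B)) - fc (c1 E).
Proof.
move=> hAB; have hC : A - B != 0 by rewrite subr_eq0.
have [h _ _] := chord_spec A hC; have hx := gen_sub_x A hC.
apply: (mulIf hx); rewrite mulrBl h.
rewrite [ufun _ _ _](_ : _ = (yco (pt (gen - emb A)) - fc (yco (pt (A - B))))
  / (xG (gen - emb A) - fc (xG (A - B)))) //.
rewrite divfK // /etaG /eta c1_gen c3_gen !(fcstD, fcstM) -!/(xG _).
exact: eta_sub_aux.
Qed.

(** The line through P - A and A - B also passes through -(P - B), so the line attached to (B, A) is
    its reflection. A pole at B can thus be studied as a pole at A. *)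
Lemma ufun_swap A B : A != B -> sgG (gen - emb B) (emb (B - A))
   = - sgG (gen - emb A) (emb (A - B)).
Proof.
move=> hAB; have lev := curve_level gen_two_neq0 gen_disc_neq0.
have -> : gen - emb B = emb (A - B) + (gen - emb A).
  by rewrite embD embN [RHS]addrC [RHS]addrA subrK.
have -> : emb (B - A) = - emb (A - B) by rewrite -embN opprB.
by rewrite (lev_sc lev) (lev_sC lev).
Qed.

End BaseChange.

(** * Poles *)

Lemma subs_aux (R : comPzRingType) (a b c d : R) :
  c = a + b + c + d + - a + - b + - d.
Proof. ring. Qed.

Lemma subs_aux2 (R : comPzRingType) (a b c d : R) :
  c - b = a + b + c + d - a - b *+ 2 - d.
Proof. ring. Qed.

(** For x and h with poles of orders 2 and 3, and g the abscissa of (x, h) + (x0, h0) minus x0: the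
    leading terms cancel, and the factor of W^2 has order at least -3 against 4, so g vanishes at
    the pole. [chord_eta_aux] does the same for the ordinate, with -5 against 6. *)
Lemma chord_x_aux (R : comPzRingType) (x h W x0 h0 a2 a4 a6 g : R) :
  (x - x0) * W = 1 -> h ^+ 2 = x ^+ 3 + a2 * x ^+ 2 + a4 * x + a6 ->
  g = ((h - h0) * W) ^+ 2 - x - x0 *+ 2 - a2 ->
  g = ((a4 + 3%:R * x0 ^+ 2 + 2%:R * (a2 * x0)) * x + - (2%:R * h0) * h
    + (a6 + h0 ^+ 2 - 2%:R * x0 ^+ 3 - a2 * x0 ^+ 2)) * W ^+ 2.
Proof.
move=> e eh ->.
transitivity ((h ^+ 2 - h0 * h *+ 2 + h0 ^+ 2) * W ^+ 2
  - (x + x0 *+ 2 + a2) * ((x - x0) * W) ^+ 2); first by rewrite e; ring.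
by rewrite eh; ring.
Qed.

Lemma chord_eta_aux (R : comPzRingType) (x h W x0 h0 a2 a4 a6 cc cd g s e : R) :
  (x - x0) * W = 1 -> h ^+ 2 = x ^+ 3 + a2 * x ^+ 2 + a4 * x + a6 ->
  s = (h - h0) * W -> g - x0 = (cc * x + - (2%:R * h0) * h + cd) * W ^+ 2 ->
  e = - (h + s * (g - x)) ->
  e - h0 = - ((- (2%:R * h0) * (3%:R * x0 + a2) * x ^+ 2
    + (2%:R * h0 * (3%:R * x0 ^+ 2 - a4) - h0 * cc) * x
    + (- (2%:R * h0) * (x0 ^+ 3 + a6) - h0 * cd)
    + cc * (x * h) + (cd + 2%:R * h0 ^+ 2) * h) * W ^+ 3).
Proof.
move=> eW eh es eg ->.
have -> : g - x = (g - x0) - (x - x0) by ring.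
rewrite eg es.
transitivity (- (h + ((h - h0) * ((cc * x + - (2%:R * h0) * h + cd) * W ^+ 3))
  - (h - h0) * ((x - x0) * W)) - h0); first by ring.
transitivity (- (h * ((x - x0) * W) ^+ 3 + ((h - h0) * ((cc * x + cd) * W ^+ 3))
  - 2%:R * h0 * h ^+ 2 * W ^+ 3 + 2%:R * h0 ^+ 2 * h * W ^+ 3
  - (h - h0) * ((x - x0) * W) ^+ 3) - h0 * ((x - x0) * W) ^+ 3).
  by rewrite !eW !expr1n; ring.
by rewrite eh; ring.
Qed.

Section Valuation.
Variables (K : fieldType) (E : weierstrass K) (v : place E).
Local Notation L := (funfield E).
Local Notation fc := (fcst E).

(** A lower bound on the order in which 0 counts as having infinite order, since [ord] is junk
    there. *)
Definition Oge (n : int) (f : L) := (f == 0) || (n <= ord v f).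

Lemma ord1 : ord v 1 = 0.
Proof. by rewrite -(fcst1 E) ord_cst // oner_neq0. Qed.

Lemma ordN f : f != 0 -> ord v (- f) = ord v f.
Proof.
move=> hf; have n1 : fc (-1) != 0.
  by rewrite -(fcst0 E) (inj_eq (@fcst_inj _ E)) oppr_eq0 oner_neq0.
rewrite -mulN1r -(fcst1 E) -fcstN ordM // ord_cst ?add0r //.
by rewrite oppr_eq0 oner_neq0.
Qed.

Lemma ordV f : f != 0 -> ord v f^-1 = - ord v f.
Proof.
move=> hf; apply/eqP; rewrite -addr_eq0 -ordM ?invr_eq0 // mulVf //.
by rewrite ord1.
Qed.

Lemma ordXn f n : f != 0 -> ord v (f ^+ n) = ord v f *+ n.
Proof.
move=> hf; elim: n => [|n IH]; first by rewrite expr0 mulr0n ord1.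
by rewrite exprS mulrS ordM ?expf_neq0 // IH.
Qed.

Lemma ord_lt f g : f != 0 -> g != 0 -> ord v f < ord v g ->
  f + g != 0 /\ ord v (f + g) = ord v f.
Proof.
move=> hf hg lt; have hfg : f + g != 0.
  apply/eqP => /eqP; rewrite addr_eq0 => /eqP e.
  by move: lt; rewrite e ordN // ltxx.
split=> //; apply/eqP; rewrite eq_le; apply/andP; split; last first.
  by apply: le_trans (ordD v hf hg hfg); rewrite le_min lexx ltW.
have hng : - g != 0 by rewrite oppr_eq0.
have := ordD v hfg hng; rewrite addrK ordN // => /(_ hf).
by rewrite ge_min => /orP[//|]; rewrite leNgt lt.
Qed.

Lemma Oge_cst c : Oge 0 (fc c).
Proof.
rewrite /Oge; case: (eqVneq c 0) => [->|hc]; first by rewrite fcst0 eqxx.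
by rewrite ord_cst // lexx orbT.
Qed.

Lemma Oge_le n m f : n <= m -> Oge m f -> Oge n f.
Proof. by move=> h /orP[/eqP->|hf]; rewrite /Oge ?eqxx // (le_trans h hf) orbT. Qed.

Lemma OgeD n f g : Oge n f -> Oge n g -> Oge n (f + g).
Proof.
rewrite /Oge; case: (eqVneq f 0) => [->|hf]; first by rewrite add0r.
case: (eqVneq g 0) => [->|hg]; first by rewrite addr0 (negPf hf).
case: (eqVneq (f + g) 0) => //= hfg h1 h2.
by apply: le_trans (ordD v hf hg hfg); rewrite le_min h1 h2.
Qed.

Lemma OgeM n m f g : Oge n f -> Oge m g -> Oge (n + m) (f * g).
Proof.
rewrite /Oge mulf_eq0; case: (eqVneq f 0) => //= hf; case: (eqVneq g 0) => //= hg.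
by move=> h1 h2; rewrite ordM // lerD.
Qed.

Lemma OgeZ n c f : Oge n f -> Oge n (fc c * f).
Proof. by move=> h; rewrite -[n]add0r; apply: OgeM h; apply: Oge_cst. Qed.

Lemma OgeN n f : Oge n f -> Oge n (- f).
Proof.
by rewrite /Oge oppr_eq0; case: (eqVneq f 0) => //= hf; rewrite ordN.
Qed.

Lemma OgeB n f g : Oge n f -> Oge n g -> Oge n (f - g).
Proof. by move=> hf hg; apply/OgeD/OgeN. Qed.

Lemma Oge_sum n (I : Type) (r : seq I) (P : pred I) (F : I -> L) :
  (forall i, P i -> Oge n (F i)) -> Oge n (\sum_(i <- r | P i) F i).
Proof.
by move=> h; elim/big_rec: _ => [|i x Pi hx]; [rewrite /Oge eqxx|apply: OgeD; first exact: h].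
Qed.

Lemma Oge_ord f : f != 0 -> Oge (ord v f) f.
Proof. by rewrite /Oge lexx orbT. Qed.

Lemma OgeX n f k : Oge n f -> Oge (n *+ k) (f ^+ k).
Proof.
move=> h; elim: k => [|k IH]; first by rewrite mulr0n expr0 -(fcst1 E) Oge_cst.
by rewrite exprS mulrS OgeM.
Qed.

Definition isC f := exists c, f = fc c.

Lemma isC_nat n : isC n%:R. Proof. by exists n%:R; rewrite fcst_nat. Qed.
Lemma isCD f g : isC f -> isC g -> isC (f + g).
Proof. by move=> [c ->] [c' ->]; exists (c + c'); rewrite fcstD. Qed.
Lemma isCM f g : isC f -> isC g -> isC (f * g).
Proof. by move=> [c ->] [c' ->]; exists (c * c'); rewrite fcstM. Qed.
Lemma isCN f : isC f -> isC (- f).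
Proof. by move=> [c ->]; exists (- c); rewrite fcstN. Qed.
Lemma isCXn f n : isC f -> isC (f ^+ n).
Proof. by move=> [c ->]; exists (c ^+ n); rewrite fcstXn. Qed.

Lemma isC_Oge n c f : isC c -> Oge n f -> Oge n (c * f).
Proof. by move=> [x ->]; exact: OgeZ. Qed.

Lemma Oge_isC n c : n <= 0 -> isC c -> Oge n c.
Proof. by move=> h [x ->]; apply: Oge_le h (Oge_cst x). Qed.

Lemma vanishesE f : vanishes v f = Oge 1 f.
Proof. by []. Qed.

End Valuation.

Section PolarBehaviour.
Variables (K : fieldType) (E : weierstrass K) (v : place E).
Hypothesis two_neq0 : (2%:R : K) != 0.
Hypothesis disc_neq0 : disc E != 0.
Local Notation L := (funfield E).
Local Notation fc := (fcst E).
Local Notation G := (ecpt two_neq0 disc_neq0).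
Implicit Types A B C : G.

Section Pole.
Variable A : G.
Local Notation Q := (gen two_neq0 disc_neq0 - emb A).
Local Notation X := (xG Q).
Local Notation H := (etaG Q).

Lemma curve_gen : H ^+ 2 = X ^+ 3 + fc (A2 E) * X ^+ 2 + fc (A4 E) * X + fc (A6 E).
Proof.
rewrite (etaG_sqr (gen_sub A)) horner_cubic A2_gen A4_gen A6_gen //.
Qed.

Hypothesis pole : ~~ Oge v 0 X.

Lemma X_neq0 : X != 0.
Proof. by apply: contra pole => /eqP->; rewrite /Oge eqxx. Qed.

Lemma ordX_lt0 : ord v X < 0.
Proof. by move: pole; rewrite /Oge (negPf X_neq0) /= ltNge. Qed.

(** The order of X / H, the local parameter at O pulled back by the translation. All orders turn out
    to be multiples of k, so surjectivity of the valuation gives k = 1. *)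
Let k : int := ord v X - ord v H.

Lemma ord_pole : [/\ H != 0, ord v X = - (k *+ 2), ord v H = - (k *+ 3) & 0 < k].
Proof.
have X0 := X_neq0; have lt0 := ordX_lt0; have X3 : X ^+ 3 != 0 by rewrite expf_neq0.
have e3 := ordXn v 3 X0.
have h2 : Oge v (ord v X *+ 2) (fc (A2 E) * X ^+ 2 + fc (A4 E) * X + fc (A6 E)).
  apply: OgeD; first apply: OgeD.
  - by apply/OgeZ/OgeX/Oge_ord.
  - by apply/OgeZ; apply: (@Oge_le _ _ _ _ (ord v X)) (Oge_ord v X0); lia.
  - by apply: (@Oge_le _ _ _ _ 0) (Oge_cst v _); lia.
have [H2 oH2] : H ^+ 2 != 0 /\ ord v (H ^+ 2) = ord v X *+ 3.
  rewrite curve_gen -!addrA addrA addrA.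
  rewrite -!addrA in h2 *.
  case: (eqVneq (fc (A2 E) * X ^+ 2 + (fc (A4 E) * X + fc (A6 E))) 0) h2 => [->|n0].
    by rewrite addr0.
  rewrite /Oge (negPf n0) /= => h2; rewrite -e3; apply: ord_lt => //.
  by rewrite e3; lia.
have H0 : H != 0 by apply: contraNneq H2 => ->; rewrite expr0n.
by split=> //; move: oH2 lt0; rewrite ordXn // /k; move: (ord v X) (ord v H); clear; lia.
Qed.

Section WithEvaluation.
Variable io : {rmorphism {poly K} -> L}.
Hypotheses (io_C : forall c, io c%:P = fc c) (io_X : io 'X = X).

Lemma io_cubic : H ^+ 2 = io (wcubic (A2 E) (A4 E) (A6 E)).
Proof.
rewrite curve_gen /wcubic !(rmorphD io) !(rmorphXn io) !(rmorphM io).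
by rewrite !io_C io_X.
Qed.

Lemma ord_io p : p != 0 ->
  io p != 0 /\ ord v (io p) = k * - (2 * (size p).-1)%N%:Z.
Proof.
have [_ oX _ k0] := ord_pole; have X0 := X_neq0.
elim/poly_ind: p => [|p c IH]; first by rewrite eqxx.
have -> : io (p * 'X + c%:P) = io p * X + fc c.
  by rewrite (rmorphD io) (rmorphM io) io_C io_X.
case: (eqVneq p 0) => [->|p0] hpc.
  rewrite mul0r add0r (rmorph0 io) mul0r add0r in hpc *.
  have c0 : c != 0 by rewrite -polyC_eq0.
  by rewrite fcst_eq0 c0 ord_cst // size_polyC c0 oppr0 mulr0.
have [hp op] := IH p0.
have hpX : io p * X != 0 by rewrite mulf_neq0.
have sz : size (p * 'X + c%:P) = (size p).+1.
  by rewrite size_MXaddC (negPf p0).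
have oo : ord v (io p * X) = k * - (2 * (size (p * 'X + c%:P)%R).-1)%N%:Z.
  by rewrite ordM // op oX sz /= {2}(polySpred p0) mulnS PoszD; ring.
case: (eqVneq c 0) => [->|c0].
  by rewrite fcst0 addr0 oo polyC0 addr0 size_mulX ?p0 // sz.
have hc : fc c != 0 by rewrite fcst_eq0.
have lt : ord v (io p * X) < ord v (fc c).
  by rewrite ord_cst // oo sz (polySpred p0) mulrN oppr_lt0 mulr_gt0.
by have [h1 h2] := ord_lt hpX hc lt; rewrite h1 h2 oo.
Qed.

(** The orders of [io q * H] and [io p] are odd and even multiples of k, so the two terms cannot
    cancel. *)
Lemma KE_ord f : KE io H f -> f != 0 -> exists z, ord v f = k * z.
Proof.
have [H0 _ oH k0] := ord_pole.
move=> [p [q ->]].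
case: (eqVneq q 0) => [->|q0].
  rewrite (rmorph0 io) mul0r addr0 => hp.
  have p0 : p != 0 by apply: contraNneq hp => ->; rewrite rmorph0.
  by have [_ ->] := ord_io p0; eexists.
have [hq oq] := ord_io q0.
have hqH : io q * H != 0 by rewrite mulf_neq0.
have oqH : ord v (io q * H) = k * (- (2 * (size q).-1)%N%:Z - 3%:R).
  by rewrite ordM // oq oH; ring.
case: (eqVneq p 0) => [->|p0].
  by rewrite (rmorph0 io) add0r => _; eexists; exact: oqH.
have [hp op] := ord_io p0.
move=> _; have : ord v (io p) != ord v (io q * H).
  rewrite op oqH; apply/eqP => /(mulfI (lt0r_neq0 k0)); clear; lia.
case: (ltgtP (ord v (io p)) (ord v (io q * H))) => // h _.
  by have [_ ->] := ord_lt hp hqH h; eexists; exact: op.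
by rewrite addrC; have [_ ->] := ord_lt hqH hp h; eexists; exact: oqH.
Qed.

Definition Rat f := exists N D, [/\ KE io H N, KE io H D, D != 0 & f = N / D].

Lemma RatD f g : Rat f -> Rat g -> Rat (f + g).
Proof.
move=> [N [D [hN hD D0 ->]]] [N' [D' [hN' hD' D0' ->]]].
exists (N * D' + N' * D), (D * D'); split; rewrite ?mulf_neq0 //.
- by apply: KED; apply: (KEM io_cubic).
- exact: (KEM io_cubic).
- by rewrite addf_div.
Qed.

Lemma RatM f g : Rat f -> Rat g -> Rat (f * g).
Proof.
move=> [N [D [hN hD D0 ->]]] [N' [D' [hN' hD' D0' ->]]].
exists (N * N'), (D * D'); split; rewrite ?mulf_neq0 ?mulf_div //; exact: (KEM io_cubic).
Qed.

Lemma RatN f : Rat f -> Rat (- f).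
Proof. by move=> [N [D [hN hD D0 ->]]]; exists (- N), D; rewrite mulNr; split=> //; apply: KEN. Qed.

Lemma Rat_KE f : KE io H f -> Rat f.
Proof.
move=> h; exists f, 1; rewrite divr1 oner_neq0; split=> //.
by rewrite -(rmorph1 io); apply: KE_io.
Qed.

Lemma Rat_cst c : Rat (fc c).
Proof. by rewrite -io_C; apply/Rat_KE/KE_io. Qed.

Lemma RatV f : Rat f -> Rat f^-1.
Proof.
move=> [N [D [hN hD D0 ->]]]; case: (eqVneq N 0) => [->|N0].
  by rewrite mul0r invr0 -(fcst0 E); apply: Rat_cst.
by exists D, N; rewrite invf_div.
Qed.

Lemma RatX : Rat X. Proof. by rewrite -io_X; apply/Rat_KE/KE_io. Qed.
Lemma RatH : Rat H. Proof. by apply/Rat_KE/KE_Y. Qed.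

(* The generic point is the sum of [Q] and a constant point. *)
Lemma gen_chord : A != 0 -> exists s,
  [/\ s * (X - fc (xG A)) = H - fc (etaG A),
      etaG (gen two_neq0 disc_neq0) = - (H + s * (fx E - X))
    & s ^+ 2 = X + fc (xG A) + fx E + fc (A2 E)].
Proof.
move=> hA; have [h1 h2 h3] := chord_spec A hA.
have e : Q + emb A = gen two_neq0 disc_neq0 by rewrite subrK.
by rewrite e in h2 h3; eexists; split; [exact: h1|exact: h2|exact: h3].
Qed.

Lemma eta_gen : etaG (gen two_neq0 disc_neq0) = fy E + fc (c1 E) * fx E + fc (c3 E).
Proof. by rewrite /etaG /eta c1_gen c3_gen. Qed.

Lemma gen0 : A = 0 -> Q = gen two_neq0 disc_neq0.
Proof. by move=> ->; rewrite emb0 subr0. Qed.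

Lemma XB0 : X - fc (xG A) != 0.
Proof.
apply: contra pole; rewrite subr_eq0 => /eqP ->; exact: Oge_cst.
Qed.

(** The coordinates of gen = Q + A are rational in X and H by the addition law, and they generate
    the function field. *)
Lemma Rat_all f : Rat f.
Proof.
have [hx hy] : Rat (fx E) /\ Rat (fy E).
  suff [hx he] : Rat (fx E) /\ Rat (etaG (gen two_neq0 disc_neq0)).
    split=> //; have -> : fy E = etaG (gen two_neq0 disc_neq0) + - (fc (c1 E) * fx E) + - fc (c3 E).
      by rewrite eta_gen addrAC addrK addrK.
    by apply: RatD; first apply: RatD => //; apply: RatN; [apply: RatM|]=> //; apply: Rat_cst.
  case: (eqVneq A 0) => [A0|hA].
    split; first by have -> : fx E = X; [rewrite gen0|exact: RatX].
    by have <- : H = etaG (gen two_neq0 disc_neq0); [rewrite gen0|exact: RatH].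
  have [s [h1 h2 h3]] := gen_chord hA.
  have hs : Rat s.
    have -> : s = (H + - fc (etaG A)) * (X + - fc (xG A))^-1 by rewrite -h1 mulfK ?XB0.
    by apply: RatM; [apply: RatD; [exact: RatH|apply/RatN/Rat_cst]|
      apply/RatV/RatD; [exact: RatX|apply/RatN/Rat_cst]].
  have hx : Rat (fx E).
    have -> : fx E = s * s + - X + - fc (xG A) + - fc (A2 E).
      by rewrite -expr2 h3; exact: subs_aux.
    apply: RatD; last exact/RatN/Rat_cst.
    apply: RatD; last exact/RatN/Rat_cst.
    by apply: RatD; [exact: RatM|exact/RatN/RatX].
  split=> //; rewrite h2; apply/RatN/RatD; first exact: RatH.
  by apply: RatM => //; apply: RatD => //; apply/RatN/RatX.
have [p [q [r [r0 e]]]] := funfieldP f.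
have Rpc (s : {poly K}) : Rat (pc E s).
  elim/poly_ind: s => [|s c IH]; first by rewrite pc0 -(fcst0 E); apply: Rat_cst.
  by rewrite pcD pcM -fcstE -fxE; apply: RatD; [apply: RatM|exact: Rat_cst].
have -> : f = (pc E p + pc E q * fy E) * (pc E r)^-1 by rewrite -e mulfK ?pc_eq0.
by apply: RatM; [apply: RatD => //; apply: RatM|apply: RatV].
Qed.

Lemma k_eq1_aux : k = 1.
Proof.
have [_ _ _ k0] := ord_pole.
have [f f0 ef] := ord_onto v.
have [N [D [hN hD D0 e]]] := Rat_all f.
have N0 : N != 0 by apply: contraNneq f0 => N0; rewrite e N0 mul0r.
have [z ez] := KE_ord hN N0; have [z' ez'] := KE_ord hD D0.
move: ef; rewrite e ordM ?invr_eq0 // ordV // ez ez' -mulrBr.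
move: k (z - z') k0; clear => k w k0 h; case: (lerP w 0) => hw.
  by have := mulr_ge0_le0 (ltW k0) hw; rewrite h.
by apply/eqP; rewrite eq_le -(gtz0_ge1 k) k0 andbT -h ler_peMr ?(ltW k0).
Qed.

End WithEvaluation.

Lemma k_eq1 : k = 1.
Proof.
pose io : {rmorphism {poly K} -> L} :=
  GRing.RMorphism.clone _ _ (horner_eval X \o map_poly (fcst E)) _.
apply: (@k_eq1_aux io) => [c|].
  by rewrite /io /= map_polyC /= /horner_eval hornerC.
by rewrite /io /= map_polyX /horner_eval hornerX.
Qed.

Lemma ord_XH : ord v X = - 2%:R /\ ord v H = - 3%:R.
Proof. by have [_ -> -> _] := ord_pole; rewrite k_eq1. Qed.

Lemma OgeX2 : Oge v (- 2%:R) X.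
Proof. by rewrite -(proj1 ord_XH) Oge_ord // X_neq0. Qed.

Lemma OgeH3 : Oge v (- 3%:R) H.
Proof. by have [H0 _ _ _] := ord_pole; rewrite -(proj2 ord_XH) Oge_ord. Qed.

Lemma Oge_const n c : n <= 0 -> Oge v n (fc c).
Proof. by move=> h; apply: Oge_le h (Oge_cst v c). Qed.

Lemma XBV_Oge c : Oge v 2%:R (X - fc c)^-1.
Proof.
have [oX _] := ord_XH; have X0 := X_neq0.
have [h1 h2] : X - fc c != 0 /\ ord v (X - fc c) = - 2%:R.
  case: (eqVneq c 0) => [->|c0]; first by rewrite fcst0 subr0.
  rewrite -oX -fcstN; apply: ord_lt => //; first by rewrite fcst_eq0 oppr_eq0.
  by rewrite ord_cst ?oppr_eq0 // oX.
by rewrite /Oge invr_eq0 (negPf h1) ordV // h2.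
Qed.

Lemma chord_Oge C : C != 0 -> Oge v (- 1%:R) (sgG Q (emb C)).
Proof.
move=> hC; have [h _ _] := chord_spec A hC.
rewrite -[sgG _ _](mulfK (gen_sub_x A hC)) h.
rewrite (_ : - 1%:R = - 3%:R + 2%:R) //; apply: OgeM; last exact: XBV_Oge.
by apply: OgeB; [exact: OgeH3|apply: Oge_const].
Qed.

(** A pole of the abscissa of gen - A means that gen specialises to A at v. For A = O the orders -2
    and -3 of x and y suffice in the chart at infinity; otherwise gen = Q + A is expanded at the
    pole of Q. *)
Lemma centered_pole : centered v (pt A).
Proof.
have [H0 _ _ _] := ord_pole; have [oX oH] := ord_XH; have X0 := X_neq0.
case: (eqVneq A 0) => [A0|hA].
  rewrite A0 /centered /= !vanishesE fcst0 !subr0.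
  have eQ := gen0 A0.
  have ex : fx E = X by rewrite eQ.
  have hr : Oge v (- 2%:R) (- (fc (c1 E) * X + fc (c3 E))).
    apply/OgeN/OgeD; last exact: Oge_const.
    exact/OgeZ/OgeX2.
  have ey : fy E = H + - (fc (c1 E) * X + fc (c3 E)).
    by rewrite -ex eQ eta_gen -[fy E + _ + _]addrA addrK.
  have [y0 oy] : fy E != 0 /\ ord v (fy E) = - 3%:R.
    rewrite ey; case: (eqVneq (- (fc (c1 E) * X + fc (c3 E))) 0) => [->|n0].
      by rewrite addr0.
    rewrite -oH; apply: ord_lt => //.
    by move: hr; rewrite /Oge (negPf n0) oH /=; apply: lt_le_trans.
  have hyV : Oge v 3%:R (fy E)^-1.
    by rewrite /Oge invr_eq0 (negPf y0) ordV // oy.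
  apply/andP; split; last exact: Oge_le hyV.
  rewrite ex (_ : 1 = - 2%:R + 3%:R) //; apply: OgeM => //; exact: OgeX2.
have [s [h1 h2 h3]] := gen_chord hA.
have hx0 := XB0.
pose xA := fc (xG A); pose hA' := fc (etaG A).
have eA : hA' ^+ 2 = xA ^+ 3 + fc (A2 E) * xA ^+ 2 + fc (A4 E) * xA + fc (A6 E).
  by rewrite /hA' /xA -!fcstXn etaG_sqr // horner_cubic !(fcstD, fcstXn, fcstM).
have eX := curve_gen.
have es : s = (H - hA') * (X - xA)^-1 by rewrite -h1 mulfK.
have hVx := XBV_Oge (xG A); rewrite -/xA in hVx.
have Vx := mulfV hx0; rewrite -/xA in Vx.
pose W := (X - xA)^-1; rewrite -/W in es hVx Vx.
have HX := OgeX2; have HH := OgeH3.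
have CA : isC hA' by exists (etaG A).
have Cx : isC xA by exists (xG A).
have C2 : isC (fc (A2 E)) by exists (A2 E).
have C4 : isC (fc (A4 E)) by exists (A4 E).
have C6 : isC (fc (A6 E)) by exists (A6 E).
have efx := chord_x_aux Vx eX (g := fx E - xA) (h0 := hA').
have {}efx := efx (etrans (subs_aux2 X xA (fx E) (fc (A2 E))) _).
move: efx; set cc := _ + 2%:R * (_ * xA); set cd := _ - _ * xA ^+ 2 => efx.
have K2 : isC (2%:R : L) by exact: isC_nat.
have K3 : isC (3%:R : L) by exact: isC_nat.
have Ccc : isC cc.
  apply: isCD; first by apply: isCD; [exact: C4|apply: isCM; [exact: K3|exact: isCXn Cx]].
  by apply: isCM; [exact: K2|apply: isCM; [exact: C2|exact: Cx]].
have Ccd : isC cd.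
  apply: isCD; last by apply/isCN/isCM; [exact: C2|exact: isCXn Cx].
  apply: isCD; last by apply/isCN/isCM; [exact: K2|exact: isCXn Cx].
  by apply: isCD; [exact: C6|exact: isCXn CA].
have {}efx : fx E - xA = (cc * X + - (2%:R * hA') * H + cd) * W ^+ 2.
  by apply: efx; rewrite -es h3.
have C2h : isC (2%:R * hA') by apply: isCM; [exact: K2|exact: CA].
have hW n : Oge v (2%:R *+ n) (W ^+ n) by apply: OgeX.
have eeta := chord_eta_aux Vx eX es efx h2.
have Mx : vanishes v (fx E - xA).
  rewrite vanishesE efx (_ : 1 = - 3%:R + 2%:R *+ 2) //; apply: OgeM (hW 2%N).
  apply: OgeD; first apply: OgeD.
  - by apply: isC_Oge; [exact: Ccc|exact: Oge_le HX].
  - by apply: isC_Oge; [exact: isCN C2h|exact: HH].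
  - exact: Oge_isC Ccd.
have Me : vanishes v (etaG (gen two_neq0 disc_neq0) - hA').
  rewrite vanishesE eeta; apply: OgeN.
  rewrite (_ : 1 = - 5%:R + 2%:R *+ 3) //; apply: OgeM (hW 3%N).
  apply: OgeD; first apply: OgeD; first apply: OgeD; first apply: OgeD.
  - apply: isC_Oge; first apply: isCM; first exact: isCN C2h.
      by apply: isCD; [apply: isCM; [exact: K3|exact: Cx]|exact: C2].
    by apply: (@Oge_le _ _ _ _ (- 2%:R *+ 2)); last exact: OgeX HX.
  - apply: isC_Oge; last by apply: Oge_le HX.
    apply: isCD; last by apply/isCN/isCM; [exact: CA|exact: Ccc].
    apply: isCM; first exact: C2h.
    by apply: isCD; [apply: isCM; [exact: K3|exact: isCXn Cx]|exact: isCN C4].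
  - apply: Oge_isC; first by [].
    apply: isCD; last by apply/isCN/isCM; [exact: CA|exact: Ccd].
    by apply: isCM; [exact: isCN C2h|apply: isCD; [exact: isCXn Cx|exact: C6]].
  - apply: isC_Oge; first exact: Ccc.
    by rewrite (_ : - 5%:R = - 2%:R - 3%:R); [exact: OgeM HX HH|].
  - apply: isC_Oge; last by apply: Oge_le HH.
    apply: isCD; first exact: Ccd.
    by apply: isCM; [exact: K2|exact: isCXn CA].
have ept : pt A = Some (xG A, yco (pt A)).
  rewrite /xG; case e: (pt A) => [[? ?]|] //.
  by case/eqP: hA; exact: pt_eq0.
rewrite /centered ept /= -/xA Mx /=.
have -> : fy E - fc (yco (pt A))
    = (etaG (gen two_neq0 disc_neq0) - hA') - fc (c1 E) * (fx E - xA).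
  rewrite eta_gen /hA' /xA /etaG /eta -/(xG A) !(fcstD, fcstM) -![fc (wa1 E) * _]fcstM -![fc (wa3 E) * _]fcstM.
  exact: eta_sub_aux.
by rewrite vanishesE; apply: OgeB => //; apply: OgeZ.
Qed.

End Pole.

(** m^2 is the sum of the abscissas of gen - A and gen - B and of constants, so m is regular unless
    one of them has a pole. At a pole of the first, m is a quotient of functions of orders -3 and
    -2; the second reduces to it by [ufun_swap]. *)
Lemma chord_polar A B : A != B ->
  let m := sgG (gen two_neq0 disc_neq0 - emb A) (emb (A - B)) in
  Oge v (- 1%:R) m /\ [\/ Oge v 0 m, centered v (pt A) | centered v (pt B)].
Proof.
move=> hAB m; have hC : A - B != 0 by rewrite subr_eq0.
case: (boolP (Oge v 0 (xG (gen two_neq0 disc_neq0 - emb A)))) => hA; last first.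
  by split; [exact: chord_Oge|constructor 2; exact: centered_pole].
case: (boolP (Oge v 0 (xG (gen two_neq0 disc_neq0 - emb B)))) => hB; last first.
  split; last by constructor 3; exact: centered_pole.
  rewrite -[m]opprK -ufun_swap //; apply/OgeN/chord_Oge => //.
  by rewrite subr_eq0 eq_sym.
have hm : Oge v 0 m; last by split; [exact: Oge_le hm|constructor 1].
have [_ _ h] := chord_spec A hC.
have e : gen two_neq0 disc_neq0 - emb A + emb (A - B) = gen two_neq0 disc_neq0 - emb B.
  by rewrite embD embN addrA subrK.
rewrite e -/m in h.
have h2 : Oge v 0 (m ^+ 2).
  rewrite h; apply: OgeD (Oge_cst v _); apply: OgeD hB.
  exact: OgeD hA (Oge_cst v _).
move: h2; rewrite /Oge; case: (eqVneq m 0) => //= m0.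
by rewrite expf_eq0 (negPf m0) /= ordXn // pmulrn_lge0.
Qed.

Lemma ufun_polar A B (D : seq (point K)) : A != B -> pt A \in D -> pt B \in D ->
  Oge v (- (count (centered v) D)%:Z) (ufun E (pt A) (pt B)).
Proof.
move=> hAB hA hB; rewrite ufunE //.
apply: OgeB; last by apply: Oge_const; rewrite oppr_le0.
have [h1 h2] := chord_polar hAB.
have hD P : P \in D -> centered v P -> Oge v (- (count (centered v) D)%:Z)
    (sgG (gen two_neq0 disc_neq0 - emb A) (emb (A - B))).
  move=> hP hc; apply: Oge_le h1; rewrite lerN2 lez_nat -has_count.
  by apply/hasP; exists P.
by case: h2 => [h|/(hD _ hA)|/(hD _ hB)] //; apply: Oge_le h; rewrite oppr_le0.
Qed.

End PolarBehaviour.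

Section RiemannRoch.
Variables (K : fieldType) (E : weierstrass K).

Lemma in_RRP (D : seq (point K)) (f : funfield E) :
  (forall v : place E, Oge v (- (count (centered v) D)%:Z) f) -> in_RR D f.
Proof.
move=> h f0 v; have := h v; rewrite /Oge (negPf f0) /=.
by rewrite -subr_ge0 opprK.
Qed.

End RiemannRoch.

(** * Values *)

(** It turns the slope into a fraction with denominator h + h0, which can be evaluated at a point
    where x - x0 vanishes. *)
Lemma tangent_aux (R : comPzRingType) (x h x0 h0 a2 a4 a6 : R) :
  h ^+ 2 = x ^+ 3 + a2 * x ^+ 2 + a4 * x + a6 ->
  h0 ^+ 2 = x0 ^+ 3 + a2 * x0 ^+ 2 + a4 * x0 + a6 ->
  (h - h0) * (h + h0)
  = (x * x + x * x0 + x0 * x0 + a2 * (x + x0) + a4) * (x - x0).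
Proof. by move=> e e0; rewrite -subr_sqr e e0; ring. Qed.

Lemma third_aux (R : comPzRingType) (a b c d : R) :
  c = a + b + c + d - a - b - d.
Proof. ring. Qed.

Section Values.
Variables (K : fieldType) (E : weierstrass K) (x0 y0 : K).
Local Notation L := (funfield E).
Local Notation fc := (fcst E).
Local Notation P0 := (Some (x0, y0)).
Hypothesis hP : on_curve E P0.

Let E1 (p : {poly {poly K}}) : L := eval_fun p (fx E, fy E).
Let E0 (p : {poly {poly K}}) : K := p.[x0, y0].

Lemma E1D p q : E1 (p + q) = E1 p + E1 q.
Proof. by rewrite /E1 /eval_fun /= rmorphD !hornerD. Qed.
Lemma E1M p q : E1 (p * q) = E1 p * E1 q.
Proof. by rewrite /E1 /eval_fun /= rmorphM !hornerM. Qed.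
Lemma E1N p : E1 (- p) = - E1 p.
Proof. by rewrite /E1 /eval_fun /= rmorphN !hornerN. Qed.
Lemma E1C c : E1 c%:P%:P = fc c.
Proof. by rewrite /E1 /eval_fun /= !map_polyC /= map_polyC !hornerC. Qed.
Lemma E1X : E1 'X = fx E.
Proof. by rewrite /E1 /eval_fun /= map_polyX hornerX hornerC. Qed.
Lemma E1Y : E1 'Y = fy E.
Proof. by rewrite /E1 /eval_fun /= map_polyC /= map_polyX hornerC hornerX. Qed.

Lemma E0D p q : E0 (p + q) = E0 p + E0 q. Proof. by rewrite /E0 !hornerD. Qed.
Lemma E0M p q : E0 (p * q) = E0 p * E0 q. Proof. by rewrite /E0 !hornerM. Qed.
Lemma E0N p : E0 (- p) = - E0 p. Proof. by rewrite /E0 !hornerN. Qed.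
Lemma E0C c : E0 c%:P%:P = c. Proof. by rewrite /E0 !hornerC. Qed.
Lemma E0X : E0 'X = x0. Proof. by rewrite /E0 hornerX hornerC. Qed.
Lemma E0Y : E0 'Y = y0. Proof. by rewrite /E0 hornerC hornerX. Qed.

(** Reduction to the form r + s y, valid at once at the generic point and at (x0, y0). With
    [pc_free] it shows that a polynomial which is zero as a function vanishes at (x0, y0), so that
    values are well defined. *)
Definition rep p := exists r s, E1 p = pc E r + pc E s * fy E /\ E0 p = r.[x0] + s.[x0] * y0.

Lemma fy_sqr : fy E ^+ 2 = pc E (wcub E) - pc E (wlin E) * fy E.
Proof.
rewrite /wcub /wlin !pcD !pcXn !pcM -!fcstE -fxE.
rewrite -[fx E * fx E]expr2 -[X in X - _]fy_eq mulrDl.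
by rewrite -[_ + _ + _]addrA addrK.
Qed.

Lemma y0_sqr : y0 ^+ 2 = (wcub E).[x0] - (wlin E).[x0] * y0.
Proof.
move: hP => /eqP; rewrite /wcub /wlin !hornerE /= => e.
have -> : y0 ^+ 2 = y0 ^+ 2 + wa1 E * x0 * y0 + wa3 E * y0 - wa1 E * x0 * y0 - wa3 E * y0.
  by ring.
by rewrite e; ring.
Qed.

Lemma repD p q : rep p -> rep q -> rep (p + q).
Proof.
move=> [r [s [e1 e2]]] [r' [s' [e1' e2']]]; exists (r + r'), (s + s').
rewrite E1D E0D e1 e2 e1' e2' !pcD !hornerD !mulrDl; split; exact: addrACA.
Qed.

Lemma rep_mul_aux (R : comPzRingType) (r s r' s' y c l : R) : y ^+ 2 = c - l * y ->
  (r + s * y) * (r' + s' * y) = r * r' + s * s' * c + (r * s' + s * r' - s * s' * l) * y.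
Proof.
move=> e; transitivity (r * r' + (r * s' + s * r') * y + s * s' * y ^+ 2); first by ring.
by rewrite e; ring.
Qed.

Lemma repM p q : rep p -> rep q -> rep (p * q).
Proof.
move=> [r [s [e1 e2]]] [r' [s' [e1' e2']]].
exists (r * r' + s * s' * wcub E), (r * s' + s * r' - s * s' * wlin E).
rewrite E1M E0M e1 e2 e1' e2'.
move: (wcub E) (wlin E) fy_sqr y0_sqr => c l f1 f2.
rewrite !(pcD, pcN, pcM) !(hornerD, hornerN, hornerM).
by split; [exact: (rep_mul_aux _ _ _ _ f1)|exact: (rep_mul_aux _ _ _ _ f2)].
Qed.

Lemma rep_C c : rep c%:P%:P.
Proof. by exists c%:P, 0; rewrite E1C E0C pc0 horner0 !mul0r !addr0 hornerC. Qed.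

Lemma rep_all p : rep p.
Proof.
elim/poly_ind: p => [|p c IH].
  by rewrite -[0]/((0 : {poly K})%:P) -(rmorph0 polyC); exact: rep_C.
apply: repD; first apply: repM => //.
  by exists 'X, 0; rewrite E1X E0X pc0 hornerX horner0 !mul0r !addr0.
elim/poly_ind: c => [|c a IHc]; first by rewrite -(rmorph0 polyC); exact: rep_C.
rewrite rmorphD rmorphM; apply: repD; last exact: rep_C.
apply: repM => //; exists 0, 1.
by rewrite E1Y E0Y pc0 pc1 horner0 hornerC !mul1r !add0r.
Qed.

Lemma E1_neq0 q : E0 q != 0 -> E1 q != 0.
Proof.
apply: contraNneq => e; have [r [s [e1 e2]]] := rep_all q.
rewrite e2; move: e1; rewrite e => /esym/pc_free[-> ->].
by rewrite !horner0 mul0r addr0.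
Qed.

Local Notation value f c := (@value_at K E f P0 c).

Lemma valueP f c : value f c <-> exists p q, [/\ E0 q != 0, f = E1 p / E1 q & c = E0 p / E0 q].
Proof. by []. Qed.

Lemma value_cst c : value (fc c) c.
Proof.
apply/valueP; exists c%:P%:P, 1%:P%:P; rewrite !E0C !E1C fcst1 !divr1.
by rewrite oner_neq0.
Qed.

Lemma value_fx : value (fx E) x0.
Proof.
apply/valueP; exists 'X, 1%:P%:P; rewrite E0C E1C E0X E1X fcst1 !divr1.
by rewrite oner_neq0.
Qed.

Lemma value_fy : value (fy E) y0.
Proof.
apply/valueP; exists 'Y, 1%:P%:P; rewrite E0C E1C E0Y E1Y fcst1 !divr1.
by rewrite oner_neq0.
Qed.

Lemma valueD f c g e : value f c -> value g e -> value (f + g) (c + e).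
Proof.
move=> /valueP[p [q [q0 -> ->]]] /valueP[p' [q' [q0' -> ->]]].
apply/valueP; exists (p * q' + p' * q), (q * q').
rewrite E0M mulf_neq0 // !E1M !E1D !E0D !E1M !E0M.
by rewrite !addf_div ?E1_neq0.
Qed.

Lemma valueM f c g e : value f c -> value g e -> value (f * g) (c * e).
Proof.
move=> /valueP[p [q [q0 -> ->]]] /valueP[p' [q' [q0' -> ->]]].
apply/valueP; exists (p * p'), (q * q').
by rewrite E0M mulf_neq0 // !E1M !E0M !mulf_div.
Qed.

Lemma valueN f c : value f c -> value (- f) (- c).
Proof.
move=> /valueP[p [q [q0 -> ->]]]; apply/valueP; exists (- p), q.
by rewrite E1N E0N !mulNr.
Qed.

Lemma valueB f c g e : value f c -> value g e -> value (f - g) (c - e).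
Proof. by move=> hf hg; apply/valueD/valueN. Qed.

Lemma valueV f c : c != 0 -> value f c -> value f^-1 c^-1.
Proof.
move=> c0 /valueP[p [q [q0 -> e]]]; apply/valueP; exists q, p.
rewrite e !invf_div; split=> //.
by apply: contraNneq c0 => e0; rewrite e e0 mul0r.
Qed.

Lemma value0 c : value 0 c -> c = 0.
Proof.
move=> /valueP[p [q [q0 e ->]]]; apply/eqP; rewrite mulf_eq0; apply/orP; left.
apply: contraTT isT => p0; move/eqP: e.
by rewrite eq_sym mulf_eq0 invr_eq0 (negPf (E1_neq0 p0)) (negPf (E1_neq0 q0)).
Qed.

Lemma value_sum (I : Type) (r : seq I) (Q : pred I) (F : I -> L) (G : I -> K) :
  (forall i, Q i -> value (F i) (G i)) ->
  value (\sum_(i <- r | Q i) F i) (\sum_(i <- r | Q i) G i).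
Proof.
move=> h; elim: r => [|i r IH]; first by rewrite !big_nil -(fcst0 E); exact: value_cst.
by rewrite !big_cons; case: ifP => // Qi; apply: valueD; first exact: h.
Qed.

End Values.

Section ChordValues.
Variables (K : fieldType) (E : weierstrass K).
Hypothesis two_neq0 : (2%:R : K) != 0.
Hypothesis disc_neq0 : disc E != 0.
Local Notation L := (funfield E).
Local Notation fc := (fcst E).
Local Notation G := (ecpt two_neq0 disc_neq0).
Local Notation gen := (gen two_neq0 disc_neq0).
Implicit Types A B C P R : G.

Lemma add_spec_tangent (P Q R : point K) s x y : add_spec E P Q R s -> P = Q -> R <> None ->
  P = Some (x, y) -> s * (eta E x y *+ 2) = (wcubic (A2 E) (A4 E) (A6 E))^`().[x].
Proof.
case=> [? <- //|? -> //|? ? _ _ [] //|x1 y1 x2 y2 x3 y3 m -> _ _ _ _ [<- _] _ [<- <-]].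
by rewrite !derivE !hornerE /= /eta; ring.
Qed.

Lemma sg_tangent C : C != 0 -> C + C != 0 ->
  sgG C C * (etaG C *+ 2) = 3%:R * xG C ^+ 2 + A2 E * xG C *+ 2 + A4 E.
Proof.
move=> hC hCC; rewrite -(horner_deriv_cubic _ _ (A6 E)).
apply: (add_spec_tangent (addP two_neq0 (pt_on C) (pt_on C))) => // [e|].
  by rewrite (pt_eq0 (e : pt (C + C) = None)) eqxx in hCC.
rewrite /xG; case e: (pt C) => [[]|] //.
by rewrite (pt_eq0 e) eqxx in hC.
Qed.

Lemma chord_value P A C R : P != 0 -> R != 0 -> C != 0 -> R + C != 0 ->
  value_at (xG (gen - emb A)) (pt P) (xG R) ->
  value_at (etaG (gen - emb A)) (pt P) (etaG R) ->
  [/\ value_at (sgG (gen - emb A) (emb C)) (pt P) (sgG R C),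
      value_at (xG (gen - emb A + emb C)) (pt P) (xG (R + C))
    & value_at (etaG (gen - emb A + emb C)) (pt P) (etaG (R + C))].
Proof.
move=> hP hR hC hRC; have := pt_on P.
case eP : (pt P) => [[x0 y0]|] hon; last by rewrite (pt_eq0 eP) eqxx in hP.
move=> vx vh; have [h1 h2 h3] := chord_spec A hC.
have [r1 r2 r3] := sgG_spec hR hC hRC.
have hX := gen_sub_x A hC.
  have vc c : value_at (fc c) (Some (x0, y0)) c by exact: value_cst.
have vs : value_at (sgG (gen - emb A) (emb C)) (Some (x0, y0)) (sgG R C).
  case: (eqVneq (xG R) (xG C)) => [e|ne]; last first.
    have ne' : xG R - xG C != 0 by rewrite subr_eq0.
    rewrite -[sgG _ (emb C)](mulfK hX) h1.
    have -> : sgG R C = (etaG R - etaG C) / (xG R - xG C).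
      apply: (mulIf ne'); rewrite divfK // r1; ring.
    by apply: valueM; [apply: (valueB hon)|apply: valueV => //; apply: (valueB hon)].
  (* Equal abscissas leave only R = C, as R + C is nonzero; the slope is then evaluated in its
     tangent form. *)
  have RC : R = C.
    case: (xG_inj hR hC e) => // e'; by move: hRC; rewrite e' addNr eqxx.
  have eC : etaG C *+ 2 != 0.
    rewrite -mulr_natl mulf_neq0 //; apply: contraNneq hRC => e0; rewrite RC.
    apply/eqP; rewrite -[X in X + _]opprK; apply/eqP; rewrite addrC subr_eq0; apply/eqP.
    by apply: coord_inj; rewrite ?oppr_eq0 ?xGN ?etaGN // e0 oppr0.
  rewrite RC in vx vh hRC *.
  have eX := etaG_sqr (gen_sub A).
  have hC' : emb C != 0 by rewrite emb_eq0.
  have eR := etaG_sqr hC'.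
  rewrite horner_cubic A2_gen A4_gen A6_gen in eX.
  rewrite horner_cubic A2_gen A4_gen A6_gen xG_emb etaG_emb in eR.
  have vd : value_at (etaG (gen - emb A) + fc (etaG C)) (Some (x0, y0)) (etaG C *+ 2).
    by rewrite mulr2n; apply: (valueD hon).
  have d0 : etaG (gen - emb A) + fc (etaG C) != 0.
    by apply: contraNneq eC => e0; rewrite e0 in vd; rewrite (value0 hon vd).
  rewrite -[sgG _ (emb C)](mulfK hX) h1.
  rewrite -[etaG _ - _](mulfK d0) (tangent_aux eX eR).
  rewrite mulrAC mulfK // .
  have -> : sgG C C = (3%:R * xG C ^+ 2 + A2 E * xG C *+ 2 + A4 E) / (etaG C *+ 2).
    by apply: (mulIf eC); rewrite divfK // sg_tangent.
  apply: valueM; last exact: valueV.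
  have -> : 3%:R * xG C ^+ 2 + A2 E * xG C *+ 2 + A4 E
    = xG C * xG C + xG C * xG C + xG C * xG C + A2 E * (xG C + xG C) + A4 E by ring.
  do ![apply: (valueD hon)|apply: valueM] => //.
have vx' : value_at (xG (gen - emb A + emb C)) (Some (x0, y0)) (xG (R + C)).
  have -> : xG (gen - emb A + emb C)
    = sgG (gen - emb A) (emb C) ^+ 2 - xG (gen - emb A) - fc (xG C) - fc (A2 E).
    by rewrite h3; exact: third_aux.
  have -> : xG (R + C) = sgG R C ^+ 2 - xG R - xG C - A2 E by rewrite r3; ring.
  apply: (valueB hon) => //; apply: (valueB hon) => //; apply: (valueB hon) => //.
  by rewrite !expr2; apply: valueM.
split=> //; rewrite h2 r2; apply: (valueN); apply: (valueD hon) => //.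
by apply: valueM => //; apply: (valueB hon).
Qed.

(** Adding -A to the generic point specialises it to P - A, and the chord through A - B is evaluated
    there; P <> A and P <> B keep both sums away from O. *)
Lemma ufun_value A B P : A != B -> P != 0 -> P != A -> P != B ->
  value_at (ufun E (pt A) (pt B)) (pt P) (sgG (P - A) (A - B) - c1 E).
Proof.
move=> hAB hP hPA hPB; rewrite ufunE //; have := pt_on P.
have hgen : value_at (xG gen) (pt P) (xG P) /\ value_at (etaG gen) (pt P) (etaG P).
  have := pt_on P; rewrite /xG /etaG; case eP : (pt P) => [[x0 y0]|] hon; last first.
    by rewrite (pt_eq0 eP) eqxx in hP.
  split; first exact: value_fx.
  rewrite /eta c1_gen c3_gen /=; apply: (valueD hon); last exact: value_cst.
  apply: (valueD hon); first exact: value_fy.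
  by apply: valueM; [exact: value_cst|exact: value_fx].
have hA : value_at (xG (gen - emb A)) (pt P) (xG (P - A)) /\
    value_at (etaG (gen - emb A)) (pt P) (etaG (P - A)).
  case: (eqVneq A 0) => [->|A0]; first by rewrite emb0 !subr0.
  have := @chord_value P 0 (- A) P; rewrite emb0 subr0 embN oppr_eq0 subr_eq0.
  by move=> /(_ hP hP A0 hPA hgen.1 hgen.2)[].
case eP : (pt P) => [[x0 y0]|] hon; last by rewrite (pt_eq0 eP) eqxx in hP.
rewrite -eP; rewrite -eP in hon.
have [||||||v _ _] := @chord_value P A (A - B) (P - A); rewrite ?subr_eq0 //.
- by rewrite addrA subrK subr_eq0.
- exact: hA.1.
- exact: hA.2.
rewrite eP in v *; rewrite eP in hon; apply: (valueB hon) => //; exact: value_cst.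
Qed.

End ChordValues.

(** * The interpolation program *)

Section ProgramOutput.
Variables (K : fieldType) (n m : nat).

Lemma slp_of_avail (c : seq (instr K n)) (g : 'I_m -> ('I_n -> K) -> K) :
  (forall j, avail c (g j)) ->
  exists P : slp K n m, slp_cost P = size c /\ forall alpha j, slp_run alpha P j = g j alpha.
Proof.
move=> h.
have [j|out hout] := fin_all_exists (P := fun j o =>
    forall alpha, read alpha (regs c alpha) o = g j alpha).
  by have [o _ ho] := h j; exists o.
by exists (Slp c out); split=> // alpha j; exact: hout.
Qed.

Definition inp k : ('I_n -> K) -> K :=
  fun alpha => if insub k is Some i then alpha i else 0.

Lemma inp_avail c k : avail c (inp k).
Proof.
by rewrite /inp; case: insub => [i|]; [exact: avail_inp|exact: avail_cst].
Qed.

Lemma inp_val alpha (i : 'I_n) : inp i alpha = alpha i.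
Proof. by rewrite /inp valK. Qed.

End ProgramOutput.

Section Final.
Variables (K : fieldType) (E : weierstrass K).
Hypothesis two_neq0 : (2%:R : K) != 0.
Hypothesis disc_neq0 : disc E != 0.
Local Notation G := (ecpt two_neq0 disc_neq0).
Local Notation fc := (fcst E).
Local Notation s := (@sgG _ _ two_neq0 disc_neq0).
Variables (b t : G) (delta : nat).
Hypothesis delta_gt0 : (0 < delta)%N.
Local Notation d := (2 ^ delta)%N.
Hypothesis hcyc : cyclic_data b t (@zeroG K E two_neq0 disc_neq0) d.
Local Notation node := (node b t).

Lemma d_split : d = (2 ^ delta.-1 + 2 ^ delta.-1)%N.
Proof. by rewrite addnn -mul2n -expnS prednK. Qed.

Lemma half_gt0 : (0 < 2 ^ delta.-1)%N. Proof. by rewrite expn_gt0. Qed.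

Lemma d_gt1 : (1 < d)%N.
Proof. by rewrite -{1}(expn0 2) ltn_exp2l. Qed.

Lemma d_gt0 : (0 < d)%N. Proof. exact: ltnW d_gt1. Qed.

Lemma hcyc' : cyclic_data b t (@zeroG K E two_neq0 disc_neq0)
  (2 ^ delta.-1 + 2 ^ delta.-1).
Proof. by rewrite -d_split. Qed.

Lemma tE k : (t *+ k == 0) = (d %| k)%N. Proof. exact: (proj1 hcyc). Qed.

Lemma tl0 l : l != 0%N -> (l < d)%N -> 0 != t *+ l.
Proof.
rewrite -lt0n eq_sym tE => l0 hl; apply/negP => /(dvdn_leq l0).
by rewrite leqNgt hl.
Qed.

Lemma td : t *+ d = 0. Proof. by apply/eqP; rewrite tE. Qed.

Lemma node_sub_neq0 k l : node k - t *+ l != 0.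
Proof. exact: (node_sub hcyc'). Qed.

Lemma node_neq k l : node k != t *+ l.
Proof. by rewrite -subr_eq0 node_sub_neq0. Qed.

Lemma node0 k : node k != 0.
Proof. by rewrite -(mulr0n t) node_neq. Qed.

Lemma nodes_unisolvent : unisolvent b t s d.
Proof. by rewrite d_split; apply: unisolvent_curve half_gt0 hcyc'. Qed.

Lemma solution : exists M : nat -> nat -> K, forall (beta : nat -> K) k, (k < d)%N ->
  interp t s d (\sum_(0 <= i < d) M 0%N i * beta i)
    (fun l => \sum_(0 <= i < d) M l i * beta i) (node k) = beta k.
Proof.
have [M hM] := interp_linear nodes_unisolvent d_gt0; exists M => beta k hk.
have [c0 [r hr]] := interp_solve nodes_unisolvent d_gt0 beta.
rewrite -[RHS](hr k hk) /interp -(hM _ _ _ hr 0%N d_gt0); congr (_ + _).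
apply: eq_big_nat => l /andP[l0 hl].
by rewrite -(hM _ _ _ hr l hl) /coefs eqn0Ngt l0.
Qed.

Lemma t_neq0 : t != 0.
Proof.
have := tE 1; rewrite mulr1n dvdn1 => ->.
by rewrite neq_ltn d_gt1 orbT.
Qed.

Lemma tS_neq l : t *+ l != t *+ l.+1.
Proof.
by rewrite eq_sym -subr_eq0 mulrS addrK t_neq0.
Qed.

Lemma t_in_cyc l : (l <= d)%N -> pt (t *+ l) \in cyc E (pt t) d.
Proof.
rewrite leq_eqVlt => /orP[/eqP->|hl]; rewrite ptMn; last first.
  by apply/mapP; exists l; rewrite // mem_iota.
apply/mapP; exists 0%N; first by rewrite mem_iota d_gt0.
by rewrite -ptMn td.
Qed.

Lemma value_comb P (w : 'I_d -> funfield E) (a c : 'I_d -> K) : P != 0 ->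
  (forall l, value_at (w l) (pt (P : G)) (c l)) ->
  value_at (\sum_(l < d) fc (a l) * w l) (pt P) (\sum_(l < d) a l * c l).
Proof.
move=> hP; have := pt_on P; case eP : (pt P) => [[x0 y0]|] hon; last first.
  by rewrite (pt_eq0 eP) eqxx in hP.
move=> h; apply: (value_sum hon) => l _; apply: valueM => //; exact: value_cst.
Qed.

Lemma RR_comb (w : 'I_d -> funfield E) (a : 'I_d -> K) :
  (forall (v : place E) l, Oge v (- (count (centered v) (cyc E (pt t) d))%:Z) (w l)) ->
  in_RR (cyc E (pt t) d) (\sum_(l < d) fc (a l) * w l).
Proof. by move=> h; apply: in_RRP => v; apply: Oge_sum => l _; apply: OgeZ. Qed.

Lemma v_polar (v : place E) l :
  Oge v (- (count (centered v) (cyc E (pt t) d))%:Z) (v_basis E (pt t) d l).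
Proof.
rewrite /v_basis; case: eqP => [_|/eqP l0].
  by rewrite -(fcst1 E) Oge_const // oppr_le0.
rewrite -ptMn -[None]/(pt (0 : G)); apply: ufun_polar.
- exact: tl0.
- by have := t_in_cyc (leq0n d); rewrite mulr0n.
- by apply: t_in_cyc; apply: ltnW.
Qed.

Lemma afun_polar (v : place E) :
  Oge v (- (count (centered v) (cyc E (pt t) d))%:Z) (afun E (pt t) d).
Proof.
apply: Oge_sum => l _; rewrite -!ptMn; apply: ufun_polar.
- exact: tS_neq.
- by apply: t_in_cyc; apply: ltnW.
- exact: t_in_cyc.
Qed.

Lemma u_polar (v : place E) l :
  Oge v (- (count (centered v) (cyc E (pt t) d))%:Z) (u_basis E (pt t) d l).
Proof.
apply: OgeD.
  rewrite -!ptMn; apply: ufun_polar; first exact: tS_neq.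
    by apply: t_in_cyc; apply: ltnW.
  exact: t_in_cyc.
rewrite mulrC -(fcst_nat E) -fcstV; apply: OgeZ; apply: OgeB; last exact: afun_polar.
by rewrite -(fcst1 E) Oge_const // oppr_le0.
Qed.

Definition v_val k l : K := if l == 0%N then 1 else s (node k) (- (t *+ l)) - c1 E.

Lemma v_value k (l : 'I_d) : value_at (v_basis E (pt t) d l) (pt (node k)) (v_val k l).
Proof.
rewrite /v_basis /v_val; case: eqP => [_|/eqP l0].
  have := pt_on (node k); case eP : (pt (node k)) => [[x0 y0]|] hon; last first.
    by have := node0 k; rewrite (pt_eq0 eP) eqxx.
  by rewrite -(fcst1 E); exact: value_cst.
rewrite -ptMn -[None]/(pt (0 : G)).
have := @ufun_value _ _ two_neq0 disc_neq0 0 (t *+ l) (node k).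
rewrite subr0 sub0r; apply; rewrite ?node_neq ?node0 //.
exact: tl0.
Qed.

(** The cocycle relation for P, -lt and -t writes u_{lt,(l+1)t} at P as s(P, -(l+1)t) - s(P, -lt)
    plus a term independent of P, which is [kap l]. The differences telescope, so [kap_sum] is the
    value of [afun] at the nodes. *)
Definition kap l : K := s (- (t *+ l)) (- t) - c1 E.
Definition kap_sum : K := \sum_(l < d) kap l.
Definition a_val k l : K :=
  s (node k) (- (t *+ l.+1)) - s (node k) (- (t *+ l)) + kap l.

Lemma sum_a k : \sum_(l < d) a_val k l = kap_sum.
Proof.
rewrite /a_val big_split /= -[RHS]add0r; congr (_ + _).
rewrite -(big_mkord xpredT (fun l => s (node k) (- (t *+ l.+1)) - s (node k) (- (t *+ l)))).
rewrite telescope_sumr ?leq0n //.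
by rewrite td mulr0n subrr.
Qed.

Lemma ut_value k l : (l < d)%N ->
  value_at (ufun E (mulpt E l (pt t)) (mulpt E l.+1 (pt t))) (pt (node k)) (a_val k l).
Proof.
move=> hl; rewrite -!ptMn.
have := ufun_value (tS_neq l) (node0 k) (node_neq k l) (node_neq k l.+1).
have -> : t *+ l - t *+ l.+1 = - t by rewrite mulrS opprD addrCA subrr addr0.
have -> : s (node k - t *+ l) (- t) - c1 E = a_val k l; last by [].
have := lev_sA (curve_level two_neq0 disc_neq0) (node k) (- (t *+ l)) (- t).
rewrite -opprD -mulrSr => e.
rewrite /a_val /kap; apply/eqP; rewrite -subr_eq0.
have -> : s (node k - t *+ l) (- t) = s (- (t *+ l)) (- t)
   + s (node k) (- (t *+ l.+1)) - s (node k) (- (t *+ l)) by rewrite -e [RHS]addrC addKr.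
by apply/eqP; ring.
Qed.

Definition u_val k l : K := a_val k l + (1 - kap_sum) / d%:R.

Hypothesis d_neq0 : (d%:R : K) != 0.

Lemma u_value k (l : 'I_d) : value_at (u_basis E (pt t) d l) (pt (node k)) (u_val k l).
Proof.
have ha : value_at (afun E (pt t) d) (pt (node k)) kap_sum.
  rewrite -(sum_a k) /afun; have := pt_on (node k).
  have hu := fun l : 'I_d => ut_value k (ltn_ord l).
  case eP : (pt (node k)) hu => [[x0 y0]|] hu hon; last first.
    by have := node0 k; rewrite (pt_eq0 eP) eqxx.
  by apply: (value_sum hon) => i _; exact: hu.
have := ut_value k (ltn_ord l); have := pt_on (node k).
case eP : (pt (node k)) ha => [[x0 y0]|] ha hon hl; last first.
  by have := node0 k; rewrite (pt_eq0 eP) eqxx.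
apply: (valueD hon hl); apply: valueM; last first.
  by rewrite -(fcst_nat E); apply: valueV => //; exact: value_cst.
by apply: (valueB hon) => //; rewrite -(fcst1 E); exact: value_cst.
Qed.

Definition solves (val : nat -> nat -> K) (P : slp K d d) := forall alpha (k : 'I_d),
  \sum_(l < d) slp_run alpha P l * val k l = alpha k.

Section Coordinates.
Variable M : nat -> nat -> K.
Hypothesis hM : forall (beta : nat -> K) k, (k < d)%N ->
  interp t s d (\sum_(0 <= i < d) M 0%N i * beta i)
    (fun l => \sum_(0 <= i < d) M l i * beta i) (node k) = beta k.

Definition res l : ('I_d -> K) -> K := fun alpha => \sum_(0 <= i < d) M l i * inp i alpha.

Lemma res_interp alpha k : (k < d)%N ->
  interp t s d (res 0 alpha) (fun l => res l alpha) (node k) = inp k alpha.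
Proof. exact: (hM (fun i => inp i alpha)). Qed.

Lemma res_code : exists2 c, extends (12 * delta * d) [::] c
  & forall l, (0 < l < d)%N -> avail c (res l).
Proof.
apply: (residues_program two_neq0 (curve_level two_neq0 disc_neq0) hcyc nodes_unisolvent (beta := inp (n := d)) (c0 := res 0)).
  by move=> k _; exact: inp_avail.
by move=> alpha k; exact: res_interp.
Qed.

Lemma sum_ord1 (F : nat -> K) : \sum_(l < d) F l = F 0%N + \sum_(1 <= l < d) F l.
Proof. by rewrite -(big_mkord xpredT) big_ltn ?d_gt0. Qed.

Lemma program_v : exists2 P, solves v_val P & (slp_cost P <= 17 * delta * d)%N.
Proof.
have [c1' e1 a1] := res_code.
(* Since v_l is s(P, -lt) - c1 for l nonzero, the coordinate on v_0 is the constant term plus c1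
   times the sum of the residues, again a linear form in the inputs. *)
pose m i := M 0%N i + c1 E * \sum_(1 <= l < d) M l i.
have [c2 e2 a2] := @avail_lin K d d c1' m (inp (n := d)) (fun k _ => inp_avail c1' k).
have [|P [hP rP]] := @slp_of_avail K d d c2
    (fun j => if (j : nat) == 0%N then fun alpha => \sum_(0 <= k < d) m k * inp k alpha else res j).
  move=> j; case: eqP => [_|/eqP j0]; first exact: a2.
  by apply: avail_extends e2 (a1 j _); rewrite lt0n j0 ltn_ord.
exists P.
  move=> alpha k; under eq_bigr => l _ do rewrite rP.
  rewrite (sum_ord1 (fun l => (if l == 0%N then fun alpha => \sum_(0 <= k < d) m k * inp k alpha
    else res l) alpha * v_val k l)) /=.
  rewrite -(inp_val alpha k) -(res_interp alpha (ltn_ord k)) /interp {1}/v_val eqxx mulr1.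
  have -> : \sum_(0 <= i < d) m i * inp i alpha = res 0 alpha + c1 E * \sum_(1 <= l < d) res l alpha.
    rewrite /res exchange_big /= mulr_sumr -big_split /=; apply: eq_bigr => i _.
    by rewrite /m mulrDl -mulrA mulr_suml.
  rewrite -addrA mulr_sumr -big_split /=; congr (_ + _); apply: eq_big_nat => l /andP[l0 _].
  by rewrite /v_val eqn0Ngt l0 /=; ring.
have [x ex hx] := extends_trans e1 e2.
rewrite hP ex /=; apply: leq_trans hx _.
have : (d <= delta * d)%N by rewrite leq_pmull.
lia.
Qed.

(* Summation by parts turns coordinates on [u] into residues: since the residues
   at [lt] sum to 0, the coordinate on [u_l] is a constant minus the sum of the
   residues at [t, ..., lt], and the constant is a linear form in the values. *)
Definition psum l : ('I_d -> K) -> K := fun alpha => \sum_(1 <= i < l.+1) res i alpha.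
Definition wt l : K := kap l + (1 - kap_sum) / d%:R.
Definition gam : ('I_d -> K) -> K :=
  fun alpha => res 0 alpha + \sum_(l < d) psum l alpha * wt l.

Lemma gam_lin alpha : gam alpha
  = \sum_(0 <= i < d) (M 0%N i + \sum_(l < d) (\sum_(1 <= j < l.+1) M j i) * wt l) * inp i alpha.
Proof.
under [RHS]eq_bigr => i _ do rewrite mulrDl mulr_suml.
rewrite big_split /= exchange_big /=; congr (_ + _); apply: eq_bigr => l _.
rewrite /psum /res exchange_big /= mulr_suml; apply: eq_bigr => i _.
by rewrite -mulr_suml mulrAC.
Qed.

Lemma prefix_code c L : (L <= d)%N -> avail c gam -> (forall l, (0 < l < d)%N -> avail c (res l)) ->
  exists2 c', extends (3 * L) c c'
    & forall l, (l < L)%N -> avail c' (fun alpha => gam alpha - psum l alpha).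
Proof.
move=> + hg hr; elim: L => [|L IH] hL; first by exists c => //; exact: extends_refl.
have [c1' e1 a1] := IH (ltnW hL).
have [c2 e2 a2] : exists2 c2, extends 3 c1' c2 & avail c2 (fun alpha => gam alpha - psum L alpha).
  case: L hL {IH} e1 a1 => [|L] hL e1 a1.
    exists c1'; first exact: extends_le (leq0n _) (extends_refl _).
    by apply: avail_ext (avail_extends e1 hg) => alpha; rewrite /psum big_geq // subr0.
  have hrL : avail c1' (res L.+1) by apply: avail_extends e1 (hr _ _).
  have [c2 e2 a2] := avail_comb 1 (-1) (a1 L (ltnSn L)) hrL.
  exists c2 => //; apply: avail_ext a2 => alpha.
  by rewrite /psum [in RHS]big_nat_recr //=; ring.
exists c2; first by rewrite mulnS addnC; exact: extends_trans e1 e2.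
move=> l; rewrite ltnS leq_eqVlt => /orP[/eqP->//|hl].
exact: avail_extends e2 (a1 l hl).
Qed.

Lemma u_coordinates alpha k : (k < d)%N ->
  \sum_(l < d) (gam alpha - psum l alpha) * u_val k l = inp k alpha.
Proof.
move=> hk; rewrite -(res_interp alpha hk) /interp.
pose S l := s (node k) (- (t *+ l)).
have S0 : S 0%N = 0 by rewrite /S mulr0n oppr0 (lev_sC (curve_level two_neq0 disc_neq0)) (lev_s0 (curve_level two_neq0 disc_neq0)).
have Sd : S d = 0 by rewrite /S td -(mulr0n t) -/(S 0%N).
have uE l : u_val k l = (S l.+1 - S l) + wt l by rewrite /u_val /a_val /wt -[LHS]addrA.
(* The normalisation of the u_l makes them sum to 1 at the nodes, so adding [gam] to every
   coordinate adds the constant [gam]. *)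
have swt : \sum_(l < d) wt l = 1.
  rewrite /wt big_split /= -/kap_sum sumr_const card_ord -[X in _ + X]mulr_natr divfK //.
  by rewrite addrC subrK.
under eq_bigr => l _ do rewrite uE mulrDr.
rewrite big_split /= [X in _ + X](_ : _ = res 0 alpha); last first.
  under eq_bigr => l _ do rewrite mulrBl.
  by rewrite sumrB -mulr_sumr swt mulr1 /gam addrK.
rewrite addrC; congr (_ + _).
under eq_bigr => l _ do rewrite mulrBl.
rewrite sumrB -mulr_sumr.
rewrite -(big_mkord xpredT (fun l => S l.+1 - S l)) telescope_sumr ?leq0n // S0 Sd subrr mulr0 sub0r.
under [in LHS]eq_bigr => l _ do rewrite mulrBr.
rewrite sumrB opprB.
rewrite -(big_mkord xpredT (fun l => psum l alpha * S l)).
rewrite -(big_mkord xpredT (fun l => psum l alpha * S l.+1)).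
rewrite big_ltn ?d_gt0 // S0 mulr0 add0r.
have -> : \sum_(0 <= l < d) psum l alpha * S l.+1 = \sum_(1 <= l < d) psum l.-1 alpha * S l.
  rewrite -[in LHS](prednK d_gt0) big_nat_recr //= prednK ?d_gt0 // Sd mulr0 addr0.
  by rewrite [RHS]big_add1.
rewrite -sumrB; apply: eq_big_nat => l /andP[l0 _].
rewrite -mulrBl; congr (_ * _).
by rewrite /psum prednK // [X in X - _]big_nat_recr //= addrAC subrr add0r.
Qed.

Lemma program_u : exists2 P, solves u_val P & (slp_cost P <= 17 * delta * d)%N.
Proof.
have [c1' e1 a1] := res_code.
have [c2 e2 a2] := @avail_lin K d d c1'
  (fun i => M 0%N i + \sum_(l < d) (\sum_(1 <= j < l.+1) M j i) * wt l)
  (inp (n := d)) (fun k _ => inp_avail c1' k).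
have hg : avail c2 gam by apply: avail_ext a2 => alpha; rewrite gam_lin.
have [c3 e3 a3] := prefix_code (leqnn d) hg (fun l hl => avail_extends e2 (a1 l hl)).
have [|P [hP rP]] := @slp_of_avail K d d c3 (fun j alpha => gam alpha - psum j alpha).
  by move=> j; exact: a3.
exists P.
  move=> alpha k; under eq_bigr => l _ do rewrite rP.
  by rewrite u_coordinates // inp_val.
(* 12 delta d for the residues, 2d for [gam], 3d for the prefix sums; 5d is at most 5 delta d,
   whence 17. *)
have [x ex hx] := extends_trans (extends_trans e1 e2) e3.
rewrite hP ex /=; apply: leq_trans hx _.
have : (d <= delta * d)%N by rewrite leq_pmull.
lia.
Qed.

End Coordinates.

Lemma interpolation_program (w : 'I_d -> funfield E) :
  w = u_basis E (pt t) d \/ w = v_basis E (pt t) d ->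
  exists P : slp K d d,
    (forall alpha : 'I_d -> K,
       let f := \sum_(l < d) fc (slp_run alpha P l) * w l in
       in_RR (cyc E (pt t) d) f /\ forall k : 'I_d, value_at f (pt (node k)) (alpha k))
    /\ (slp_cost P <= 17 * delta * d)%N.
Proof.
have [M hM] := solution.
case=> ->.
  have [P hP cP] := program_u hM; exists P; split=> // alpha f.
  split; first by apply: RR_comb => v l; exact: u_polar.
  move=> k; rewrite -(hP alpha k); apply: value_comb; first exact: node0.
  by move=> l; exact: u_value.
have [P hP cP] := program_v hM; exists P; split=> // alpha f.
split; first by apply: RR_comb => v l; exact: v_polar.
move=> k; rewrite -(hP alpha k); apply: value_comb; first exact: node0.
by move=> l; exact: v_value.
Qed.

End Final.

Theorem proposition4 (R : realType) :
  exists Q : R, 0 < Q /\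
  forall (K : fieldType) (p : nat) (E : weierstrass K) (delta : nat)
         (t b : point K),
    p \in [pchar K] -> odd p ->
    disc E != 0 ->
    (1 <= delta)%N ->
    let d := (2 ^ delta)%N in
    on_curve E t -> has_order E t d ->
    on_curve E b -> mulpt E d b <> None ->
    forall w : 'I_d -> funfield E,
      w = u_basis E t d \/ w = v_basis E t d ->
    exists P : slp K d d,
      (forall alpha : 'I_d -> K,
         let f := \sum_(l < d) fcst E (slp_run alpha P l) * w l in
         in_RR (cyc E t d) f /\
         (forall l : 'I_d, value_at f (addpt E b (mulpt E l t)) (alpha l)))
      /\ (slp_cost P)%:R <= Q * d%:R * ln (d%:R : R).
Proof.
have ln2 : 0 < ln (2%:R : R) by rewrite ln_gt0 // ltr1n.
(* The program costs at most 17 delta d, and delta = ln d / ln 2. *)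
exists (17%:R / ln 2%:R); split; first by rewrite divr_gt0 // ltr0n.
move=> K p E delta t b hp op disc_neq0 delta_gt0 d ht [_ td tk] hb bd w hw.
have two_neq0 : (2%:R : K) != 0.
  rewrite -(dvdn_pcharf hp) dvdn_prime2 ?(pcharf_prime hp) //.
  by apply: contraTneq op => ->.
have d_neq0 : (d%:R : K) != 0 by rewrite natrX expf_neq0.
pose T : ecpt two_neq0 disc_neq0 := exist _ t ht.
pose B : ecpt two_neq0 disc_neq0 := exist _ b hb.
have hd : (0 < d)%N by rewrite expn_gt0.
have td0 : T *+ d = 0 by apply: pt_eq0; rewrite ptMn.
have hcyc : cyclic_data B T (@zeroG K E two_neq0 disc_neq0) d.
  split; last by apply/negP => /eqP e; apply: bd; rewrite -(ptMn B) e.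
  move=> k; rewrite /zeroG /=; apply/eqP/idP => [e|/dvdnP[q ->]]; last first.
    by rewrite mulnC mulrnA td0 mul0rn.
  have e' : T *+ (k %% d) = 0.
    by move: e; rewrite {1}(divn_eq k d) mulrnDr mulnC mulrnA td0 mul0rn add0r.
  rewrite /dvdn; apply/eqP; apply/eqP; rewrite -leqn0 leqNgt; apply/negP => k0.
  apply: (tk (k %% d)%N); first by rewrite k0 ltn_pmod.
  by rewrite -(ptMn T) e'.
have [P [hP cP]] := interpolation_program delta_gt0 hcyc d_neq0 hw.
exists P; split.
  move=> alpha; have [h1 h2] := hP alpha; split; first exact: h1.
  move=> l; have := h2 l; rewrite /node ptD ptMn.
  by [].
rewrite natrX lnXn ?ltr0n //.
apply: (@le_trans _ _ (17 * delta * d)%:R); first by rewrite ler_nat.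
rewrite -natrX !natrM.
have -> : 17%:R / ln 2%:R * d%:R * (ln 2%:R *+ delta) = 17%:R * delta%:R * d%:R :> R.
  by rewrite -mulr_natr; field; rewrite gt_eqF.
by [].
Qed.
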